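(* Let $\boldsymbol{k}\in\mathbb{Z}_+^m$ be a partition of $n$ with $m\geq 2$ and let $j\in\{1,\dots,m\}$ be given. Let $a\in L^\infty(\mathbb{B}^n)$ be a $(\boldsymbol{k},j)$-quasi-radial quasi-homogeneous symbol, and let $f\in L^\infty(\tau(\mathbb{B}^m)\times\mathbb{S}^{k_j})$ be the corresponding function, i.e. $f(r,\eta\xi)=f(r,\xi)$ for every $r\in\tau(\mathbb{B}^m)$, $\xi\in\mathbb{S}^{k_j}$, $\eta\in\mathbb{T}$, and $a(z)=f(|z_{(1)}|,\dots,|z_{(m)}|,\xi_{(j)})$ for almost every $z\in\mathbb{B}^n$. Then for every $\lambda>-1$ and $\boldsymbol{\kappa}\in\mathbb{N}^m$ we have \[ \begin{aligned} \langle T_a^{(\lambda)}(z^\alpha),z^\beta\rangle_\lambda = {}& \frac{2^{m-1}\,\Gamma(n+\lambda+1)\,\alpha_{\widehat{(j)}}!}{\pi^{k_j}\,\Gamma(\lambda+1)\prod_{l\neq j}(k_l+\kappa_l-1)!} \\ &\times\int_{\tau(\mathbb{B}^m)\times\mathbb{S}^{k_j}} f(r,\xi_{(j)})\,{\xi_{(j)}}^{\alpha_{(j)}}\,{\overline{\xi}_{(j)}}^{\beta_{(j)}}\,(1-|r|^2)^\lambda\prod_{l=1}^m r_l^{2k_l+2\kappa_l-1}\,dr_l\,d\xi_{(j)} \end{aligned} \] for every $\alpha,\beta\in\mathbb{N}^n$ such that $|\alpha_{(l)}|=|\beta_{(l)}|=\kappa_l$ for all $l=1,\dots,m$ and that satisfy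 $\alpha_{\widehat{(j)}}=\beta_{\widehat{(j)}}$.
   Context: Here $\mathbb{N}=\{0,1,2,\dots\}$, $\mathbb{Z}_+$ is the set of positive integers, $\mathbb{R}_+=[0,\infty)$, and $\tau(\mathbb{B}^m)=\{r\in\mathbb{R}_+^m : |r|<1\}$ with $|r|$ the Euclidean norm. $\mathbb{B}^n$ is the open unit ball of $\mathbb{C}^n$ with Lebesgue measure $v$. For $\lambda>-1$, $dv_\lambda(z) = c_\lambda (1-|z|^2)^\lambda dv(z)$ with $c_\lambda = \frac{\Gamma(n+\lambda+1)}{\pi^n\Gamma(\lambda+1)}$, and $\mathcal{A}^2_\lambda(\mathbb{B}^n)$ is the closed subspace of holomorphic functions in $L^2(\mathbb{B}^n,v_\lambda)$, with inner product $\langle\cdot,\cdot\rangle_\lambda$ and orthogonal projection $B_\lambda$. For $a\in L^\infty(\mathbb{B}^n)$ the Toeplitz operator is $T_a^{(\lambda)}(f)=B_\lambda(af)$ on $\mathcal{A}^2_\lambda(\mathbb{B}^n)$. A partition of $n$ is $\boldsymbol{k}=(k_1,\dots,k_m)\in\mathbb{Z}_+^m$ with $k_1+\dots+k_m=n$. It gives $\mathbb{C}^n=\mathbb{C}^{k_1}\times\dots\times\mathbb{C}^{k_m}$, $z=(z_{(1)},\dots,z_{(m)})$ and, for multi-indices, $\alpha=(\alpha_{(1)},\dots,\alpha_{(m)})\in\mathbb{N}^n$ with $\alpha_{(l)}\in\mathbb{N}^{k_l}$. Also $\alpha_{\widehat{(j)}}=(\alpha_{(1)},\dots,\alpha_{(j-1)},\alpha_{(j+1)},\dots,\alpha_{(m)})\in\mathbb{N}^{n-k_j}$.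 $\mathbb{S}^{k_j}$ denotes the unit sphere in $\mathbb{C}^{k_j}$ (of real dimension $2k_j-1$), $d\xi_{(j)}$ the measure on it coming from the Riemannian structure inherited from $\mathbb{C}^{k_j}$, and one writes $z_{(j)}=|z_{(j)}|\xi_{(j)}$ with $\xi_{(j)}\in\mathbb{S}^{k_j}$. A symbol $a\in L^\infty(\mathbb{B}^n)$ is $(\boldsymbol{k},j)$-quasi-radial quasi-homogeneous if $a\circ A=a$ for all $A$ in the block diagonal subgroup $\mathrm{U}(\boldsymbol{k},j,\mathbb{T})=\mathrm{U}(k_1)\times\dots\times\mathrm{U}(k_{j-1})\times\mathbb{T}I_{(j)}\times\mathrm{U}(k_{j+1})\times\dots\times\mathrm{U}(k_m)$ of $\mathrm{U}(n)$, $I_{(j)}$ being the identity of $\mathbb{C}^{k_j}$; this is equivalent to the existence of a function $f$ as in the claim. *)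

(* Defs.v *)
From HB Require Import structures.
Set Warnings "-all".
From mathcomp Require Import all_boot all_order all_algebra.
From mathcomp Require Import perm complex ring lra.
From mathcomp Require Import all_classical all_reals all_analysis.
From mathcomp Require Import measurable_realfun.

Set Implicit Arguments.
Unset Strict Implicit.
Unset Printing Implicit Defensive.
Import Order.TTheory GRing.Theory Num.Theory.
Import numFieldNormedType.Exports.

Local Open Scope classical_set_scope.
Local Open Scope ring_scope.

(* R[i] as a normed space over itself, so that differentiability over R[i] is
   complex differentiability. *)
HB.instance Definition _ (R : realType) := NormedModule.copy R[i] R[i]^o.

(* The product sigma-algebra on matrices. *)
Definition measure_matrix_display : measure_display -> measure_display.
Proof. exact. Qed.

Section measurable_matrix.
Context {d} {T : measurableType d}.
Variables m n : nat.

Definition matrix_sigma_algebra : set (set 'M[T]_(m, n)) :=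
  <<s \bigcup_(ij in [set: 'I_m * 'I_n])
        preimage_set_system setT (fun M : 'M[T]_(m, n) => M ij.1 ij.2)
          measurable >>.

Let matrix_set0 : matrix_sigma_algebra set0.
Proof. exact: sigma_algebra0. Qed.

Let matrix_setC A : matrix_sigma_algebra A -> matrix_sigma_algebra (~` A).
Proof. exact: sigma_algebraC. Qed.

Let matrix_bigcup (F : _^nat) : (forall i, matrix_sigma_algebra (F i)) ->
  matrix_sigma_algebra (\bigcup_i (F i)).
Proof. exact: sigma_algebra_bigcup. Qed.

HB.instance Definition _ := @isMeasurable.Build (measure_matrix_display d)
  'M[T]_(m, n) matrix_sigma_algebra matrix_set0 matrix_setC matrix_bigcup.

End measurable_matrix.

Lemma measurable_coord d (T : measurableType d) m n i j :
  measurable_fun [set: 'M[T]_(m, n)] (fun M : 'M[T]_(m, n) => M i j).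
Proof.
move=> _ Y mY; rewrite setTI; apply: sub_sigma_algebra.
by exists (i, j) => //; exists Y => //; rewrite setTI.
Qed.

Lemma measurable_fun_matrixP d d' (T : measurableType d)
    (T' : measurableType d') m n (f : T' -> 'M[T]_(m, n)) :
  (forall i j, measurable_fun [set: T'] (fun x => f x i j)) ->
  measurable_fun [set: T'] f.
Proof.
move=> mf; apply: (measurability (\bigcup_(ij in [set: 'I_m * 'I_n])
  preimage_set_system setT (fun M : 'M[T]_(m, n) => M ij.1 ij.2) measurable)).
  by [].
move=> _ [_ [[i j] _ [B mB <-]] <-]; rewrite !setTI.
by have := mf i j measurableT B mB; rewrite setTI.
Qed.

(* The sigma-algebra of R[i] seen as R x R. *)
Definition measure_complex_display : measure_display -> measure_display.
Proof. exact. Qed.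

Section measurable_complex.
Variable R : realType.

Definition complex_sigma_algebra : set (set R[i]) :=
  <<s preimage_set_system setT (@complex.Re R) measurable `|`
      preimage_set_system setT (@complex.Im R) measurable >>.

Let complex_set0 : complex_sigma_algebra set0.
Proof. exact: sigma_algebra0. Qed.

Let complex_setC A : complex_sigma_algebra A -> complex_sigma_algebra (~` A).
Proof. exact: sigma_algebraC. Qed.

Let complex_bigcup (F : _^nat) : (forall i, complex_sigma_algebra (F i)) ->
  complex_sigma_algebra (\bigcup_i (F i)).
Proof. exact: sigma_algebra_bigcup. Qed.

HB.instance Definition _ :=
  @isMeasurable.Build (measure_complex_display default_measure_display)
  R[i] complex_sigma_algebra complex_set0 complex_setC complex_bigcup.

End measurable_complex.

Section measurable_complex_lemmas.
Variable R : realType.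

Lemma measurable_Re : measurable_fun [set: R[i]] (@complex.Re R).
Proof.
move=> _ Y mY; rewrite setTI; apply: sub_sigma_algebra.
by left; exists Y => //; rewrite setTI.
Qed.

Lemma measurable_Im : measurable_fun [set: R[i]] (@complex.Im R).
Proof.
move=> _ Y mY; rewrite setTI; apply: sub_sigma_algebra.
by right; exists Y => //; rewrite setTI.
Qed.

Lemma measurable_fun_complexP d (T : measurableType d) (f : T -> R[i]) :
  measurable_fun [set: T] (fun x => complex.Re (f x)) ->
  measurable_fun [set: T] (fun x => complex.Im (f x)) ->
  measurable_fun [set: T] f.
Proof.
move=> mr mi; apply: (measurability
  (preimage_set_system setT (@complex.Re R) measurable `|`
   preimage_set_system setT (@complex.Im R) measurable)).
  by [].
move=> _ [_ [|] [B mB <-] <-]; rewrite !setTI.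
- by have := mr measurableT B mB; rewrite setTI.
- by have := mi measurableT B mB; rewrite setTI.
Qed.

End measurable_complex_lemmas.

Lemma sigma_finite_product d1 d2 (T1 : measurableType d1)
    (T2 : measurableType d2) (R : realType)
    (m1 : {sigma_finite_measure set T1 -> \bar R})
    (m2 : {sigma_finite_measure set T2 -> \bar R}) :
  sigma_finite [set: T1 * T2] (m1 \x m2)%E.
Proof.
have /sigma_finiteP[F [TF ndF Foo]] := sigma_finiteT m1.
have /sigma_finiteP[G [TG ndG Goo]] := sigma_finiteT m2.
exists (fun n => F n `*` G n).
  rewrite -setXTT TF TG predeqE => -[x y]; split.
    move=> [/= [n _ Fnx] [k _ Gky]]; exists (maxn n k) => //; split.
    - by move: x Fnx; exact/subsetPset/ndF/leq_maxl.
    - by move: y Gky; exact/subsetPset/ndG/leq_maxr.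
  by move=> [n _ []/= ? ?]; split; exists n.
move=> k; have [? ?] := Foo k; have [? ?] := Goo k.
split; first exact: measurableX.
by rewrite product_measure1E// lte_mul_pinfty// ge0_fin_numE.
Qed.

(* Push-forward along a measurable map with a measurable left inverse; the
   left inverse only serves to show that the image measure is sigma-finite. *)
Section image_measure.
Context d d' (T : measurableType d) (T' : measurableType d') (R : realType).
Variables (mu : {measure set T -> \bar R}) (f : T -> T') (g : T' -> T).
Hypothesis mu_sigma_finite : sigma_finite [set: T] mu.
Hypotheses (mf : measurable_fun [set: T] f) (mg : measurable_fun [set: T'] g).
Hypothesis fK : cancel f g.

Definition image_measure (_ : sigma_finite [set: T] mu)
    (_ : measurable_fun [set: T] f) (_ : measurable_fun [set: T'] g)
    (_ : cancel f g) : set T' -> \bar R :=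
  pushforward mu f.

Local Notation nu := (image_measure mu_sigma_finite mf mg fK).

Let nu0 : nu set0 = 0%E.
Proof. by rewrite /image_measure /pushforward preimage_set0 measure0. Qed.

Let nu_ge0 A : (0 <= nu A)%E.
Proof. exact: measure_ge0. Qed.

Let nu_sigma_additive : semi_sigma_additive nu.
Proof.
move=> F mF tF mUF; rewrite /image_measure /pushforward preimage_bigcup.
have mfF A : measurable A -> measurable (f @^-1` A).
  by move=> mA; rewrite -[X in measurable X]setTI; exact: mf.
apply: measure_semi_sigma_additive => [k||].
- exact/mfF/mF.
- apply/trivIsetP => i j _ _ ij; rewrite -preimage_setI.
  by move/trivIsetP : tF => /(_ _ _ _ _ ij) ->//; rewrite preimage_set0.
- by rewrite -preimage_bigcup; exact: mfF.
Qed.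

HB.instance Definition _ := isMeasure.Build _ _ _ nu
  nu0 nu_ge0 nu_sigma_additive.

Let nu_sigma_finite : sigma_finite [set: T'] nu.
Proof.
have [F FT Ffin] := mu_sigma_finite.
exists (fun k => g @^-1` F k).
  by rewrite -preimage_bigcup -FT preimage_setT.
move=> k; have [mFk Fkoo] := Ffin k; split.
  by rewrite -[X in measurable X]setTI; exact: mg.
rewrite /image_measure /pushforward -comp_preimage.
by rewrite (_ : g \o f = id) ?preimage_id//; apply/funext => x /=; rewrite fK.
Qed.

HB.instance Definition _ := @Measure_isSigmaFinite.Build _ _ _ nu
  nu_sigma_finite.

End image_measure.

Section lebesgue_cV.
Variable R : realType.

Definition cV_cons n (x : R * 'cV[R]_n) : 'cV[R]_n.+1 :=
  col_mx (x.1%:M : 'cV[R]_1) x.2.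

Definition cV_uncons n (x : 'cV[R]_n.+1) : R * 'cV[R]_n :=
  ((usubmx (x : 'cV[R]_(1 + n))) 0 0, dsubmx (x : 'cV[R]_(1 + n))).

Lemma cV_consK n : cancel (@cV_cons n) (@cV_uncons n).
Proof.
by case=> x y; rewrite /cV_uncons /cV_cons/= col_mxKu col_mxKd mxE eqxx.
Qed.

Lemma measurable_cV_cons n : measurable_fun [set: R * 'cV[R]_n] (@cV_cons n).
Proof.
apply: measurable_fun_matrixP => i j; rewrite ord1.
have [k ->|k ->] := split_ordP (i : 'I_(1 + n)).
  rewrite (_ : (fun _ => _) = fst)//; apply/funext => x.
  by rewrite [LHS]col_mxEu mxE ord1 eqxx.
rewrite (_ : (fun _ => _) = (fun M : 'cV[R]_n => M k 0) \o snd).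
  by apply: measurableT_comp => //; exact: measurable_coord.
by apply/funext => x; rewrite [LHS]col_mxEd.
Qed.

Lemma measurable_cV_uncons n :
  measurable_fun [set: 'cV[R]_n.+1] (@cV_uncons n).
Proof.
apply/measurable_fun_pairP; split.
  rewrite (_ : _ \o _ = fun x : 'cV[R]_n.+1 => x (lshift n (0 : 'I_1)) 0).
    exact: measurable_coord.
  by apply/funext => x /=; rewrite mxE.
apply: measurable_fun_matrixP => i j.
rewrite (_ : (fun _ => _) = fun x : 'cV[R]_n.+1 => x (rshift 1 i) j).
  exact: measurable_coord.
by apply/funext => x /=; rewrite mxE.
Qed.

Fixpoint lebesgue_cV n : {sigma_finite_measure set 'cV[R]_n -> \bar R} :=
  if n is k.+1 then
    image_measure (sigma_finite_product (@lebesgue_measure R) (lebesgue_cV k))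
      (@measurable_cV_cons k) (@measurable_cV_uncons k) (@cV_consK k)
  else \d_(0 : 'cV[R]_0).

End lebesgue_cV.

(* Riemannian volume of the unit sphere of R^(n+1), for the metric inherited
   from R^(n+1), in the two graph charts y |-> (+-sqrt(1 - |y|^2), y) over the
   open unit ball of R^n: the volume density of a chart is the square root of
   the Gram determinant of its partial derivatives.  The two charts miss only
   the equator, which is a null set. *)
Section sphere.
Variable R : realType.

Definition sqnorm n (y : 'cV[R]_n) : R := \sum_i y i 0 ^+ 2.

Definition metric n p (phi : 'cV[R]_n -> 'cV[R]_p) (y : 'cV[R]_n) : 'M[R]_n :=
  \matrix_(i, j) \sum_l ('D_(delta_mx i 0) phi y) l 0 *
                         ('D_(delta_mx j 0) phi y) l 0.

Definition volume_density n p (phi : 'cV[R]_n -> 'cV[R]_p) y : R :=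
  Num.sqrt (\det (metric phi y)).

Definition chart_domain n : set 'cV[R]_n := [set y | sqnorm y < 1].
Arguments chart_domain : clear implicits.

Definition chart (s : bool) n (y : 'cV[R]_n) : 'cV[R]_n.+1 :=
  cV_cons ((-1) ^+ s * Num.sqrt (1 - sqnorm y), y).

Definition hemisphere_measure (s : bool) n (A : set 'cV[R]_n.+1) : \bar R :=
  (\int[lebesgue_cV R n]_(y in chart_domain n `&` @chart s n @^-1` A)
     (volume_density (@chart s n) y)%:E)%E.

Lemma is_derive_line n (f : 'cV[R]_n -> R) (y v : 'cV[R]_n) (df : R) :
  is_derive (0 : R) 1 (fun h : R => f (h *: v + y)) df -> is_derive y v f df.
Proof.
move=> [dex dval].
have E : (fun h : R => h^-1 *: ((f \o shift y) (h *: v) - f y)) =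
    (fun h : R => h^-1 *: (((fun h : R => f (h *: v + y)) \o shift 0) (h *: 1)
                           - f (0 *: v + y))).
  by apply/funext => h /=; rewrite addr0 scale0r add0r [h *: 1]mulr1.
split; first by rewrite /derivable E; exact: dex.
by rewrite /derive E; exact: dval.
Qed.

Lemma sqnorm_line n (y v : 'cV[R]_n) (h : R) :
  sqnorm (h *: v + y) =
  sqnorm y + h * (2 * \sum_i y i 0 * v i 0) + h ^+ 2 * sqnorm v.
Proof.
rewrite /sqnorm !mulr_sumr -!big_split/=; apply: eq_bigr => i _.
by rewrite !mxE; ring.
Qed.

Lemma is_derive_chart0 (s : bool) n (y v : 'cV[R]_n) : chart_domain n y ->
  is_derive y v (fun z : 'cV[R]_n => (-1) ^+ s * Num.sqrt (1 - sqnorm z))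
    ((-1) ^+ s * - ((\sum_i y i 0 * v i 0) / Num.sqrt (1 - sqnorm y))).
Proof.
rewrite /chart_domain/= => y1; apply: is_derive_line.
set b := \sum_i _; set a := sqnorm y; set c := sqnorm v.
rewrite (_ : (fun _ => _) =
    (fun h : R => (-1) ^+ s * Num.sqrt ((1 - a) - h * (2 * b) - h ^+ 2 * c))).
  2: { apply/funext => h; rewrite sqnorm_line -/a -/b -/c; congr (_ * Num.sqrt _); ring. }
have a1 : 0 < 1 - a by rewrite subr_gt0.
have inner : is_derive (0 : R) 1
    (fun h : R => (1 - a) - h * (2 * b) - h ^+ 2 * c) (- (2 * b)).
  apply: is_derive_eq.
  rewrite expr0n/= !scale0r !(addr0, scaler0, add0r) mul1r subr0.
  by rewrite [(2 * b)%:A]mulr1.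
have outer : is_derive ((1 - a) - 0 * (2 * b) - 0 ^+ 2 * c) 1 Num.sqrt
    (2 * Num.sqrt (1 - a))^-1.
  by rewrite mul0r expr0n/= mul0r !subr0; exact: is_derive1_sqrt.
have comp := @is_derive1_comp R Num.sqrt
  (fun h : R => (1 - a) - h * (2 * b) - h ^+ 2 * c) 0 _ _ outer inner.
have := is_deriveZ ((-1) ^+ s : R) comp.
rewrite (_ : _ *: _ = (-1) ^+ s * - (b / Num.sqrt (1 - a)))//.
rewrite [LHS]/GRing.scale/=; congr (_ * _).
by rewrite invfM; field; rewrite sqrtr_eq0 -ltNge.
Qed.


Lemma is_derive_coord n (y v : 'cV[R]_n) k :
  is_derive y v (fun z : 'cV[R]_n => z k 0) (v k 0).
Proof.
apply: is_derive_line.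
rewrite (_ : (fun _ => _) = (fun h : R => h * v k 0 + y k 0)).
  2: { by apply/funext => h; rewrite !mxE. }
by apply: is_derive_eq; rewrite scaler0 add0r addr0 [LHS]mulr1.
Qed.

Lemma derive_chart (s : bool) n (y v : 'cV[R]_n) : chart_domain n y ->
  'D_v (@chart s n) y =
  cV_cons ((-1) ^+ s * - ((\sum_i y i 0 * v i 0) / Num.sqrt (1 - sqnorm y)), v).
Proof.
move=> Dy; have top := is_derive_chart0 s v Dy.
have comp i j : is_derive y v (fun z : 'cV[R]_n => chart s z i j)
    (cV_cons ((-1) ^+ s * - ((\sum_i y i 0 * v i 0) /
       Num.sqrt (1 - sqnorm y)), v) i j).
  rewrite ord1; have [k ->|k ->] := split_ordP (i : 'I_(1 + n)).
    rewrite [X in is_derive _ _ _ X](_ : _ = (-1) ^+ s * - ((\sum_i y i 0 *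
        v i 0) / Num.sqrt (1 - sqnorm y))).
      2: { by rewrite [LHS]col_mxEu mxE ord1 eqxx. }
    rewrite [X in is_derive _ _ X _](_ : _ = fun z : 'cV[R]_n =>
        (-1) ^+ s * Num.sqrt (1 - sqnorm z))//.
    by apply/funext => z; rewrite [LHS]col_mxEu mxE ord1 eqxx.
  rewrite [X in is_derive _ _ _ X](_ : _ = v k 0).
    2: { by rewrite [LHS]col_mxEd. }
  rewrite [X in is_derive _ _ X _](_ : _ = fun z : 'cV[R]_n => z k 0).
    2: { by apply/funext => z; rewrite [LHS]col_mxEd. }
  exact: is_derive_coord.
rewrite derive_mx; last by apply/derivable_mxP => i j; have [] := comp i j.
by apply/matrixP => i j; rewrite mxE; have [_ ->] := comp i j.
Qed.

Lemma metric_chart (s : bool) n (y : 'cV[R]_n) i j : chart_domain n y ->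
  metric (@chart s n) y i j =
  (i == j)%:R + y i 0 * y j 0 * (1 - sqnorm y) `^ (-1).
Proof.
move=> Dy; have y1 : 0 < 1 - sqnorm y by rewrite subr_gt0.
have sumE k : \sum_l y l 0 * (delta_mx k 0 : 'cV[R]_n) l 0 = y k 0.
  rewrite (bigD1 k)//= !mxE !eqxx mulr1 big1 ?addr0// => l lk.
  by rewrite mxE (negPf lk) mulr0.
rewrite mxE !derive_chart// !sumE big_ord_recl addrC; congr (_ + _).
  transitivity (\sum_(l < n) (delta_mx i 0 : 'cV[R]_n) l 0 *
                             (delta_mx j 0 : 'cV[R]_n) l 0).
    apply: eq_bigr => l _.
    have E w (c : R) : cV_cons (c, w) (lift ord0 l) 0 = w l 0.
      by rewrite /cV_cons -rshift1 [LHS]col_mxEd.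
    by rewrite !E.
  rewrite (bigD1 i)//= !mxE !eqxx mul1r andbT big1 ?addr0// => l li.
  by rewrite mxE (negPf li) mul0r.
have E w (c : R) : @cV_cons R n (c, w) ord0 0 = c.
  have -> : ord0 = lshift n (0 : 'I_1) by apply/val_inj.
  by rewrite [LHS]col_mxEu mxE eqxx.
rewrite !E powR_inv1 ?ltW// mulrACA -expr2 sqrr_sign mul1r mulrNN mulrACA.
by rewrite -invfM -expr2 sqr_sqrtr// ltW.
Qed.

Lemma volume_density_chart (s s' : bool) n (y : 'cV[R]_n) : chart_domain n y ->
  volume_density (@chart s n) y = volume_density (@chart s' n) y.
Proof.
move=> Dy; rewrite /volume_density; congr (Num.sqrt (\det _)).
by apply/matrixP => i j; rewrite !metric_chart.
Qed.

Lemma measurable_sqnorm n : measurable_fun [set: 'cV[R]_n] (@sqnorm n).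
Proof.
apply: measurable_sum => i; apply: measurable_funX; exact: measurable_coord.
Qed.

Lemma measurable_chart_domain n : measurable (chart_domain n).
Proof.
rewrite (_ : chart_domain n = [set: 'cV[R]_n] `&` @sqnorm n @^-1` `]-oo, 1[).
  exact: measurable_sqnorm.
by rewrite setTI; apply/seteqP; split => y /=; rewrite in_itv.
Qed.

Lemma measurable_chart (s : bool) n :
  measurable_fun [set: 'cV[R]_n] (@chart s n).
Proof.
apply: (@measurableT_comp _ _ _ _ _ _ (@cV_cons R n) _ (fun y : 'cV[R]_n =>
  ((-1) ^+ s * Num.sqrt (1 - sqnorm y), y))); first exact: measurable_cV_cons.
apply: measurable_fun_pair => //; apply: measurable_funM => //.
apply: (@measurableT_comp _ _ _ _ _ _ (@Num.sqrt R) _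
  (fun y : 'cV[R]_n => 1 - sqnorm y)).
  by apply: continuous_measurable_fun; exact: sqrt_continuous.
by apply: measurable_funB => //; exact: measurable_sqnorm.
Qed.

Lemma measurable_volume_density (s : bool) n :
  measurable_fun (chart_domain n) (volume_density (@chart s n)).
Proof.
apply: (@measurableT_comp _ _ _ _ _ _ (@Num.sqrt R) _
  (fun y => \det (metric (@chart s n) y))).
  by apply: continuous_measurable_fun; exact: sqrt_continuous.
apply: measurable_sum => p; apply: measurable_funM => //.
apply: measurable_prod => i _.
apply: (eq_measurable_fun (fun y : 'cV[R]_n =>
  (i == p i)%:R + y i 0 * y (p i) 0 * (1 - sqnorm y) `^ (-1))).
  by move=> y; rewrite inE => Dy; rewrite metric_chart.
apply: measurable_funTS; apply: measurable_funD => //.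
apply: measurable_funM.
  by apply: measurable_funM; exact: measurable_coord.
apply: (@measurableT_comp _ _ _ _ _ _ (fun x : R => x `^ (-1)) _
  (fun y : 'cV[R]_n => 1 - sqnorm y)); first exact: measurable_powR.
by apply: measurable_funB => //; exact: measurable_sqnorm.
Qed.

Let measurable_chart_preimage (s : bool) n (A : set 'cV[R]_n.+1) :
  measurable A -> measurable (chart_domain n `&` @chart s n @^-1` A).
Proof.
move=> mA; apply: measurableI; first exact: measurable_chart_domain.
by rewrite -[X in measurable X]setTI; exact: measurable_chart.
Qed.

Section hemisphere.
Variables (s : bool) (n : nat).

Let hemisphere0 : hemisphere_measure s (n:=n) set0 = 0%E.
Proof.
by rewrite /hemisphere_measure preimage_set0 setI0 integral_set0.
Qed.

Let hemisphere_ge0 A : (0 <= hemisphere_measure s (n:=n) A)%E.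
Proof. by apply: integral_ge0 => y _; rewrite lee_fin sqrtr_ge0. Qed.

Let hemisphere_sigma_additive :
  semi_sigma_additive (hemisphere_measure s (n:=n)).
Proof.
move=> F mF tF mUF.
rewrite [X in _ --> X](_ : _ =
    (\sum_(k <oo) hemisphere_measure s (n:=n) (F k))%E).
  by apply/cvg_closeP; split; [exact: is_cvg_nneseries|rewrite closeE].
rewrite /hemisphere_measure preimage_bigcup setI_bigcupr.
rewrite ge0_integral_bigcup//=.
- by move=> k; exact: measurable_chart_preimage.
- apply/measurable_EFinP.
  apply: measurable_funS (@measurable_volume_density s n) => //.
    exact: measurable_chart_domain.
  by move=> y [k _ []].
- by move=> y _; rewrite lee_fin sqrtr_ge0.
- apply/trivIsetP => i j _ _ ij; rewrite setIACA -preimage_setI.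
  by move/trivIsetP : tF => /(_ _ _ _ _ ij) ->//; rewrite preimage_set0 setI0.
Qed.

HB.instance Definition _ := isMeasure.Build _ _ _
  (hemisphere_measure s (n:=n))
  hemisphere0 hemisphere_ge0 hemisphere_sigma_additive.

End hemisphere.

Section two_hemispheres.
Variable n : nat.

Definition two_hemispheres : set 'cV[R]_n.+1 -> \bar R :=
  measure_add (@hemisphere_measure false n) (@hemisphere_measure true n).

HB.instance Definition _ := Measure.on two_hemispheres.

Let two_hemispheres_sigma_finite :
  sigma_finite [set: 'cV[R]_n.+1] two_hemispheres.
Proof.
have /sigma_finiteP[F [FT ndF Foo]] := sigma_finiteT (lebesgue_cV R n).
set D := chart_domain n; pose w := volume_density (@chart false n).
pose G k : set 'cV[R]_n := F k `&` (~` D `|` (D `&` [set y | w y <= k%:R])).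
have mD : measurable D by exact: measurable_chart_domain.
have mG k : measurable (G k).
  apply: measurableI; first by have [] := Foo k.
  apply: measurableU; first exact: measurableC.
  rewrite (_ : [set y | _] = w @^-1` `]-oo, k%:R]).
    by apply: measurable_volume_density.
  by apply/seteqP; split => y /=; rewrite in_itv.
exists (fun k => (snd \o @cV_uncons R n) @^-1` G k).
  apply/seteqP; split => // x _.
  have : [set: 'cV[R]_n] (cV_uncons x).2 by [].
  rewrite FT => -[k _ Fk].
  exists (maxn k (Num.truncn (w (cV_uncons x).2)).+1) => //; split => /=.
    by move: Fk; exact/subsetPset/ndF/leq_maxl.
  have [Dx|Dx] := pselect (D (cV_uncons x).2); [right; split => //=|by left].
  apply: (@le_trans _ _ (Num.truncn (w (cV_uncons x).2)).+1%:R).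
    exact/ltW/truncnS_gt.
  by rewrite ler_nat leq_maxr.
move=> k; split.
  rewrite -[X in measurable X]setTI; apply: measurableT_comp => //.
  exact: measurable_cV_uncons.
have fin s : (@hemisphere_measure s n
    ((snd \o @cV_uncons R n) @^-1` G k) < +oo)%E.
  set E := _ @^-1` _; set A := D `&` @chart s n @^-1` E.
  have mE : measurable E.
    rewrite -[X in measurable X]setTI; apply: measurableT_comp => //.
    exact: measurable_cV_uncons.
  have mA : measurable A by exact: measurable_chart_preimage.
  have AG : A `<=` F k `&` [set y | w y <= k%:R].
    move=> y [Dy Ey]; have : G k (cV_uncons (chart s y)).2 by exact: Ey.
    by rewrite cV_consK/= => -[Fy [//|[_ wy]]].
  apply: (@le_lt_trans _ _ (\int[lebesgue_cV R n]_(y in A) (cst k%:R%:E) y)%E).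
    apply: ge0_le_integral => //.
    - by move=> y _; rewrite lee_fin sqrtr_ge0.
    - apply/measurable_EFinP.
      by apply: measurable_funS (@measurable_volume_density s n) => // y [].
    - move=> y Ay; rewrite lee_fin; have [_] := AG _ Ay; rewrite /w/=.
      by rewrite (@volume_density_chart s false)//; case: Ay.
  rewrite integral_cst// lte_mul_pinfty//.
  have [mF] := Foo k; apply: le_lt_trans; apply: le_measure; rewrite ?inE//.
  by move=> y /AG[].
rewrite /two_hemispheres measure_addE.
by apply: lte_add_pinfty; exact: fin.
Qed.

HB.instance Definition _ := @Measure_isSigmaFinite.Build _ _ _ two_hemispheres
  two_hemispheres_sigma_finite.

End two_hemispheres.

(* The unit sphere of R^0 is empty. *)
Definition sphere_measure n : {sigma_finite_measure set 'cV[R]_n -> \bar R} :=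
  if n is k.+1 then @two_hemispheres k else mzero.

End sphere.

(* C^n as R^(2n), with coordinates (Re z, Im z). *)
Section complex_space.
Variable R : realType.

Definition cV_complex n (x : 'cV[R]_(n + n)) : 'cV[R[i]]_n :=
  \col_i (usubmx x i 0 +i* dsubmx x i 0)%C.

Definition cV_real n (z : 'cV[R[i]]_n) : 'cV[R]_(n + n) :=
  col_mx (map_mx (@complex.Re R) z) (map_mx (@complex.Im R) z).

Lemma cV_complexK n : cancel (@cV_complex n) (@cV_real n).
Proof.
move=> x; rewrite -[RHS]vsubmxK /cV_real; congr col_mx;
  by apply/colP => i; rewrite !mxE.
Qed.

Lemma measurable_cV_complex n :
  measurable_fun [set: 'cV[R]_(n + n)] (@cV_complex n).
Proof.
apply: measurable_fun_matrixP => i j.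
apply: measurable_fun_complexP.
- rewrite (_ : (fun _ => _) = fun x : 'cV[R]_(n + n) => x (lshift n i) 0).
    exact: measurable_coord.
  by apply/funext => x; rewrite !mxE.
- rewrite (_ : (fun _ => _) = fun x : 'cV[R]_(n + n) => x (rshift n i) 0).
    exact: measurable_coord.
  by apply/funext => x; rewrite !mxE.
Qed.

Lemma measurable_cV_real n : measurable_fun [set: 'cV[R[i]]_n] (@cV_real n).
Proof.
apply: measurable_fun_matrixP => i j; have [k ->|k ->] := split_ordP i.
- rewrite (_ : (fun _ => _) = @complex.Re R \o fun z : 'cV[R[i]]_n => z k j).
    apply: measurableT_comp; [exact: measurable_Re|exact: measurable_coord].
  by apply/funext => z; rewrite [LHS]col_mxEu mxE.
- rewrite (_ : (fun _ => _) = @complex.Im R \o fun z : 'cV[R[i]]_n => z k j).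
    apply: measurableT_comp; [exact: measurable_Im|exact: measurable_coord].
  by apply/funext => z; rewrite [LHS]col_mxEd mxE.
Qed.

Definition lebesgue_complex n :
    {sigma_finite_measure set 'cV[R[i]]_n -> \bar R} :=
  image_measure (sigma_finiteT (lebesgue_cV R (n + n)))
    (@measurable_cV_complex n) (@measurable_cV_real n) (@cV_complexK n).

Definition sphere_complex n :
    {sigma_finite_measure set 'cV[R[i]]_n -> \bar R} :=
  image_measure (sigma_finiteT (sphere_measure R (n + n)))
    (@measurable_cV_complex n) (@measurable_cV_real n) (@cV_complexK n).

Definition rnorm n (r : 'cV[R]_n) : R := Num.sqrt (\sum_i r i 0 ^+ 2).

Definition cnorm n (z : 'cV[R[i]]_n) : R :=
  Num.sqrt (\sum_i Normc.normc (z i 0) ^+ 2).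

Definition cball n : set 'cV[R[i]]_n := [set z : 'cV[R[i]]_n | cnorm z < 1].

Definition csphere n : set 'cV[R[i]]_n := [set xi : 'cV[R[i]]_n | cnorm xi = 1].

Definition tau_ball m : set 'cV[R]_m :=
  [set r : 'cV[R]_m | (forall l, 0 <= r l 0) /\ rnorm r < 1].

Definition Cintegral d (T : measurableType d)
    (mu : {measure set T -> \bar R}) (D : set T) (F : T -> R[i]) : R[i] :=
  (Rintegral mu D (fun x => complex.Re (F x)) +i*
   Rintegral mu D (fun x => complex.Im (F x)))%C.

(* Borel representatives of classes in L^oo. *)
Definition Linfty d (T : measurableType d) (mu : {measure set T -> \bar R})
    (D : set T) (F : T -> R[i]) : Prop :=
  measurable_fun D F /\
  exists M : R, {ae mu, forall x, D x -> Normc.normc (F x) <= M}.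

End complex_space.
Arguments cball : clear implicits.
Arguments csphere : clear implicits.
Arguments tau_ball : clear implicits.

Section multi_index.

Definition mi_size n (alpha : 'cV[nat]_n) : nat := (\sum_i alpha i 0%R)%N.

Definition mi_fact n (alpha : 'cV[nat]_n) : nat := (\prod_i (alpha i 0%R)`!)%N.

Definition monomial (R : realType) n (alpha : 'cV[nat]_n) (z : 'cV[R[i]]_n) :
  R[i] := \prod_i z i 0 ^+ alpha i 0.

End multi_index.

Section bergman.
Variable R : realType.

Definition Gamma (s : R) : R :=
  Rintegral lebesgue_measure `]0, +oo[ (fun t => t `^ (s - 1) * expR (- t)).

Variables (n : nat) (lam : R).
Implicit Types f g h : 'cV[R[i]]_n -> R[i].

Definition c_lambda : R :=
  Gamma (n%:R + lam + 1) / (pi ^+ n * Gamma (lam + 1)).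

Definition bergman_weight (z : 'cV[R[i]]_n) : R :=
  c_lambda * (1 - cnorm z ^+ 2) `^ lam.

Definition inner_lambda f g : R[i] :=
  Cintegral (lebesgue_complex R n) (cball R n)
    (fun z => f z * (g z)^*%C * (bergman_weight z)%:C%C).

Definition L2_lambda f : Prop :=
  measurable_fun (cball R n) f /\
  (\int[lebesgue_complex R n]_(z in cball R n)
     (Normc.normc (f z) ^+ 2 * bergman_weight z)%:E < +oo)%E.

Definition holomorphic_ball f : Prop :=
  forall z, cball R n z -> differentiable f z.

Definition bergman_space f : Prop := holomorphic_ball f /\ L2_lambda f.

(* Elements of L^2 are represented by functions on the whole space, of which
   only the values on the ball matter: B is determined on the ball, almost
   everywhere by orthogonality and everywhere by continuity. *)
Definition bergman_projection
    (B : ('cV[R[i]]_n -> R[i]) -> 'cV[R[i]]_n -> R[i]) : Prop :=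
  forall g, L2_lambda g ->
    bergman_space (B g) /\
    (forall h, bergman_space h -> inner_lambda (fun z => g z - B g z) h = 0).

Definition toeplitz (B : ('cV[R[i]]_n -> R[i]) -> 'cV[R[i]]_n -> R[i])
    (a f : 'cV[R[i]]_n -> R[i]) : 'cV[R[i]]_n -> R[i] :=
  B (fun z => a z * f z).

End bergman.

Section quasi_radial_quasi_homogeneous.
Variables (R : realType) (m : nat) (k : 'I_m -> nat) (j : 'I_m).

(* U(k_1) x ... x T.I_(j) x ... x U(k_m) *)
Definition unitary_kj : set 'M[R[i]]_(\sum_(l < m) k l) :=
  [set A | exists U : forall l, 'M[R[i]]_(k l),
    [/\ forall l, l != j -> U l \is unitarymx,
        (exists2 t : R[i], Normc.normc t = 1 & U j = t%:M) &
        A = \mxdiag_(l < m) U l]].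

Definition quasi_radial_quasi_homogeneous
    (a : 'cV[R[i]]_(\sum_(l < m) k l) -> R[i]) : Prop :=
  forall A, unitary_kj A ->
    {ae lebesgue_complex R (\sum_(l < m) k l),
      forall z, cball R _ z -> a (A *m z) = a z}.

Definition block_norms (z : 'cV[R[i]]_(\sum_(l < m) k l)) : 'cV[R]_m :=
  \col_l cnorm (submxcol z l).

Definition block_direction (z : 'cV[R[i]]_(\sum_(l < m) k l)) :
    'cV[R[i]]_(k j) :=
  ((cnorm (submxcol z j))^-1)%:C%C *: submxcol z j.

(* Where z_(j) = 0 the direction is the junk value 0: a null set. *)
Definition corresponding_function
    (a : 'cV[R[i]]_(\sum_(l < m) k l) -> R[i])
    (f : 'cV[R]_m * 'cV[R[i]]_(k j) -> R[i]) : Prop :=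
  [/\ Linfty (lebesgue_cV R m \x sphere_complex R (k j))%E
        (tau_ball R m `*` csphere R (k j)) f,
      (forall r xi (eta : R[i]), tau_ball R m r -> csphere R (k j) xi ->
         Normc.normc eta = 1 -> f (r, eta *: xi) = f (r, xi)) &
      {ae lebesgue_complex R (\sum_(l < m) k l), forall z, cball R _ z ->
         a z = f (block_norms z, block_direction z)}].

End quasi_radial_quasi_homogeneous.

(* Main.v *)
Require Import Defs.
From HB Require Import structures.
Set Warnings "-all".
From mathcomp Require Import all_boot all_order all_algebra.
From mathcomp Require Import complex ring lra.
From mathcomp Require Import all_classical all_reals all_analysis.
From mathcomp Require Import measurable_realfun.
Set Implicit Arguments.
Unset Strict Implicit.
Unset Printing Implicit Defensive.
Import Order.TTheory GRing.Theory Num.Theory.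
Import numFieldNormedType.Exports.
Local Open Scope classical_set_scope.
Local Open Scope ring_scope.

(** The Toeplitz coefficient is the integral of [a z^alpha conj(z^beta)]
    against the weight, by orthogonality of [g - B g] to the monomials.  In polar
    coordinates on each block [C^(k l)], [l != j], the spherical variables only
    enter through [|xi^alpha_l|^2] because [alpha_l = beta_l]; integrating them
    out leaves the sphere moments [2 pi^k alpha! / (k + |alpha| - 1)!], found by
    computing a Gaussian integral both in Cartesian and in polar coordinates.
    Polar coordinates in the graph charts of the sphere come from Tonelli's
    theorem: at fixed [y], substitute [t = sqrt (r^2 - |y|^2)] for the first
    coordinate, exchange [r] and [y], and scale [y] by [r]. *)

(** * Measures with densities and substitutions in one variable *)

(** The function [f] is not a product over the blocks, so the integral cannot be separated block by
    block. What does separate are two measures on pairs (block norms, direction of block [j]): the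
    image of Lebesgue measure weighted by [|z_l^alpha_l|^2], [l != j], and the product measure with
    the expected density. Both factor on boxes; agreeing there, they are equal, and every integrand
    in the norms and that direction can be transported. The Gaussian suits the moments because it is
    both radial and a product over the coordinates. Each of the [m - 1] blocks [l != j] brings
    [2 * pi ^+ k l] from its moment, and [c_lambda] brings [pi] to the power [- N], where [N] is the
    sum of the [k l]; what remains is [2 ^+ m.-1 / pi ^+ k j]. Changes of variables are proved for
    nonnegative functions, where Tonelli applies freely. Signed integrands follow through positive
    and negative parts, complex ones through real and imaginary parts. *)

(* [measurableT_comp] in the eta-expanded form met in integrands. *)
Lemma measurable_fun_comp d1 d2 d3 (T1 : measurableType d1)
    (T2 : measurableType d2) (T3 : measurableType d3) (f : T2 -> T3)
    (g : T1 -> T2) :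
  measurable_fun setT f -> measurable_fun setT g ->
  measurable_fun setT (fun x => f (g x)).
Proof. exact: measurableT_comp. Qed.

Section density.
Context d d' (T : measurableType d) (T' : measurableType d') (R : realType).
Local Open Scope ereal_scope.

Import HBNNSimple.

(** The common form of all substitutions below: [nu] is the image under [phi] of the measure with
    density [w]. An identity on measurable sets extends to simple functions by linearity and to
    nonnegative functions by monotone convergence. *)
Lemma ge0_integral_density (mu : {measure set T -> \bar R})
    (nu : {measure set T' -> \bar R}) (phi : T -> T') (w : T -> R) :
  measurable_fun setT phi -> measurable_fun setT w -> (forall x, 0 <= w x)%R ->
  (forall A, measurable A -> nu A = \int[mu]_(x in phi @^-1` A) (w x)%:E) ->
  forall g : T' -> \bar R, measurable_fun setT g -> (forall y, 0 <= g y) ->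
  \int[nu]_y g y = \int[mu]_x (g (phi x) * (w x)%:E).
Proof.
move=> mphi mw w0 nuE g mg g0.
have mpre A : measurable A -> measurable (phi @^-1` A).
  by move=> mA; rewrite -[X in measurable X]setTI; exact: mphi.
pose f_ := nnsfun_approx measurableT mg.
have mf n : measurable_fun setT (fun x => (f_ n (phi x))%:E).
  by apply/measurable_EFinP; apply: measurableT_comp.
transitivity (limn (fun n => \int[nu]_x (f_ n x)%:E)).
  rewrite -monotone_convergence//.
  - apply: eq_integral => y _; apply/esym/cvg_lim => //.
    by apply: cvg_nnsfun_approx.
  - by move=> n; exact/measurable_EFinP.
  - by move=> n y _; rewrite lee_fin.
  - by move=> y _ m n mn; rewrite lee_fin; exact/lefP/nd_nnsfun_approx.
transitivity (limn (fun n => \int[mu]_x ((f_ n (phi x))%:E * (w x)%:E))); last first.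
  rewrite -monotone_convergence//.
  - apply: eq_integral => x _; apply/cvg_lim => //.
    by apply: cvgeZr => //; apply: cvg_nnsfun_approx => // *; exact: g0.
  - by move=> n; apply: emeasurable_funM => //; exact/measurable_EFinP.
  - by move=> n y _; rewrite mule_ge0// lee_fin//.
  - move=> y _ m n mn; rewrite lee_wpmul2r// lee_fin//.
    exact/lefP/nd_nnsfun_approx.
(* It remains to treat one simple function, a finite sum of multiples of indicators, on each of
   which the hypothesis on [nu] applies. *)
congr (limn _); apply/funext => n.
have fE y : (f_ n y)%:E = \sum_(k \in range (f_ n))
    (k * \1_(f_ n @^-1` [set k]) y)%:E by rewrite fsumEFin// -fimfunE.
under eq_integral do rewrite fE.
under [RHS]eq_integral => x _.
  rewrite fE ge0_mule_fsuml; last by move=> k; exact: nnfun_muleindic_ge0.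
  over.
rewrite /=.
- rewrite ge0_integral_fsum//; last 2 first.
  + by move=> y; exact/measurable_EFinP/measurable_funM.
  + by move=> y x _; rewrite nnfun_muleindic_ge0.
  rewrite ge0_integral_fsum//; last 2 first.
  + move=> r; apply: emeasurable_funM; last exact/measurable_EFinP.
    apply/measurable_EFinP/measurable_funM => //.
    exact: (measurableT_comp (measurable_indic _)).
  + by move=> r x _; rewrite mule_ge0// ?nnfun_muleindic_ge0 ?lee_fin.
  apply: eq_fsbigr => k /[!inE] -[y _ yk].
  have k0 : (0 <= k)%R by rewrite -yk.
  rewrite integralZl_indic_nnsfun// integral_indic// setIT nuE//.
  rewrite [RHS](_ : _ = \int[mu]_x (k%:E *
     ((EFin \o w) \_ (phi @^-1` (f_ n @^-1` [set k]))) x)).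
    rewrite ge0_integralZl_EFin//.
    - by rewrite [in LHS]integral_mkcond.
    - by move=> x _; apply: erestrict_ge0 => z _; rewrite lee_fin.
    - apply: (measurable_restrictT _ (mpre _ _)).1 => //; apply: measurable_funTS; exact/measurable_EFinP.
  apply: eq_integral => x _; rewrite EFinM -muleA; congr (_ * _).
  rewrite patchE indicE; case: ifPn => [|] xA.
  + by rewrite mem_set ?mul1e//; move: xA; rewrite inE.
  + by rewrite memNset ?mul0e//; move: xA; rewrite notin_setE.
Qed.

Lemma ge0_integral_image_measure (mu : {measure set T -> \bar R})
    (f : T -> T') (g : T' -> T) (smu : sigma_finite [set: T] mu)
    (mf : measurable_fun setT f) (mg : measurable_fun setT g)
    (fK : cancel f g) (h : T' -> \bar R) :
  measurable_fun setT h -> (forall y, 0 <= h y) ->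
  \int[image_measure smu mf mg fK]_y h y = \int[mu]_x h (f x).
Proof.
move=> mh h0; rewrite (@ge0_integral_density mu _ f (cst 1%R))//.
  by apply: eq_integral => x _; rewrite mule1.
move=> A mA; rewrite (_ : (fun _ => _) = cst 1)// integral_cst ?mul1e//.
by rewrite -[X in measurable X]setTI; exact: mf.
Qed.

End density.

Section image_density.
Context d d' (T : measurableType d) (T' : measurableType d') (R : realType).
Variables (mu : {measure set T -> \bar R}) (phi : T -> T') (w : T -> R).
Hypotheses (mphi : measurable_fun setT phi) (mw : measurable_fun setT w).
Hypothesis w0 : forall x, 0 <= w x.

(** The three proofs are arguments of the term so that the measure structure, which rests on them,
    can be attached to it. *)
Definition image_density (_ : measurable_fun setT phi)
    (_ : measurable_fun setT w) (_ : forall x, 0 <= w x) (A : set T') : \bar R :=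
  (\int[mu]_(x in phi @^-1` A) (w x)%:E)%E.

Local Notation nu := (image_density mphi mw w0).

Let mpre A : measurable A -> measurable (phi @^-1` A).
Proof. by move=> mA; rewrite -[X in measurable X]setTI; exact: mphi. Qed.

Let nu0 : nu set0 = 0%E.
Proof. by rewrite /image_density preimage_set0 integral_set0. Qed.

Let nu_ge0 A : (0 <= nu A)%E.
Proof. by apply: integral_ge0 => x _; rewrite lee_fin. Qed.

Let nu_sigma_additive : semi_sigma_additive nu.
Proof.
move=> F mF tF mUF.
rewrite [X in _ --> X](_ : _ = (\sum_(k <oo) nu (F k))%E).
  by apply/cvg_closeP; split; [exact: is_cvg_nneseries|rewrite closeE].
rewrite /image_density preimage_bigcup ge0_integral_bigcup//=.
- by move=> k; exact: mpre.
- by apply/measurable_EFinP; exact: measurable_funTS.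
- by move=> x _; rewrite lee_fin.
- apply/trivIsetP => i j _ _ ij; rewrite -preimage_setI.
  by move/trivIsetP : tF => /(_ _ _ _ _ ij) ->//; rewrite preimage_set0.
Qed.

HB.instance Definition _ := isMeasure.Build _ _ _ nu
  nu0 nu_ge0 nu_sigma_additive.

End image_density.

Section lebesgue_substitution.
Variable R : realType.
Local Notation leb := (@lebesgue_measure R).
(** The signed square is an increasing C^1 bijection of the whole line, so substituting it calls for
    no restriction to a half-line. At 0 its difference quotient is [|h|]. *)
Lemma is_derive_mulr_norm (x : R) :
  is_derive x (1 : R) (fun t : R => t * `|t|) (2 * `|x|).
Proof.
have [x0|x0|->] := ltgtP x 0.
- have E : \near x, (- (x * x) = x * `|x|).
    near=> t; rewrite ltr0_norm ?mulrN//.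
    by near: t; exact: lt_nbhsl.
  apply: (near_eq_is_derive E).
  apply: is_derive_eq; rewrite /GRing.scale/= ltr0_norm//; ring.
- have E : \near x, (x * x = x * `|x|).
    near=> t; rewrite gtr0_norm//.
    by near: t; exact: lt_nbhsr.
  apply: (near_eq_is_derive E).
  apply: is_derive_eq; rewrite /GRing.scale/= gtr0_norm//; ring.
- rewrite normr0 mulr0.
  have cv : (fun h : R => h^-1 *: (((fun t : R => t * `|t|) \o shift 0) (h *: (1:R)) -
     (fun t : R => t * `|t|) 0)) @ 0^' --> (0 : R).
    apply: (@cvg_trans _ ((fun h : R => `|h|) @ (0 : R)^')).
      apply: near_eq_cvg; near=> h => /=.
      have h0 : h != 0 by near: h; exact: nbhs_dnbhs_neq.
      by rewrite addr0 [(h *: 1)]mulr1 mul0r subr0 /GRing.scale/= mulKf.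
    apply: cvg_within_filter; have := @norm_continuous R R^o 0.
    by rewrite /continuous_at normr0.
  by split; [apply: cvgP cv|exact: cvg_lim cv].
Unshelve. all: by end_near.
Qed.

Local Open Scope ereal_scope.

(** Lebesgue measure is determined by its values on half-open intervals, so a substitution has to be
    checked there only, where the fundamental theorem of calculus does it. *)
Lemma lebesgue_density (phi w : R -> R) :
  measurable_fun setT phi -> measurable_fun setT w -> (forall x, 0 <= w x)%R ->
  (forall a b : R, (a <= b)%R ->
     \int[leb]_(x in phi @^-1` `]a, b]) (w x)%:E = (b - a)%:E) ->
  forall g : R -> \bar R, measurable_fun setT g -> (forall y, 0 <= g y) ->
  \int[leb]_y g y = \int[leb]_x (g (phi x) * (w x)%:E).
Proof.
move=> mphi mw w0 ab g mg g0; apply: ge0_integral_density => // A mA.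
pose nu : {measure set (measurableTypeR R) -> \bar R} :=
  @image_density _ _ _ (measurableTypeR R) _ leb phi w mphi mw w0.
suff nuE : forall X, ocitv X -> leb X = nu X by exact: (@lebesgue_measure_unique R nu nuE A mA).
move=> _ [[a b] _ <-] /=; rewrite /nu /image_density/= lebesgue_measure_itv/=.
rewrite lte_fin; have [lt_ab|le_ba] := ltP a b; first by rewrite ab// ltW.
by rewrite set_itv_ge ?preimage_set0 ?integral_set0// bnd_simp -leNgt.
Qed.

Lemma integral_affine (c b : R) (g : R -> \bar R) : (0 < c)%R ->
  measurable_fun setT g -> (forall y, 0 <= g y) ->
  \int[leb]_y g y = \int[leb]_x (g (c * x + b)%R * c%:E).
Proof.
move=> c0 mg g0.
apply: (@lebesgue_density (fun x => c * x + b)%R (cst c)) => //.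
- by apply: measurable_funD => //; exact: measurable_funM.
- by move=> x; exact: ltW.
move=> s t st.
rewrite (_ : _ @^-1` _ = `]((s - b) / c)%R, ((t - b) / c)%R]%classic); last first.
  apply/seteqP; split=> x /=; rewrite !in_itv/= ltr_pdivrMr// ler_pdivlMr//
    ltrBlDr lerBrDr (mulrC x) //.
set I := `]_, _]%classic.
transitivity (c%:E * leb I); first exact: (@integral_cst _ _ _ leb I (measurable_itv _) c%:E).
rewrite {}/I lebesgue_measure_itv/= lte_fin.
have := st; rewrite le_eqVlt => /predU1P[->|st'].
  by rewrite ltxx subrr mule0.
rewrite ltr_pM2r ?invr_gt0// ltrD2r st' -EFinB -EFinM -mulrBl; congr EFin.
by rewrite opprB addrA subrK; field; rewrite gt_eqF.
Qed.

Lemma integral_mulr_norm (g : R -> \bar R) :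
  measurable_fun setT g -> (forall y, 0 <= g y) ->
  \int[leb]_y g y = \int[leb]_x (g (x * `|x|)%R * (2 * `|x|)%:E).
Proof.
have cF : continuous (fun x : R => x * `|x|)%R.
  move=> x; apply: differentiable_continuous; apply/derivable1_diffP.
  by have [] := is_derive_mulr_norm x.
have cf : continuous (fun x : R => 2 * `|x|)%R.
  by move=> x; apply: cvgM; [exact: cvg_cst|exact: norm_continuous].
have Fmono (x y : R) : (x * `|x| <= y * `|y|)%R = (x <= y)%R.
  have [x0|x0] := leP 0%R x; have [y0|y0] := leP 0%R y.
  - by rewrite (ger0_norm x0) (ger0_norm y0) -!expr2 ler_pXn2r.
  - rewrite (ger0_norm x0) (ltr0_norm y0); apply/idP/idP => h; exfalso; nra.
  - rewrite (ger0_norm y0) (ltr0_norm x0); apply/idP/idP => h; nra.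
  - rewrite (ltr0_norm y0) (ltr0_norm x0); apply/idP/idP => h; nra.
have Fmonolt (x y : R) : (x * `|x| < y * `|y|)%R = (x < y)%R.
  by rewrite !ltNge Fmono.
have Fsurj (a : R) : exists s, (s * `|s| = a)%R.
  have [a0|a0] := leP 0%R a.
    by exists (Num.sqrt a); rewrite ger0_norm ?sqrtr_ge0// -expr2 sqr_sqrtr.
  exists (- Num.sqrt (- a))%R; rewrite normrN ger0_norm ?sqrtr_ge0//.
  by rewrite mulNr -expr2 sqr_sqrtr ?opprK// oppr_ge0 ltW.
move=> mg g0; apply: (@lebesgue_density (fun x => x * `|x|)%R
    (fun x => 2 * `|x|)%R) => //.
- exact: continuous_measurable_fun.
- exact: continuous_measurable_fun.
(* With endpoints written as signed squares of [s] and [t], the preimage of the interval is []s,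
   t]]; it is then closed at [s], at no cost, for the fundamental theorem of calculus. *)
move=> a b; have [s <-] := Fsurj a; have [t <-] := Fsurj b.
rewrite Fmono => st.
rewrite (_ : _ @^-1` _ = `]s, t]%classic); last first.
  by apply/seteqP; split=> x /=; rewrite !in_itv/= Fmono Fmonolt.
have := st; rewrite le_eqVlt => /predU1P[->|st'].
  by rewrite set_itv_ge ?integral_set0 ?subrr// bnd_simp ltxx.
rewrite integral_itv_obnd_cbnd; last first.
  by apply/measurable_EFinP/measurable_funTS; exact: continuous_measurable_fun.
rewrite (@continuous_FTC2 _ _ (fun x => x * `|x|)%R) ?EFinB//.
- by apply: continuous_subspaceT.
- split; first by move=> x _; have [] := is_derive_mulr_norm x.
  + by apply: cvg_at_right_filter; exact: cF.
  + by apply: cvg_at_left_filter; exact: cF.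
- by move=> x _; rewrite derive1E; have [_ ->] := is_derive_mulr_norm x.
Qed.

End lebesgue_substitution.

(** * Iterated integrals on R^n, scaling, and the substitution [r ^+ 2 = t ^+ 2 + q] *)

Section lebesgue_cV_theory.
Variable R : realType.
Local Notation leb := (@lebesgue_measure R).

Lemma measurable_inv : measurable_fun [set: R] (@GRing.inv R).
Proof.
(* [powR] with exponent -1 is the inverse on nonnegative numbers, hence the square; at 0 both sides
   are 0. *)
rewrite (_ : GRing.inv = fun x : R => x * (x ^+ 2) `^ (-1)).
  apply: measurable_funM => //.
  apply: (measurableT_comp (measurable_powR _)); exact: measurable_funX.
apply/funext => x; rewrite powR_inv1 ?sqr_ge0//.
by have [->|x0] := eqVneq x 0; rewrite ?invr0 ?mul0r// expr2 invfM mulVKf.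
Qed.

Lemma measurable_sqrt : measurable_fun [set: R] (@Num.sqrt R).
Proof. by apply: continuous_measurable_fun; exact: sqrt_continuous. Qed.

Local Open Scope ereal_scope.

(* Where [r ^+ 2 <= q] the integrand on the right is 0, since [Num.sqrt] and
   [GRing.inv] vanish there. *)
Lemma integral_pythagoras (q : R) (h : R -> \bar R) : (0 <= q)%R ->
  measurable_fun setT h -> (forall t, 0 <= h t) ->
  \int[leb]_(t in `]0%R, +oo[) h t =
  \int[leb]_(r in `]0%R, +oo[)
    (h (Num.sqrt (r ^+ 2 - q)) * (r / Num.sqrt (r ^+ 2 - q))%:E).
Proof.
(* In the variable [u = t ^+ 2 = r ^+ 2 - q] both sides are the integral of [k]: a signed square, a
   translation by [- q], and a signed square again. Since [k] vanishes for [u <= 0], only the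
   positive half-lines contribute. *)
move=> q0 mh h0; pose k u := h (Num.sqrt u) * ((2 * Num.sqrt u)^-1)%:E.
have mk : measurable_fun setT k.
  rewrite /k; apply: emeasurable_funM; first exact: (@measurableT_comp _ _ _ _ _ _ h _ (@Num.sqrt R) mh measurable_sqrt).
  apply/measurable_EFinP/(measurableT_comp measurable_inv).
  by apply: measurable_funM => //; exact: measurable_sqrt.
have k0 u : 0 <= k u by rewrite mule_ge0// lee_fin invr_ge0 mulr_ge0// sqrtr_ge0.
have kN u : (u <= 0)%R -> k u = 0.
  by move=> u0; rewrite /k ler0_sqrtr// mulr0 invr0 mule0.
transitivity (\int[leb]_u k u).
  rewrite integral_mulr_norm// integral_mkcond; apply: eq_integral => t _.
  rewrite patchE; case: ifPn => [|].
    rewrite inE/= in_itv/= andbT => t0; rewrite /k gtr0_norm// -expr2.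
    rewrite sqrtr_sqr gtr0_norm// -muleA -EFinM mulVf ?mule1//.
    by rewrite mulf_neq0// gt_eqF.
  rewrite notin_setE/= in_itv/= andbT => /negP; rewrite -leNgt => t0.
  by rewrite kN ?mul0e// mulr_le0_ge0.
rewrite (@integral_affine _ 1 (- q)%R)//.
rewrite [LHS]integral_mulr_norm//; last 2 first.
- apply: emeasurable_funM => //; apply: (measurableT_comp mk).
  by apply: measurable_funD => //; exact: measurable_funM.
- by move=> y; rewrite mule1.
rewrite [RHS]integral_mkcond; apply: eq_integral => r _.
rewrite mule1 mul1r patchE; case: ifPn => [|].
  rewrite inE/= in_itv/= andbT => r0; rewrite /k gtr0_norm// -expr2.
  by rewrite -muleA -EFinM; congr (_ * _%:E); rewrite invfM mulrACA mulVf ?pnatr_eq0// mul1r mulrC.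
rewrite notin_setE/= in_itv/= andbT => /negP; rewrite -leNgt => r0.
rewrite kN ?mul0e// subr_le0; apply: le_trans q0.
by rewrite mulr_le0_ge0.
Qed.

Lemma measurable_partial_integral d1 d2 (T1 : measurableType d1)
    (T2 : measurableType d2) (mu : {sigma_finite_measure set T2 -> \bar R})
    (f : T1 -> T2 -> \bar R) :
  measurable_fun setT (fun x => f x.1 x.2) -> (forall x y, 0 <= f x y) ->
  measurable_fun setT (fun x => \int[mu]_y f x y).
Proof.
move=> mf f0.
exact: (measurable_fun_fubini_tonelli_F (fun x => f x.1 x.2) mf).
Qed.

Lemma lebesgue_cV_cons n (g : 'cV[R]_n.+1 -> \bar R) :
  measurable_fun setT g -> (forall x, 0 <= g x) ->
  \int[lebesgue_cV R n.+1]_x g x =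
  \int[leb]_t \int[lebesgue_cV R n]_y g (cV_cons (t, y)).
Proof.
move=> mg g0.
rewrite /= ge0_integral_image_measure// fubini_tonelli1//.
exact: (@measurableT_comp _ _ _ _ _ _ g _ (@cV_cons R n) mg
  (@measurable_cV_cons R n)).
Qed.

Lemma measurable_scale n (r : R) :
  measurable_fun [set: 'cV[R]_n] (fun x : 'cV[R]_n => r *: x)%R.
Proof.
apply: measurable_fun_matrixP => i j.
rewrite (_ : (fun _ => _) = (fun M : 'cV[R]_n => r * M i j)%R).
  by apply: measurable_funM => //; exact: measurable_coord.
by apply/funext => M; rewrite mxE.
Qed.

(** Induction on the dimension: each coordinate is scaled by [integral_affine] and contributes one
    factor [r]. *)
Lemma lebesgue_cV_scale n (r : R) (g : 'cV[R]_n -> \bar R) : (0 < r)%R ->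
  measurable_fun setT g -> (forall x, 0 <= g x) ->
  \int[lebesgue_cV R n]_x g x =
  \int[lebesgue_cV R n]_x (g (r *: x)%R * (r ^+ n)%:E).
Proof.
move=> r0; elim: n g => [|n IH] g mg g0.
  rewrite !integral_dirac// ?diracT ?mul1e ?scaler0 ?mule1//.
  by rewrite (_ : (fun _ => _) = cst (g (0%R : 'cV[R]_0) * 1))//; apply/funext => x; rewrite [x]flatmx0 scaler0.
have mcons := @measurable_cV_cons R n.
rewrite lebesgue_cV_cons// lebesgue_cV_cons//; last 2 first.
- apply: emeasurable_funM => //.
  exact: (@measurableT_comp _ _ _ _ _ _ g _ _ mg (measurable_scale _)).
- by move=> x; rewrite mule_ge0// lee_fin exprn_ge0// ltW.
rewrite (@integral_affine _ r 0%R)//; last 2 first.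
- apply: measurable_partial_integral => //.
  by apply: measurableT_comp => //; apply: measurableT_comp.
- by move=> t; exact: integral_ge0.
apply: eq_integral => t _; rewrite addr0 IH//; last first.
  apply: (@measurableT_comp _ _ _ _ _ _ g _ (fun y => cV_cons (r * t, y)%R) mg).
  apply: (@measurableT_comp _ _ _ _ _ _ _ _ (fun y => (r * t, y)%R) mcons).
  exact: measurable_fun_pair.
rewrite -ge0_integralZr//; last 3 first.
- apply: emeasurable_funM => //.
  apply: (@measurableT_comp _ _ _ _ _ _ g _ (fun y : 'cV[R]_n => cV_cons (r * t, r *: y)%R) mg).
  apply: (@measurableT_comp _ _ _ _ _ _ _ _ (fun y : 'cV[R]_n => (r * t, r *: y)%R) mcons).
  by apply: measurable_fun_pair => //; exact: measurable_scale.
- by move=> y _; rewrite mule_ge0// lee_fin exprn_ge0// ltW.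
- by rewrite lee_fin ltW.
apply: eq_integral => y _; rewrite -muleA -EFinM -exprSr; congr (g _ * _).
by rewrite /cV_cons/= -scale_scalar_mx -scale_col_mx.
Qed.

End lebesgue_cV_theory.

(** * Polar coordinates *)

(** Both sides are the determinant of the matrix with blocks [1], [- u], [v], [1], factored in two
    ways into block triangular matrices. It serves for the Gram matrix of a graph chart, the
    identity plus a matrix of rank one. *)
Lemma det_1_add_rank1 (F : comNzRingType) n (v : 'cV[F]_n) (u : 'rV[F]_n) :
  \det (1%:M + v *m u) = 1 + (u *m v) 0 0.
Proof.
have E1 : block_mx 1%:M (- u) v 1%:M =
    block_mx (1%:M : 'M[F]_(1, 1)) 0 v 1%:M *m block_mx 1%:M (- u) 0 (1%:M + v *m u).
  rewrite mulmx_block !mul1mx !mul0mx !mulmx1 !addr0 mulmxN.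
  by rewrite addrCA addNr addr0.
have E2 : block_mx 1%:M (- u) v 1%:M =
    block_mx (1%:M : 'M[F]_1) (- u) 0 1%:M *m block_mx (1%:M + u *m v) 0 v 1%:M.
  by rewrite mulmx_block !mul1mx !mul0mx !mulmx1 !add0r mulNmx addrK.
have := congr1 determinant E2; rewrite {1}E1 !det_mulmx !det_lblock !det_ublock.
by rewrite !det1 !mul1r !mulr1 => ->; rewrite det_mx11 !mxE eqxx.
Qed.

Section polar.
Variable R : realType.
Local Notation leb := (@lebesgue_measure R).

(** The Gram determinant is [1 + |y|^2 / (1 - |y|^2) = 1 / (1 - |y|^2)]. *)
Lemma volume_density_chartE (s : bool) n (y : 'cV[R]_n) : chart_domain y ->
  volume_density (chart s (n := n)) y = (Num.sqrt (1 - sqnorm y))^-1.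
Proof.
move=> Dy; have y1 : 0 < 1 - sqnorm y by rewrite subr_gt0.
rewrite /volume_density (_ : metric _ _ =
    1%:M + y *m ((1 - sqnorm y)^-1 *: y^T)); last first.
  apply/matrixP => i j; rewrite metric_chart// !mxE big_ord1 !mxE.
  by rewrite powR_inv1 ?ltW// mulrA mulrAC.
rewrite det_1_add_rank1 -scalemxAl mxE.
rewrite (_ : (_ *m _) 0 0 = sqnorm y); last first.
  by rewrite mxE; apply: eq_bigr => i _; rewrite mxE expr2.
rewrite -sqrtrV; last exact: ltW.
by congr Num.sqrt; field; rewrite gt_eqF.
Qed.

Local Open Scope ereal_scope.

(** Off the chart domain [1 - |y|^2] is nonpositive; its [Num.sqrt] is 0 and so is the inverse of
    that. The integral can thus run over the whole space, and Tonelli applies without a domain to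
    track. *)
Lemma integral_hemisphere (s : bool) n (g : 'cV[R]_n.+1 -> \bar R) :
  measurable_fun setT g -> (forall x, 0 <= g x) ->
  \int[hemisphere_measure s (n := n)]_x g x =
  \int[lebesgue_cV R n]_y (g (chart s y) * ((Num.sqrt (1 - sqnorm y))^-1)%:E).
Proof.
move=> mg g0.
apply: (@ge0_integral_density _ _ _ _ _ _ _ (@chart R s n)
  (fun y : 'cV[R]_n => (Num.sqrt (1 - sqnorm y))^-1)%R) => //.
- exact: measurable_chart.
- apply: (@measurableT_comp _ _ _ _ _ _ _ _
    (fun y : 'cV[R]_n => Num.sqrt (1 - sqnorm y))%R (@measurable_inv R)).
  apply: (@measurableT_comp _ _ _ _ _ _ _ _
    (fun y : 'cV[R]_n => 1 - sqnorm y)%R (@measurable_sqrt R)).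
  by apply: measurable_funB => //; exact: measurable_sqnorm.
move=> A mA; rewrite /= /hemisphere_measure setIC.
rewrite integral_mkcondr; apply: eq_integral => y _.
rewrite patchE; case: ifPn => [|]; first by rewrite inE => yD; rewrite volume_density_chartE.
rewrite notin_setE /chart_domain/= => /negP; rewrite -leNgt => y1.
by rewrite ler0_sqrtr ?invr0// subr_le0.
Qed.

Lemma fubini_tonelli_in d1 d2 (T1 : measurableType d1) (T2 : measurableType d2)
    (m1 : {sigma_finite_measure set T1 -> \bar R})
    (m2 : {sigma_finite_measure set T2 -> \bar R}) (D : set T1)
    (f : T1 -> T2 -> \bar R) : measurable D ->
  measurable_fun setT (fun x => f x.1 x.2) -> (forall x y, 0 <= f x y) ->
  \int[m2]_y \int[m1]_(x in D) f x y = \int[m1]_(x in D) \int[m2]_y f x y.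
Proof.
move=> mD mf f0; pose h x := f x.1 x.2 * (\1_D x.1)%:E.
have mh : measurable_fun setT h.
  apply: emeasurable_funM => //; apply/measurable_EFinP.
  by apply: (@measurableT_comp _ _ _ _ _ _ (\1_D : T1 -> R) _ fst) => //; exact: measurable_indic.
transitivity (\int[m2]_y \int[m1]_x h (x, y)).
  by apply: eq_integral => y _; rewrite integral_mkcond epatch_indic.
rewrite -(fubini_tonelli h)//; last by move=> x; rewrite mule_ge0// lee_fin.
rewrite [RHS]integral_mkcond epatch_indic; apply: eq_integral => x _.
rewrite /h/= ge0_integralZr//.
by apply: (@measurableT_comp _ _ _ _ _ _ (fun x => f x.1 x.2) _ (fun y => (x, y)) mf); exact: measurable_fun_pair.
Qed.

Lemma integral_positive_half_lines (H : R -> \bar R) :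
  measurable_fun setT H -> (forall t, 0 <= H t) ->
  \int[leb]_t H t = \int[leb]_(t in `]0%R, +oo[) H t +
                    \int[leb]_(t in `]0%R, +oo[) H (- t)%R.
Proof.
move=> mH H0.
have mHN : measurable_fun setT (fun t : R => H (- t)%R).
  by apply: (@measurableT_comp _ _ _ _ _ _ H _ (@GRing.opp R) mH); exact: oppr_measurable.
(* The origin is given to the second half-line, which reflection turns into []-oo, 0]], so that the
   two half-lines partition the line. *)
rewrite [X in _ + X]integral_itv_obnd_cbnd; last exact: measurable_funTS.
rewrite [X in _ + X]ge0_integration_by_substitution0//.
under [X in _ + X]eq_integral do rewrite opprK.
rewrite addeC -ge0_integral_setU//=.
- by rewrite -itv_bndbnd_setU// set_itvNyy.
- exact: measurable_funTS.
- by apply: lt_disjoint => x y /=; rewrite !in_itv/= => x0 /andP[y0 _]; lra.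
Qed.

Theorem polar_cV n (g : 'cV[R]_n.+1 -> \bar R) :
  measurable_fun setT g -> (forall x, 0 <= g x) ->
  \int[lebesgue_cV R n.+1]_x g x =
  \int[leb]_(r in `]0%R, +oo[)
    (\int[sphere_measure R n.+1]_x g (r *: x)%R * (r ^+ n)%:E).
Proof.
move=> mg g0.
pose sg (s : bool) : R := ((-1) ^+ s)%R.
(* The integrand after the substitution [t = Num.sqrt (r ^+ 2 - |y|^2)]. The absolute value of [r],
   which is [r] on the half-line, makes it nonnegative everywhere, as Tonelli asks. *)
pose F s r (y : 'cV[R]_n) :=
  g (cV_cons (sg s * Num.sqrt (r ^+ 2 - sqnorm y), y)%R) *
  (`|r| / Num.sqrt (r ^+ 2 - sqnorm y))%:E.
have mgc : measurable_fun setT (fun x : R * 'cV[R]_n => g (cV_cons x)).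
  exact: (@measurableT_comp _ _ _ _ _ _ g _ (@cV_cons R n) mg
    (@measurable_cV_cons R n)).
have F0 s r y : 0 <= F s r y.
  by rewrite mule_ge0// lee_fin divr_ge0// sqrtr_ge0.
have mq : measurable_fun setT (fun x : R * 'cV[R]_n =>
    Num.sqrt (x.1 ^+ 2 - sqnorm x.2))%R.
  apply: (@measurableT_comp _ _ _ _ _ _ _ _
    (fun x : R * 'cV[R]_n => x.1 ^+ 2 - sqnorm x.2)%R (@measurable_sqrt R)).
  apply: measurable_funB; first exact: measurable_funX.
  by apply: (@measurableT_comp _ _ _ _ _ _ _ _ snd (@measurable_sqnorm R n)).
have mF s : measurable_fun setT (fun x => F s x.1 x.2).
  apply: emeasurable_funM.
    apply: (@measurableT_comp _ _ _ _ _ _ _ _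
      (fun x : R * 'cV[R]_n => (sg s * Num.sqrt (x.1 ^+ 2 - sqnorm x.2), x.2)%R) mgc).
    by apply: measurable_fun_pair => //; exact: measurable_funM.
  apply/measurable_EFinP/measurable_funM.
    by apply: (@measurable_fun_comp _ _ _ _ _ _ (fun t : R => `|t|)%R fst).
  exact: (measurable_fun_comp (@measurable_inv R) mq).
have mslice (s : bool) (y : 'cV[R]_n) :
    measurable_fun setT (fun t : R => g (cV_cons (sg s * t, y)%R)).
  apply: (@measurableT_comp _ _ _ _ _ _ _ _ (fun t : R => (sg s * t, y)%R) mgc).
  by apply: measurable_fun_pair => //; exact: measurable_funM.
(* The cone over the hemisphere [s] is the open half-space in which the first coordinate has sign
   [sg s], up to a null set. *)
have half (s : bool) :
    \int[lebesgue_cV R n]_y \int[leb]_(t in `]0%R, +oo[) g (cV_cons (sg s * t, y)%R) =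
    \int[leb]_(r in `]0%R, +oo[)
      (\int[hemisphere_measure s (n := n)]_x g (r *: x)%R * (r ^+ n)%:E).
  have q0 (y : 'cV[R]_n) : (0 <= sqnorm y)%R.
    by apply: sumr_ge0 => i _; rewrite sqr_ge0.
  transitivity (\int[lebesgue_cV R n]_y \int[leb]_(r in `]0%R, +oo[) F s r y).
    apply: eq_integral => y _.
    rewrite (@integral_pythagoras _ (sqnorm y) (fun t => g (cV_cons (sg s * t, y)%R)))//.
    apply: eq_integral => r; rewrite inE/= in_itv/= andbT => r0.
    by rewrite /F gtr0_norm.
  rewrite fubini_tonelli_in//; last exact: mF.
  apply: eq_integral => r.
  rewrite inE/= in_itv/= andbT => r0.
  rewrite (@lebesgue_cV_scale _ _ r)//; last first.
    apply: (@measurable_fun_comp _ _ _ _ _ _ (fun x => F s x.1 x.2) (fun y => (r, y)) (mF s)).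
    exact: measurable_fun_pair.
  rewrite ge0_integralZr//; last 2 first.
  - apply: (@measurable_fun_comp _ _ _ _ _ _ (fun x => F s x.1 x.2) (fun y : 'cV[R]_n => (r, r *: y)%R) (mF s)).
    by apply: measurable_fun_pair => //; exact: measurable_scale.
  - by rewrite lee_fin exprn_ge0// ltW.
  rewrite integral_hemisphere//; last first.
    exact: (measurable_fun_comp mg (@measurable_scale R _ r)).
  congr (_ * _); apply: eq_integral => y _; rewrite /F.
  (* Scaling [y] by [r] cancels the [r] of the Jacobian and leaves the volume density of the chart;
     the argument of [g] becomes [r *: chart s y], and the factor [r ^+ n] is that of the
     scaling. *)
  have -> : Num.sqrt (r ^+ 2 - sqnorm (r *: y)%R) = (r * Num.sqrt (1 - sqnorm y))%R.
    rewrite (_ : _ - _ = r ^+ 2 * (1 - sqnorm y))%R.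
      by rewrite sqrtrM ?sqr_ge0// sqrtr_sqr gtr0_norm.
    rewrite mulrBr mulr1 /sqnorm mulr_sumr; congr (_ - _)%R; apply: eq_bigr => i _.
    by rewrite mxE exprMn.
  rewrite gtr0_norm// invfM mulVKf ?gt_eqF//; congr (g _ * _).
  by rewrite /chart /cV_cons/= mulrCA -scale_scalar_mx -scale_col_mx.
transitivity (\int[lebesgue_cV R n]_y
    (\int[leb]_(t in `]0%R, +oo[) g (cV_cons (sg false * t, y)%R) +
     \int[leb]_(t in `]0%R, +oo[) g (cV_cons (sg true * t, y)%R))).
  rewrite lebesgue_cV_cons//.
  transitivity (\int[lebesgue_cV R n]_y \int[leb]_t g (cV_cons (t, y))).
    pose h x := g (@cV_cons R n x).
    exact: (@fubini_tonelli _ _ _ _ _ leb (lebesgue_cV R n) h mgc (fun _ => g0 _)).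
  apply: eq_integral => y _; rewrite integral_positive_half_lines//.
    by rewrite /sg expr1; congr (_ + _); apply: eq_integral => t _;
      rewrite /sg ?expr0 ?mul1r ?mulN1r.
  by have := mslice false y; under eq_fun do rewrite /sg expr0 mul1r.
have mhalf (s : bool) : measurable_fun setT (fun y : 'cV[R]_n =>
   \int[leb]_(t in `]0%R, +oo[) g (cV_cons (sg s * t, y)%R)).
  under eq_fun do rewrite integral_mkcond epatch_indic.
  apply: (@measurable_partial_integral _ _ _ _ _ leb (fun y t =>
    g (cV_cons (sg s * t, y)%R) * (\1_(`]0%R, +oo[) t)%:E)).
    apply: emeasurable_funM.
      apply: (@measurable_fun_comp _ _ _ _ _ _ _
        (fun x : 'cV[R]_n * R => (sg s * x.2, x.1)%R) mgc).
      by apply: measurable_fun_pair => //; exact: measurable_funM.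
    apply/measurable_EFinP.
    by apply: (@measurable_fun_comp _ _ _ _ _ _ (\1_(`]0%R, +oo[) : R -> R) snd).
  by move=> y t; rewrite mule_ge0// lee_fin.
rewrite ge0_integralD//; last 2 first.
- by move=> y _; exact: integral_ge0.
- by move=> y _; exact: integral_ge0.
have mhemi (s : bool) : measurable_fun (`]0%R, +oo[%classic : set R) (fun r : R =>
    \int[hemisphere_measure s (n := n)]_x g (r *: x)%R * (r ^+ n)%:E).
  apply: emeasurable_funM; last first.
    by apply/measurable_EFinP; exact: measurable_funTS.
  apply: measurable_funTS.
  (* Measurability in [r] of a partial integral is available for sigma-finite measures;
     [hemisphere_measure] carries a mere measure structure, so the integral is first written over
     Lebesgue measure. *)
  under eq_fun => r.
    rewrite integral_hemisphere//; last first.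
      exact: (measurable_fun_comp mg (@measurable_scale R _ r)).
    over.
  apply: (@measurable_partial_integral _ _ _ _ _ (lebesgue_cV R n) (fun (r : R) y =>
    g (r *: chart s y)%R * ((Num.sqrt (1 - sqnorm y))^-1)%:E)).
    apply: emeasurable_funM.
      apply: (@measurable_fun_comp _ _ _ _ _ _ g (fun x : R * 'cV[R]_n => x.1 *: chart s x.2)%R mg).
      apply: measurable_fun_matrixP => i j.
      rewrite (_ : (fun _ => _) = (fun x : R * 'cV[R]_n => x.1 * chart s x.2 i j)%R).
        apply: measurable_funM => //.
        apply: (@measurable_fun_comp _ _ _ _ _ _ (fun y : 'cV[R]_n => chart s y i j) snd) => //.
        exact: (measurable_fun_comp (measurable_coord i j) (@measurable_chart R s n)).
      by apply/funext => x; rewrite mxE.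
    apply/measurable_EFinP.
    apply: (@measurable_fun_comp _ _ _ _ _ _ (@GRing.inv R) _ (@measurable_inv R)).
    apply: (@measurable_fun_comp _ _ _ _ _ _ (@Num.sqrt R) _ (@measurable_sqrt R)).
    apply: measurable_funB => //.
    exact: (@measurable_fun_comp _ _ _ _ _ _ _ snd (@measurable_sqnorm R n)).
  by move=> r y; rewrite mule_ge0// lee_fin invr_ge0 sqrtr_ge0.
have hemi0 (s : bool) (r : R) : `]0%R, +oo[%classic r ->
    0 <= \int[hemisphere_measure s (n := n)]_x g (r *: x)%R * (r ^+ n)%:E.
  rewrite /= in_itv/= andbT => r0.
  by rewrite mule_ge0// ?integral_ge0// lee_fin exprn_ge0// ltW.
rewrite !half -ge0_integralD//; last 4 first.
- exact: hemi0.
- exact: mhemi.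
- exact: hemi0.
- exact: mhemi.
apply: eq_integral => r; rewrite inE/= in_itv/= andbT => r0.
have mgr : measurable_fun setT (fun x : 'cV[R]_n.+1 => g (r *: x)%R).
  exact: (measurable_fun_comp mg (@measurable_scale R _ r)).
by rewrite -ge0_muleDl ?integral_ge0// -ge0_integral_measure_add.
Qed.

End polar.

(** * Measurability of complex functions; norms, directions and monomials *)

Section complex_measurability.
Variable R : realType.

Lemma measurable_complex d (T : measurableType d) (D : set T) (f : T -> R[i]) :
  measurable_fun D (fun x => complex.Re (f x)) ->
  measurable_fun D (fun x => complex.Im (f x)) -> measurable_fun D f.
Proof.
move=> mr mi mD; apply: (measurability
  (preimage_set_system setT (@complex.Re R) measurable `|`
   preimage_set_system setT (@complex.Im R) measurable)) => //.
move=> _ [_ [|] [B mB <-] <-]; rewrite !setTI.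
- exact: mr.
- exact: mi.
Qed.

Lemma measurable_Re_comp d (T : measurableType d) (D : set T) (f : T -> R[i]) :
  measurable_fun D f -> measurable_fun D (fun x => complex.Re (f x)).
Proof. by move=> mf; apply: (measurableT_comp _ mf); exact: measurable_Re. Qed.

Lemma measurable_Im_comp d (T : measurableType d) (D : set T) (f : T -> R[i]) :
  measurable_fun D f -> measurable_fun D (fun x => complex.Im (f x)).
Proof. by move=> mf; apply: (measurableT_comp _ mf); exact: measurable_Im. Qed.

Lemma measurable_complexM d (T : measurableType d) (D : set T)
    (f g : T -> R[i]) : measurable_fun D f -> measurable_fun D g ->
  measurable_fun D (fun x => f x * g x).
Proof.
move=> mf mg; have mRf := measurable_Re_comp mf.
have mIf := measurable_Im_comp mf; have mRg := measurable_Re_comp mg.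
have mIg := measurable_Im_comp mg.
apply: measurable_complex.
- rewrite (_ : (fun x => _) = (fun x => complex.Re (f x) * complex.Re (g x) -
    complex.Im (f x) * complex.Im (g x))).
    by apply: measurable_funB; exact: measurable_funM.
  by apply/funext => x; case: (f x) (g x) => [? ?] [? ?].
- rewrite (_ : (fun x => _) = (fun x => complex.Re (f x) * complex.Im (g x) +
    complex.Im (f x) * complex.Re (g x))).
    by apply: measurable_funD; exact: measurable_funM.
  by apply/funext => x; case: (f x) (g x) => [? ?] [? ?].
Qed.

Lemma measurable_conjc d (T : measurableType d) (D : set T) (f : T -> R[i]) :
  measurable_fun D f -> measurable_fun D (fun x => (f x)^*%C).
Proof.
move=> mf; apply: measurable_complex.
- rewrite (_ : (fun x => _) = (fun x => complex.Re (f x))).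
    exact: measurable_Re_comp.
  by apply/funext => x; case: (f x).
- rewrite (_ : (fun x => _) = (fun x => - complex.Im (f x))).
    exact/measurable_funN/measurable_Im_comp.
  by apply/funext => x; case: (f x).
Qed.

Lemma measurable_real_complex d (T : measurableType d) (D : set T) (f : T -> R) :
  measurable_fun D f -> measurable_fun D (fun x => (f x)%:C%C).
Proof. by move=> mf; exact: measurable_complex. Qed.

Lemma measurable_complexX d (T : measurableType d) (D : set T) (f : T -> R[i])
    n : measurable_fun D f -> measurable_fun D (fun x => f x ^+ n).
Proof.
move=> mf; elim: n => [|n IH]; first exact: measurable_cst.
by under eq_fun do rewrite exprS; exact: measurable_complexM.
Qed.

Lemma measurable_complex_prod d (T : measurableType d) (D : set T) (I : Type)
    (s : seq I) (f : I -> T -> R[i]) :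
  (forall i, measurable_fun D (f i)) ->
  measurable_fun D (fun x => \prod_(i <- s) f i x).
Proof.
move=> mf; elim: s => [|i s IH].
  by under eq_fun do rewrite big_nil; exact: measurable_cst.
by under eq_fun do rewrite big_cons; exact: measurable_complexM.
Qed.

Lemma normcE (z : R[i]) :
  Normc.normc z ^+ 2 = complex.Re z ^+ 2 + complex.Im z ^+ 2.
Proof. by case: z => x y; rewrite /= sqr_sqrtr// addr_ge0// sqr_ge0. Qed.

Lemma normc_ge0 (z : R[i]) : 0 <= Normc.normc z.
Proof. by case: z => x y; exact: sqrtr_ge0. Qed.

Lemma measurable_normc d (T : measurableType d) (D : set T) (f : T -> R[i]) :
  measurable_fun D f -> measurable_fun D (fun x => Normc.normc (f x)).
Proof.
move=> mf; rewrite (_ : (fun x => _) = (fun x => Num.sqrt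
    (complex.Re (f x) ^+ 2 + complex.Im (f x) ^+ 2))).
  apply: (measurableT_comp (@measurable_sqrt R)).
  apply: measurable_funD; apply: measurable_funX.
  - exact: measurable_Re_comp.
  - exact: measurable_Im_comp.
by apply/funext => x; case: (f x).
Qed.

Lemma measurable_cnorm n : measurable_fun [set: 'cV[R[i]]_n] (@cnorm R n).
Proof.
apply: (measurable_fun_comp (@measurable_sqrt R)).
apply: measurable_sum => i; apply: measurable_funX.
by apply: measurable_normc; exact: measurable_coord.
Qed.

Lemma measurable_rnorm n : measurable_fun [set: 'cV[R]_n] (@rnorm R n).
Proof.
apply: (measurable_fun_comp (@measurable_sqrt R)).
by apply: measurable_sum => i; apply: measurable_funX; exact: measurable_coord.
Qed.

Lemma measurable_monomial n (alpha : 'cV[nat]_n) :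
  measurable_fun setT (@monomial R n alpha).
Proof.
apply: measurable_complex_prod => i; apply: measurable_complexX.
exact: measurable_coord.
Qed.

Definition cdirection n (z : 'cV[R[i]]_n) : 'cV[R[i]]_n :=
  ((cnorm z)^-1)%:C%C *: z.

Lemma measurable_cdirection n : measurable_fun setT (@cdirection n).
Proof.
apply: measurable_fun_matrixP => i j.
rewrite (_ : (fun _ => _) = (fun z : 'cV[R[i]]_n => ((cnorm z)^-1)%:C%C * z i j)).
  apply: measurable_complexM; last exact: measurable_coord.
  apply: measurable_real_complex.
  exact: (measurable_fun_comp (@measurable_inv R) (@measurable_cnorm n)).
by apply/funext => z; rewrite mxE.
Qed.

Lemma cnorm_ge0 n (z : 'cV[R[i]]_n) : 0 <= cnorm z.
Proof. exact: sqrtr_ge0. Qed.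

Lemma cnorm_sqr n (z : 'cV[R[i]]_n) :
  cnorm z ^+ 2 = \sum_i Normc.normc (z i 0) ^+ 2.
Proof. by rewrite /cnorm sqr_sqrtr// sumr_ge0// => i _; exact: sqr_ge0. Qed.

Lemma normc_realM (r : R) (z : R[i]) :
  Normc.normc (r%:C%C * z) = `|r| * Normc.normc z.
Proof. by rewrite Normc.normcM; congr (_ * _); rewrite /= expr0n/= addr0 sqrtr_sqr. Qed.

Lemma cnormZ n (r : R) (z : 'cV[R[i]]_n) :
  cnorm (r%:C%C *: z) = `|r| * cnorm z.
Proof.
rewrite -[LHS]ger0_norm ?cnorm_ge0// -[X in _ * X]ger0_norm ?cnorm_ge0// -normrM.
rewrite -!sqrtr_sqr exprMn !cnorm_sqr mulr_sumr; congr Num.sqrt.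
by apply: eq_bigr => i _; rewrite mxE normc_realM exprMn real_normK// num_real.
Qed.

Lemma cnorm_complex n (x : 'cV[R]_(n + n)) :
  cnorm (cV_complex x) = Num.sqrt (sqnorm x).
Proof.
rewrite /cnorm /sqnorm big_split_ord/= -big_split/=; congr Num.sqrt.
by apply: eq_bigr => i _; rewrite normcE !mxE.
Qed.

Lemma monomialZ n (alpha : 'cV[nat]_n) (c : R[i]) (z : 'cV[R[i]]_n) :
  monomial alpha (c *: z) = c ^+ mi_size alpha * monomial alpha z.
Proof.
rewrite /monomial /mi_size -prodrXr -big_split/=.
by apply: eq_bigr => i _; rewrite mxE exprMn.
Qed.

End complex_measurability.

(** * Polar coordinates in C^n *)

Section complex_polar.
Variable R : realType.
Local Notation leb := (@lebesgue_measure R).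

Lemma sqnorm_cV_cons n (t : R) (y : 'cV[R]_n) :
  sqnorm (cV_cons (t, y)) = t ^+ 2 + sqnorm y.
Proof.
rewrite /sqnorm big_ord_recl; congr (_ + _).
  have -> // : cV_cons (t, y) ord0 0 = t.
  have -> : ord0 = lshift n (0 : 'I_1) by exact/val_inj.
  by rewrite [LHS]col_mxEu mxE eqxx.
apply: eq_bigr => l _; have -> // : cV_cons (t, y) (lift ord0 l) 0 = y l 0.
by rewrite /cV_cons -rshift1 [LHS]col_mxEd.
Qed.

Lemma measurable_csphere n : measurable (csphere R n).
Proof.
rewrite (_ : csphere R n = @cnorm R n @^-1` [set 1]); last by apply/seteqP; split.
by rewrite -[X in measurable X]setTI; exact: measurable_cnorm.
Qed.

Lemma measurable_cball n : measurable (cball R n).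
Proof.
rewrite (_ : cball R n = @cnorm R n @^-1` `]-oo, 1[).
  by rewrite -[X in measurable X]setTI; exact: measurable_cnorm.
by apply/seteqP; split => z /=; rewrite in_itv.
Qed.

(** A chart point has squared norm [(1 - |y|^2) + |y|^2 = 1], so this measure on the ambient space
    is carried by the unit sphere. *)
Lemma sphere_complexC n : (0 < n)%N -> sphere_complex R n (~` csphere R n) = 0%E.
Proof.
case: n => // n _; rewrite /= /image_measure /pushforward.
set A := _ @^-1` _.
rewrite /two_hemispheres measure_addE.
have AE s : hemisphere_measure s A = 0%E.
  rewrite /hemisphere_measure [X in integral _ X](_ : _ = set0).
    by rewrite integral_set0.
  apply/seteqP; split => // y [] /= y1; apply; rewrite /csphere/= cnorm_complex.
  rewrite [sqnorm _]sqnorm_cV_cons exprMn sqrr_sign mul1r sqr_sqrtr.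
    by rewrite subrK sqrtr1.
  by rewrite subr_ge0 ltW.
by rewrite -[RHS]adde0; congr (_ + _)%E; exact: AE.
Qed.

Lemma cV_complexZ n (r : R) (x : 'cV[R]_(n + n)) :
  cV_complex (r *: x) = r%:C%C *: cV_complex x.
Proof.
apply/matrixP => i j; rewrite !mxE; apply/eqP; rewrite eq_complex/=.
by rewrite !mul0r subr0 addr0 !eqxx.
Qed.

Local Open Scope ereal_scope.

Lemma measurable_cscale n (r : R) :
  measurable_fun [set: 'cV[R[i]]_n] (fun z => r%:C%C *: z)%R.
Proof.
apply: measurable_fun_matrixP => i j.
rewrite (_ : (fun _ => _) = (fun z : 'cV[R[i]]_n => r%:C%C * z i j)%R).
  by apply: measurable_complexM => //; exact: measurable_coord.
by apply/funext => z; rewrite mxE.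
Qed.

Lemma polar_complex n (g : 'cV[R[i]]_n -> \bar R) : (0 < n)%N ->
  measurable_fun setT g -> (forall z, 0 <= g z) ->
  \int[lebesgue_complex R n]_z g z =
  \int[leb]_(r in `]0%R, +oo[)
    (\int[sphere_complex R n]_xi g (r%:C%C *: xi)%R * (r ^+ (2 * n - 1))%:E).
Proof.
case: n g => // n g _ mg g0; rewrite ge0_integral_image_measure//.
have mgc := measurable_fun_comp mg (@measurable_cV_complex R n.+1).
(* The real dimension [n.+1 + n.+1] is convertible to [(n + n.+1).+1], so the exponent of [r] is
   [n + n.+1 = 2 * n.+1 - 1]. *)
rewrite [LHS](@polar_cV R (n + n.+1) (fun x => g (@cV_complex R n.+1 x)))//.
apply: eq_integral => r _.
rewrite ge0_integral_image_measure//; last first.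
  exact: (measurable_fun_comp mg (@measurable_cscale _ r)).
congr (_ * (_ ^+ _)%:E); last by rewrite mul2n -addnn addSn subn1.
by apply: eq_integral => x _; rewrite cV_complexZ.
Qed.

(** The norm and direction of [r *: xi] are [r] and [xi] when [xi] has norm 1; the other [xi] form a
    null set, and restricting to the sphere discards them. *)
Lemma polar_complex_direction n (H : R * 'cV[R[i]]_n -> \bar R) : (0 < n)%N ->
  measurable_fun setT H -> (forall x, 0 <= H x) ->
  \int[lebesgue_complex R n]_z H (cnorm z, cdirection z) =
  \int[leb]_(r in `]0%R, +oo[)
    (\int[sphere_complex R n]_(xi in csphere R n) H (r, xi) *
     (r ^+ (2 * n - 1))%:E).
Proof.
move=> n0 mH H0.
have mg : measurable_fun setT (fun z : 'cV[R[i]]_n => H (cnorm z, cdirection z)).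
  apply: (measurable_fun_comp mH); apply: measurable_fun_pair.
    exact: (@measurable_cnorm R n).
  exact: (@measurable_cdirection R n).
rewrite (polar_complex n0 mg)//; apply: eq_integral => r.
rewrite inE/= in_itv/= andbT => r0; congr (_ * _).
have mgr := measurable_fun_comp mg (@measurable_cscale n r).
rewrite (@ge0_negligible_integral _ _ _ (sphere_complex R n) setT (~` csphere R n) _ _ _ mgr)//; last 2 first.
- apply: measurableC; exact: measurable_csphere.
- exact: (@sphere_complexC n).
rewrite setTD setCK; apply: eq_integral => xi; rewrite inE /csphere/= => xi1.
have E : cnorm (r%:C%C *: xi : 'cV[R[i]]_n)%R = r by rewrite cnormZ xi1 mulr1 gtr0_norm.
have -> : cdirection (r%:C%C *: xi : 'cV[R[i]]_n)%R = xi.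
  by rewrite /cdirection E scalerA -rmorphM/= mulVf ?gt_eqF// rmorph1 scale1r.
by rewrite E.
Qed.

End complex_polar.

(** * Product structure of Lebesgue measure *)

Section lebesgue_split.
Variable R : realType.
Local Notation leb := (@lebesgue_measure R).

Lemma measurable_col_mx d (T : measurableType d) p q :
  measurable_fun setT (fun x : 'cV[T]_p * 'cV[T]_q => col_mx x.1 x.2).
Proof.
apply: measurable_fun_matrixP => i j; have [l ->|l ->] := split_ordP i.
- under eq_fun do rewrite col_mxEu.
  exact: (measurable_fun_comp (@measurable_coord _ T _ _ l j)).
- under eq_fun do rewrite col_mxEd.
  exact: (measurable_fun_comp (@measurable_coord _ T _ _ l j)).
Qed.

Local Open Scope ereal_scope.

Lemma lebesgue_cV_split p q (g : 'cV[R]_(p + q) -> \bar R) :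
  measurable_fun setT g -> (forall x, 0 <= g x) ->
  \int[lebesgue_cV R (p + q)]_x g x =
  \int[lebesgue_cV R p]_x \int[lebesgue_cV R q]_y g (col_mx x y).
Proof.
elim: p g => [|p IH] g mg g0.
  have mF : measurable_fun setT (fun x => \int[lebesgue_cV R q]_y g (col_mx x y)).
    apply: measurable_partial_integral => //.
    exact: (measurable_fun_comp mg (@measurable_col_mx _ _ 0 q)).
  rewrite [RHS]integral_dirac// diracT mul1e; apply: eq_integral => y _.
  congr g; apply/matrixP => i j; have [[]//|l ->] := split_ordP i.
  by rewrite col_mxEd; congr (y _ _); exact/val_inj.
have mgc := measurable_fun_comp mg (@measurable_cV_cons R (p + q)).
apply: (etrans (@lebesgue_cV_cons R (p + q) g mg g0)).
have mF : measurable_fun setT (fun x : 'cV[R]_p.+1 =>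
    \int[lebesgue_cV R q]_y g (col_mx x y)).
  apply: measurable_partial_integral => //.
  exact: (measurable_fun_comp mg (@measurable_col_mx _ _ p.+1 q)).
rewrite lebesgue_cV_cons//; last by move=> x; exact: integral_ge0.
apply: eq_integral => t _; rewrite (IH (fun y => g (cV_cons (t, y))))//; last first.
  by apply: (measurable_fun_comp mgc); exact: measurable_fun_pair.
apply: eq_integral => x _; apply: eq_integral => y _; congr g.
by rewrite /cV_cons -[LHS]/(col_mx _ _) col_mxA castmx_id.
Qed.

Lemma cV_complex_col_mx p q (a1 b1 : 'cV[R]_p) (a2 b2 : 'cV[R]_q) :
  cV_complex (col_mx (col_mx a1 a2) (col_mx b1 b2)) =
  col_mx (cV_complex (col_mx a1 b1)) (cV_complex (col_mx a2 b2)).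
Proof.
apply/colP => i; rewrite /cV_complex !(col_mxKu, col_mxKd) mxE.
by have [l ->|l ->] := split_ordP i; rewrite !(col_mxEu, col_mxEd) mxE.
Qed.

Lemma lebesgue_complex_Re_Im n (g : 'cV[R[i]]_n -> \bar R) :
  measurable_fun setT g -> (forall z, 0 <= g z) ->
  \int[lebesgue_complex R n]_z g z =
  \int[lebesgue_cV R n]_x \int[lebesgue_cV R n]_y g (cV_complex (col_mx x y)).
Proof.
move=> mg g0; rewrite ge0_integral_image_measure//.
rewrite (lebesgue_cV_split (g := fun x => g (cV_complex x)))//.
exact: (measurable_fun_comp mg (@measurable_cV_complex R n)).
Qed.

(** All real parts come before all imaginary parts in the real coordinates of C^(p+q). Splitting
    both groups gives the order [a], [b], [c], [d], with [a], [c] the parts of the first block; one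
    Tonelli exchange of [b] and [c] regroups them. *)
Lemma lebesgue_complex_split p q (g : 'cV[R[i]]_(p + q) -> \bar R) :
  measurable_fun setT g -> (forall z, 0 <= g z) ->
  \int[lebesgue_complex R (p + q)]_z g z =
  \int[lebesgue_complex R p]_x \int[lebesgue_complex R q]_y g (col_mx x y).
Proof.
move=> mg g0.
have mC n := measurable_fun_comp (@measurable_cV_complex R n) (@measurable_col_mx _ _ n n).
pose h (x : ('cV[R]_p * 'cV[R]_p) * ('cV[R]_q * 'cV[R]_q)) : \bar R :=
  g (col_mx (cV_complex (col_mx x.1.1 x.1.2)) (cV_complex (col_mx x.2.1 x.2.2))).
have mh : measurable_fun setT h.
  have mgc := measurable_fun_comp mg (@measurable_col_mx _ _ p q).
  have mp : measurable_fun setT (fun x : ('cV[R]_p * 'cV[R]_p) * ('cV[R]_q * 'cV[R]_q) =>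
      cV_complex (col_mx x.1.1 x.1.2)).
    exact: (@measurable_fun_comp _ _ _ _ _ _ _ fst (mC p)).
  have mq : measurable_fun setT (fun x : ('cV[R]_p * 'cV[R]_p) * ('cV[R]_q * 'cV[R]_q) =>
      cV_complex (col_mx x.2.1 x.2.2)).
    exact: (@measurable_fun_comp _ _ _ _ _ _ _ snd (mC q)).
  exact: (measurable_fun_comp mgc (measurable_fun_pair mp mq)).
have h0 x : 0 <= h x by exact: g0.
transitivity (\int[lebesgue_cV R p]_a \int[lebesgue_cV R q]_b
    \int[lebesgue_cV R p]_c \int[lebesgue_cV R q]_d h ((a, c), (b, d))).
  rewrite lebesgue_complex_Re_Im//.
  rewrite (@lebesgue_cV_split p q (fun x => \int[lebesgue_cV R (p + q)]_y
    g (cV_complex (col_mx x y)))); last 2 first.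
  - apply: measurable_partial_integral => //.
    exact: (measurable_fun_comp mg (mC (p + q)%N)).
  - by move=> x; exact: integral_ge0.
  apply: eq_integral => a _; apply: eq_integral => b _.
  rewrite (@lebesgue_cV_split p q (fun y =>
    g (cV_complex (col_mx (col_mx a b) y))))//; last first.
    have mC2 := measurable_fun_comp mg (mC (p + q)%N).
    apply: (@measurable_fun_comp _ _ _ _ _ _ _ (fun y => (col_mx a b, y)) mC2).
    exact: measurable_fun_pair.
  apply: eq_integral => c _; apply: eq_integral => d _.
  by rewrite cV_complex_col_mx.
transitivity (\int[lebesgue_cV R p]_a \int[lebesgue_cV R p]_c
    \int[lebesgue_cV R q]_b \int[lebesgue_cV R q]_d h ((a, c), (b, d))).
  apply: eq_integral => a _.
  apply: (@fubini_tonelli _ _ _ _ _ (lebesgue_cV R q) (lebesgue_cV R p)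
    (fun x => \int[lebesgue_cV R q]_d h ((a, x.2), (x.1, d)))).
    apply: measurable_partial_integral => //; apply: (measurable_fun_comp mh).
    by apply: measurable_fun_pair; apply: measurable_fun_pair => //;
      exact: (@measurable_fun_comp _ _ _ _ _ _ _ fst).
  by move=> x; exact: integral_ge0.
rewrite lebesgue_complex_Re_Im; last 2 first.
- apply: measurable_partial_integral => //.
  exact: (measurable_fun_comp mg (@measurable_col_mx _ _ p q)).
- by move=> x; exact: integral_ge0.
apply: eq_integral => a _; apply: eq_integral => c _.
rewrite lebesgue_complex_Re_Im//.
have mgc := measurable_fun_comp mg (@measurable_col_mx _ _ p q).
apply: (@measurable_fun_comp _ _ _ _ _ _ _ (fun y => (cV_complex (col_mx a c), y)) mgc).
exact: measurable_fun_pair.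
Qed.

End lebesgue_split.

(** * Integrals of products over coordinates or blocks *)

Section product_integrals.
Variable R : realType.
Local Notation leb := (@lebesgue_measure R).
Local Open Scope ereal_scope.

Lemma emeasurable_prod d (T : measurableType d) (I : Type) (s : seq I)
    (f : I -> T -> \bar R) : (forall i, measurable_fun setT (f i)) ->
  measurable_fun setT (fun x => \prod_(i <- s) f i x).
Proof.
move=> mf; elim: s => [|i s IH].
  by under eq_fun do rewrite big_nil; exact: measurable_cst.
by under eq_fun do rewrite big_cons; exact: emeasurable_funM.
Qed.

Lemma ge0_integral_mul d1 d2 (T1 : measurableType d1) (T2 : measurableType d2)
    (m1 : {measure set T1 -> \bar R}) (m2 : {measure set T2 -> \bar R})
    (f : T1 -> \bar R) (h : T2 -> \bar R) :
  measurable_fun setT f -> (forall x, 0 <= f x) ->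
  measurable_fun setT h -> (forall y, 0 <= h y) ->
  \int[m1]_x \int[m2]_y (f x * h y) = \int[m1]_x f x * \int[m2]_y h y.
Proof.
move=> mf f0 mh h0; rewrite -ge0_integralZr//; last exact: integral_ge0.
by apply: eq_integral => x _; rewrite ge0_integralZl.
Qed.

Lemma lebesgue_cV_prod m (h : 'I_m -> R -> \bar R) :
  (forall l, measurable_fun setT (h l)) -> (forall l r, 0 <= h l r) ->
  \int[lebesgue_cV R m]_r \prod_l h l (r l 0%R) = \prod_l \int[leb]_t h l t.
Proof.
move=> mh h0; elim: m h mh h0 => [|m IH] h mh h0.
  rewrite integral_dirac// ?diracT ?mul1e ?big_ord0//.
  by under eq_fun do rewrite big_ord0; exact: measurable_cst.
have mp n (g : 'I_n -> R -> \bar R) : (forall l, measurable_fun setT (g l)) ->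
    measurable_fun setT (fun r : 'cV[R]_n => \prod_l g l (r l 0%R)).
  move=> mg; apply: emeasurable_prod => l.
  exact: (measurable_fun_comp (mg l) (measurable_coord l 0%R)).
rewrite lebesgue_cV_cons//; last 2 first.
- exact: mp.
- by move=> r; exact: prode_ge0.
rewrite big_ord_recl -IH// -ge0_integral_mul//; last 2 first.
- exact: (mp _ (fun l => h (lift ord0 l))).
- by move=> r; exact: prode_ge0.
2: exact: mh.
apply: eq_integral => t _; apply: eq_integral => y _.
rewrite big_ord_recl; congr (h _ _ * _).
  have -> : ord0 = lshift m (0%R : 'I_1) by exact/val_inj.
  by rewrite [LHS]col_mxEu mxE eqxx.
apply: eq_bigr => l _; congr (h _ _).
by rewrite /cV_cons -rshift1 [LHS]col_mxEd.
Qed.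

Lemma lebesgue_complex0 (g : 'cV[R[i]]_0 -> \bar R) : measurable_fun setT g ->
  (forall z, 0 <= g z) -> \int[lebesgue_complex R 0]_z g z = g 0%R.
Proof.
move=> mg g0; rewrite ge0_integral_image_measure// integral_dirac//.
  by rewrite diracT mul1e [cV_complex _]flatmx0.
exact: (measurable_fun_comp mg (@measurable_cV_complex R 0)).
Qed.

Lemma lebesgue_complex_prod n (h : 'I_n -> R[i] -> \bar R) :
  (forall l, measurable_fun setT (h l)) -> (forall l r, 0 <= h l r) ->
  \int[lebesgue_complex R n]_z \prod_l h l (z l 0%R) =
  \prod_l \int[lebesgue_complex R 1]_z h l (z 0%R 0%R).
Proof.
have mp p (g : 'I_p -> R[i] -> \bar R) : (forall l, measurable_fun setT (g l)) ->
    measurable_fun setT (fun r : 'cV[R[i]]_p => \prod_l g l (r l 0%R)).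
  move=> mg; apply: emeasurable_prod => l.
  exact: (measurable_fun_comp (mg l) (measurable_coord l 0%R)).
elim: n h => [|n IH] h mh h0.
  rewrite lebesgue_complex0 ?big_ord0//; first exact: mp.
  by move=> z; exact: prode_ge0.
rewrite (@lebesgue_complex_split R 1 n (fun z => \prod_l h l (z l 0%R))); last 2 first.
- exact: mp.
- by move=> r; exact: prode_ge0.
rewrite big_ord_recl -(IH (fun l => h (lift ord0 l)))// -ge0_integral_mul//; last 2 first.
- exact: (mp _ (fun l => h (lift ord0 l))).
- by move=> r; exact: prode_ge0.

2: exact: (measurable_fun_comp (mh _) (measurable_coord 0%R 0%R)).
apply: eq_integral => x _; apply: eq_integral => y _.
rewrite big_ord_recl; congr (h _ _ * _).
  have -> : ord0 = lshift n (0%R : 'I_1) by exact/val_inj.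
  by rewrite col_mxEu.
by apply: eq_bigr => l _; congr (h _ _); rewrite -rshift1 col_mxEd.
Qed.

Lemma measurable_submxcol d (T : measurableType d) m (k : 'I_m -> nat) l :
  measurable_fun setT (fun z : 'cV[T]_(\sum_i k i) => submxcol z l).
Proof.
apply: measurable_fun_matrixP => i j.
rewrite (_ : (fun z => _) = (fun z : 'cV[T]_(\sum_i k i) => z (tagnat.Rank l i) j)).
  exact: measurable_coord.
by apply/funext => z; rewrite mxE.
Qed.

(** A sum of block sizes is only provably equal to the size [p + q], or 0, that the splitting lemmas
    expect; this transports an integral along such an equality. *)
Lemma lebesgue_complex_cast p q (e : p = q) (g : 'cV[R[i]]_q -> \bar R) :
  \int[lebesgue_complex R q]_z g z =
  \int[lebesgue_complex R p]_z g (castmx (e, erefl) z).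
Proof.
by case: q / e g => g; apply: eq_integral => z _; rewrite castmx_id.
Qed.

Lemma lebesgue_complex_blocks m (k : 'I_m -> nat)
    (g : forall l, 'cV[R[i]]_(k l) -> \bar R) :
  (forall l, measurable_fun setT (g l)) -> (forall l z, 0 <= g l z) ->
  \int[lebesgue_complex R (\sum_l k l)]_z \prod_l g l (submxcol z l) =
  \prod_l \int[lebesgue_complex R (k l)]_z g l z.
Proof.
have mp p (k' : 'I_p -> nat) (g' : forall l, 'cV[R[i]]_(k' l) -> \bar R) :
    (forall l, measurable_fun setT (g' l)) ->
    measurable_fun setT (fun z : 'cV[R[i]]_(\sum_l k' l) =>
      \prod_l g' l (submxcol z l)).
  move=> mg; apply: emeasurable_prod => l.
  exact: (measurable_fun_comp (mg l) (@measurable_submxcol _ _ p k' l)).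
elim: m k g => [|m IH] k g mg g0.
  have e : (0 = \sum_(l < 0) k l)%N by rewrite big_ord0.
  rewrite (lebesgue_complex_cast e) [RHS]big_ord0.
  rewrite (eq_integral (cst 1)) ?lebesgue_complex0// => z _.
  by rewrite [LHS]big_ord0.
rewrite (lebesgue_complex_cast (@mxsize_recl m k)).
(* The blocks of the stacked column are [x] followed by those of [y]: rebuild the column from its
   blocks and compare, the cast and [col_mx] being injective. *)
have sub0 x y : submxcol (castmx (@mxsize_recl m k, erefl) (col_mx x y)) ord0 = x
    :> 'cV[R[i]]_(k ord0) /\ forall l,
    submxcol (castmx (@mxsize_recl m k, erefl) (col_mx x y)) (lift ord0 l) =
    submxcol y l :> 'cV[R[i]]_(k (lift ord0 l)).
  set z := castmx _ _.
  have : z = castmx (@mxsize_recl m k, erefl) (col_mx (submxcol z ord0)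
      (\mxcol_l submxcol z (lift ord0 l))).
    by rewrite -[LHS]submxcolK mxcol_recu.
  rewrite /z => /(can_inj (castmxK _ _))/eq_col_mx[<- Ey]; split => // l.
  by rewrite [in RHS]Ey mxcolK.
rewrite (@lebesgue_complex_split R (k ord0) (\sum_l k (lift ord0 l))%N
  (fun z => \prod_l g l (submxcol (castmx (@mxsize_recl m k, erefl) z) l))); last 2 first.
- have mcast p q (e : p = q) :
      measurable_fun setT (fun z : 'cV[R[i]]_p => castmx (e, erefl 1%N) z).
    case: q / e; rewrite (_ : (fun z => _) = id); first exact: measurable_id.
    by apply/funext => z; rewrite castmx_id.
  exact: (measurable_fun_comp (mp _ _ _ mg) (mcast _ _ (@mxsize_recl m k))).
- by move=> r; exact: prode_ge0.
rewrite [RHS]big_ord_recl -(IH _ (fun l => g (lift ord0 l)))//.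
rewrite -ge0_integral_mul//; last 2 first.
- exact: (mp _ _ (fun l => g (lift ord0 l))).
- by move=> r; exact: prode_ge0.
2: exact: mg.
apply: eq_integral => x _; apply: eq_integral => y _.
have [E0 El] := sub0 x y; rewrite [LHS]big_ord_recl E0; congr (_ * _).
by apply: eq_bigr => l _; rewrite El.
Qed.

End product_integrals.

(** * Moments of the sphere *)

Section gaussian.
Variable R : realType.
Local Notation leb := (@lebesgue_measure R).

(* [- gamma_poly n x * expR (- x)] is a primitive of [x ^+ n * expR (- x)]. *)
Fixpoint gamma_poly (n : nat) (x : R) : R :=
  if n is k.+1 then n%:R * gamma_poly k x + x ^+ n else 1.

Lemma is_derive_gamma_poly n (x : R) :
  is_derive x 1 (gamma_poly n) (gamma_poly n x - x ^+ n).
Proof.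
elim: n => [|n IH] /=; first by rewrite subrr; exact: is_derive_cst.
have dX : is_derive x 1 (fun y : R => y ^+ n.+1) (n.+1%:R * x ^+ n).
  have := is_deriveX n.+1 (is_derive_id x 1); rewrite exprfctE => dX.
  by apply: (is_derive_eq dX); rewrite [LHS]mulr1.
have dZ : is_derive x 1 (fun y : R => n.+1%:R * gamma_poly n y)
    (n.+1%:R * (gamma_poly n x - x ^+ n)) := is_deriveZ _ IH.
apply: (is_derive_eq (is_deriveD dZ dX)); ring.
Qed.

Lemma gamma_poly0 n : gamma_poly n 0 = n`!%:R.
Proof.
by elim: n => //= n ->; rewrite expr0n addr0 -natrM factS.
Qed.

Lemma cvg_exprn_expRN n : x ^+ n * expR (- x) @[x --> +oo] --> (0 : R).
Proof.
apply: (@squeeze_cvgr _ _ _ _ (cst 0) (fun x : R => n.+1`!%:R * x^-1)).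
- near=> x; have x0 : 0 < x by near: x; exact: nbhs_pinfty_gt.
  apply/andP; split; first by rewrite mulr_ge0 ?exprn_ge0 ?expR_ge0 ?ltW.
  rewrite expRN ler_pdivrMr ?expR_gt0// mulrAC ler_pdivlMr// -exprSr.
  rewrite mulrC -ler_pdivrMr ?ltr0n ?fact_gt0//.
  by apply: le_trans (expR_ge1Dxn n (ltW x0)); rewrite lerDr.
- exact: cvg_cst.
- rewrite -(mulr0 n.+1`!%:R); apply: cvgM; first exact: cvg_cst.
  by apply/(@gtr0_cvgV0 _ _ _ _ id); [exact: nbhs_pinfty_gt|exact: cvg_id].
Unshelve. all: by end_near.
Qed.

Lemma cvg_gamma_poly n : gamma_poly n x * expR (- x) @[x --> +oo] --> (0 : R).
Proof.
elim: n => [|n IH] /=.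
  by under eq_fun do rewrite mul1r; exact: cvgr_expR.
under eq_fun do rewrite mulrDl -mulrA.
have := cvgD (cvgM (cvg_cst (n.+1%:R : R)) IH) (cvg_exprn_expRN n.+1).
by rewrite mulr0 addr0; apply.
Qed.

Local Open Scope ereal_scope.

Lemma integral_gamma_nat n :
  \int[leb]_(x in `[0%R, +oo[) (x ^+ n * expR (- x))%:E = n`!%:R%:E.
Proof.
have dF (x : R) : is_derive x 1%R (fun x : R => - (gamma_poly n x * expR (- x)))%R
    (x ^+ n * expR (- x))%R.
  have := is_derive_gamma_poly n x => dG.
  have dE : is_derive x 1%R (fun x : R => expR (- x))%R (- expR (- x))%R.
    by apply: is_derive_eq; rewrite /GRing.scale/=; ring.
  apply: (is_derive_eq (is_deriveN (is_deriveM dG dE))); rewrite /GRing.scale/=; ring.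
have cF : continuous (fun x : R => - (gamma_poly n x * expR (- x)))%R.
  move=> x; apply: differentiable_continuous; apply/derivable1_diffP.
  by have [] := dF x.
rewrite (@ge0_continuous_FTC2y _ _ (fun x => - (gamma_poly n x * expR (- x)))%R 0%R 0%R).
- by rewrite oppr0 expR0 mulr1 gamma_poly0 -EFinB opprK add0r.
- by move=> x x0; rewrite mulr_ge0 ?exprn_ge0 ?expR_ge0.
- apply: continuous_subspaceT => x; apply: cvgM; first exact: exprn_continuous.
  apply: continuous_comp; [exact: opp_continuous|exact: continuous_expR].
- by have /cvgN := cvg_gamma_poly n; rewrite oppr0; apply.
- by move=> x _; have [] := dF x.
- by apply: cvg_at_right_filter; exact: cF.
- by move=> x _; rewrite derive1E; have [_ ->] := dF x.
Qed.

Lemma integral_radial_gauss n :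
  \int[leb]_(r in `]0%R, +oo[) (r ^+ (2 * n).+1 * expR (- r ^+ 2))%:E =
  (n`!%:R / 2)%:E.
Proof.
(* The substitution is [u = r ^+ 2], performed as a signed square on the whole line. The indicator
   removes the negative half-line and keeps [g] nonnegative also for odd [n]. *)
pose g (u : R) := (\1_(`]0%R, +oo[) u * (u ^+ n * expR (- u)))%:E.
have mG : measurable_fun setT (fun u : R => u ^+ n * expR (- u))%R.
  apply: measurable_funM => //.
  exact: (measurable_fun_comp (@measurable_expR R) (@oppr_measurable R setT)).
have mg : measurable_fun setT g by apply/measurable_EFinP/measurable_funM.
have g0 u : 0 <= g u.
  rewrite /g indicE lee_fin; case: (boolP (u \in _)) => [|_]; last by rewrite mul0r.
  rewrite inE/= in_itv/= andbT => u0.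
  by rewrite mul1r mulr_ge0 ?exprn_ge0 ?expR_ge0 ?ltW.
have : \int[leb]_u g u = n`!%:R%:E.
  rewrite -integral_gamma_nat.
  transitivity (\int[leb]_(x in `]0%R, +oo[) (x ^+ n * expR (- x))%:E); last first.
    by apply: integral_itv_obnd_cbnd; apply/measurable_EFinP/measurable_funTS.
  rewrite [RHS]integral_mkcond epatch_indic; apply: eq_integral => u _.
  by rewrite /g mulrC EFinM.
rewrite integral_mulr_norm// => E.
rewrite [in RHS]mulrC [in RHS]EFinM -E -ge0_integralZl//; last 2 first.
- apply: emeasurable_funM.
    apply: (@measurable_fun_comp _ _ _ _ _ _ g (fun x : R => x * `|x|)%R mg).
    exact: measurable_funM.
  by apply/measurable_EFinP; exact: measurable_funM.
- by move=> x _; rewrite mule_ge0// lee_fin.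
rewrite [LHS]integral_mkcond epatch_indic; apply: eq_integral => r _.
rewrite /g -!EFinM; congr EFin; rewrite !indicE.
have [r0|r0] := ltP 0%R r.
  rewrite gtr0_norm// -expr2 !mem_set/= ?in_itv/= ?r0 ?exprn_gt0//.
  by rewrite exprS exprM; field.
rewrite !memNset ?mul0r ?mulr0//= in_itv/= andbT => /lt_geF; rewrite ?r0//.
by rewrite mulr_le0_ge0.
Qed.

End gaussian.

Section sphere_moment.
Variable R : realType.
Local Notation leb := (@lebesgue_measure R).

Lemma normc_prod (I : Type) (s : seq I) (f : I -> R[i]) :
  Normc.normc (\prod_(i <- s) f i) = \prod_(i <- s) Normc.normc (f i).
Proof.
elim: s => [|i s IH]; first by rewrite !big_nil Normc.normc1.
by rewrite !big_cons Normc.normcM IH.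
Qed.

Lemma normcX (z : R[i]) n : Normc.normc (z ^+ n) = Normc.normc z ^+ n.
Proof.
elim: n => [|n IH]; first by rewrite !expr0 Normc.normc1.
by rewrite !exprS Normc.normcM IH.
Qed.

Lemma normc_monomial n (alpha : 'cV[nat]_n) (z : 'cV[R[i]]_n) :
  Normc.normc (monomial alpha z) = \prod_i Normc.normc (z i 0) ^+ alpha i 0.
Proof. by rewrite normc_prod; apply: eq_bigr => i _; rewrite normcX. Qed.

Lemma cdirectionK n (z : 'cV[R[i]]_n) : (cnorm z)%:C%C *: cdirection z = z.
Proof.
rewrite /cdirection scalerA -rmorphM/=.
have [z0|z0] := eqVneq (cnorm z) 0; last by rewrite mulfV// rmorph1 scale1r.
rewrite z0 mul0r scale0r; apply/esym/colP => i; rewrite mxE.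
apply/Normc.eq0_normc/eqP; rewrite -sqrf_eq0.
have /eqP := cnorm_sqr z; rewrite z0 expr0n/= eq_sym psumr_eq0; last first.
  by move=> l _; exact: sqr_ge0.
by move=> /allP/(_ i); rewrite mem_index_enum => /(_ isT).
Qed.

Lemma monomial_direction n (alpha : 'cV[nat]_n) (z : 'cV[R[i]]_n) :
  monomial alpha z =
  ((cnorm z) ^+ mi_size alpha)%:C%C * monomial alpha (cdirection z).
Proof. by rewrite -{1}(cdirectionK z) monomialZ rmorphXn. Qed.

Local Open Scope ereal_scope.

Definition sphere_moment n (alpha : 'cV[nat]_n) : \bar R :=
  \int[sphere_complex R n]_(xi in csphere R n)
    (Normc.normc (monomial alpha xi) ^+ 2)%:E.

Lemma measurable_normc_monomial n (alpha : 'cV[nat]_n) :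
  measurable_fun setT (fun z : 'cV[R[i]]_n => Normc.normc (monomial alpha z) ^+ 2)%R.
Proof.
by apply: measurable_funX; apply: measurable_normc; exact: measurable_monomial.
Qed.

(** By homogeneity [|z^alpha|^2] is [r ^+ (2 * |alpha|)] times its value at the direction, so the
    polar integral factors; the Jacobian supplies the remaining [2 * n - 1] in the exponent. *)
Lemma integral_radial_monomial n (alpha : 'cV[nat]_n) (h : R -> R) :
  (0 < n)%N -> measurable_fun setT h -> (forall r, 0 <= h r)%R ->
  \int[lebesgue_complex R n]_z
    (h (cnorm z) * Normc.normc (monomial alpha z) ^+ 2)%:E =
  \int[leb]_(r in `]0%R, +oo[) (h r * r ^+ (2 * n + 2 * mi_size alpha - 1))%:E *
  sphere_moment alpha.
Proof.
move=> n0 mh h0.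
pose H (x : R * 'cV[R[i]]_n) : \bar R :=
  (h x.1 * (x.1 ^+ (2 * mi_size alpha) * Normc.normc (monomial alpha x.2) ^+ 2))%:E.
have Heven r k : (0 <= r ^+ (2 * k) :> R)%R by rewrite exprM exprn_ge0// sqr_ge0.
transitivity (\int[lebesgue_complex R n]_z H (cnorm z, cdirection z)).
  apply: eq_integral => z _; rewrite /H/= {1}(monomial_direction alpha z).
  by rewrite normc_realM exprMn real_normK ?num_real// exprM exprAC.
have mhr k : measurable_fun setT (fun r : R => h r * r ^+ k)%R.
  by apply: measurable_funM => //; exact: measurable_funX.
rewrite polar_complex_direction//; last 2 first.
- rewrite /H; apply/measurable_EFinP.
  under eq_fun do rewrite mulrA.
  apply: measurable_funM; first exact: (@measurable_fun_comp _ _ _ _ _ _ _ fst (mhr _)).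
  exact: (@measurable_fun_comp _ _ _ _ _ _ _ snd (measurable_normc_monomial alpha)).
- by move=> x; rewrite lee_fin mulr_ge0// mulr_ge0 ?sqr_ge0.
rewrite -ge0_integralZr//; last 3 first.
- by apply/measurable_EFinP; apply: measurable_funTS; exact: mhr.
- move=> r; rewrite /= in_itv/= andbT => r0.
  by rewrite lee_fin mulr_ge0// exprn_ge0// ltW.
- by apply: integral_ge0 => xi _; rewrite lee_fin sqr_ge0.
apply: eq_integral => r; rewrite inE/= in_itv/= andbT => r0.
rewrite /sphere_moment -ge0_integralZl//.
- rewrite -ge0_integralZr//.
  + apply: eq_integral => xi _; rewrite /H/= -!EFinM; congr EFin.
    rewrite (_ : 2 * n + 2 * mi_size alpha - 1 = 2 * mi_size alpha + (2 * n - 1))%N.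
      by rewrite exprD; ring.
    by rewrite addnC addnBA// muln_gt0.
  + exact: measurable_csphere.
  + rewrite /H/=; apply/measurable_EFinP/measurable_funTS.
    by do 2 apply: measurable_funM => //; exact: measurable_normc_monomial.
  + by move=> xi _; rewrite lee_fin mulr_ge0// mulr_ge0 ?sqr_ge0.
  + by rewrite lee_fin exprn_ge0// ltW.
- exact: measurable_csphere.
- by apply/measurable_EFinP/measurable_funTS; exact: measurable_normc_monomial.
- by move=> xi _; rewrite lee_fin sqr_ge0.
- by rewrite lee_fin mulr_ge0// exprn_ge0// ltW.
Qed.

End sphere_moment.

Section sphere_moment_value.
Variable R : realType.
Local Notation leb := (@lebesgue_measure R).
Local Open Scope ereal_scope.

Let gauss (r : R) : R := expR (- r ^+ 2)%R.

Let gauss_ge0 r : (0 <= gauss r)%R.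
Proof. exact: expR_ge0. Qed.

Let measurable_gauss : measurable_fun setT gauss.
Proof. exact: measurable_gauss_fun. Qed.

Lemma cnorm1 (z : 'cV[R[i]]_1) : cnorm z = Normc.normc (z 0%R 0%R).
Proof. by rewrite /cnorm big_ord1 sqrtr_sqr ger0_norm// normc_ge0. Qed.

Lemma integral_gauss_complex :
  \int[lebesgue_complex R 1]_z (gauss (cnorm z))%:E = (pi : R)%:E.
Proof.
rewrite lebesgue_complex_Re_Im; last 2 first.
- apply/measurable_EFinP.
  exact: (measurable_fun_comp measurable_gauss (@measurable_cnorm R 1)).
- by move=> z; rewrite lee_fin.
have I1 : \int[lebesgue_cV R 1]_x (gauss (x 0%R 0%R))%:E = (Num.sqrt (pi : R))%:E.
  transitivity (\int[lebesgue_cV R 1]_x \prod_(l < 1) (gauss (x l 0%R))%:E).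
    by apply: eq_integral => x _; rewrite big_ord1.
  rewrite (lebesgue_cV_prod (h := fun _ r => (gauss r)%:E))//.
    by rewrite big_ord1 integralT_gauss.
  by move=> _; exact/measurable_EFinP.
transitivity (\int[lebesgue_cV R 1]_x \int[lebesgue_cV R 1]_y
    ((gauss (x 0%R 0%R))%:E * (gauss (y 0%R 0%R))%:E)).
  apply: eq_integral => x _; apply: eq_integral => y _.
  have -> : cnorm (cV_complex (col_mx x y)) =
      Normc.normc (x 0%R 0%R +i* y 0%R 0%R)%C.
    by rewrite cnorm1 mxE col_mxKu col_mxKd.
  by rewrite /gauss normcE/= -EFinM -expRD opprD.
have mg : measurable_fun setT (fun x : 'cV[R]_1 => (gauss (x 0%R 0%R))%:E).
  apply/measurable_EFinP.
  exact: (measurable_fun_comp measurable_gauss (measurable_coord 0%R 0%R)).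
rewrite ge0_integral_mul//; last 2 first.
- by move=> x; rewrite lee_fin.
- by move=> x; rewrite lee_fin.
by rewrite I1 -EFinM -expr2 sqr_sqrtr// pi_ge0.
Qed.

Lemma integral_gauss_monomial n (alpha : 'cV[nat]_n) : (0 < n)%N ->
  \int[lebesgue_complex R n]_z
    (gauss (cnorm z) * Normc.normc (monomial alpha z) ^+ 2)%:E =
  ((n + mi_size alpha - 1)`!%:R / 2)%:E * sphere_moment R alpha.
Proof.
move=> n0; rewrite integral_radial_monomial//; congr (_ * _).
rewrite -integral_radial_gauss; apply: eq_integral => r _.
rewrite mulrC; congr (_ ^+ _ * _)%:E.
rewrite -mulnDr; case: (n + _)%N (ltn_addr (mi_size alpha) n0) => // s _.
by rewrite mulnS add2n !subn1.
Qed.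

(** On the unit circle [|xi ^+ b| = 1] for every [b], so all exponents share one unknown factor, the
    length of the circle. The case [b = 0], a Gaussian integral equal to [pi], shows that it is
    [2 * pi]. *)
Lemma integral_gauss_complexX (a : nat) :
  \int[lebesgue_complex R 1]_z
    (gauss (Normc.normc (z 0%R 0%R)) * Normc.normc (z 0%R 0%R) ^+ (2 * a))%:E =
  (a`!%:R * pi)%:E.
Proof.
have E b (alpha := (\col_(_ < 1) b)%R : 'cV[nat]_1) :
    \int[lebesgue_complex R 1]_z
      (gauss (Normc.normc (z 0%R 0%R)) * Normc.normc (z 0%R 0%R) ^+ (2 * b))%:E =
    (b`!%:R / 2)%:E * sphere_complex R 1 (csphere R 1).
  transitivity (\int[lebesgue_complex R 1]_z
      (gauss (cnorm z) * Normc.normc (monomial alpha z) ^+ 2)%:E).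
    apply: eq_integral => z _; rewrite cnorm1 normc_monomial big_ord1 mxE.
    by rewrite mulnC exprM.
  rewrite integral_gauss_monomial//; congr ((_ `!%:R / _)%:E * _).
    by rewrite /mi_size big_ord1 mxE addnC addnK.
  rewrite -[RHS]mul1e -integral_cst; last exact: measurable_csphere.
  apply: eq_integral => xi; rewrite inE /csphere/= cnorm1 => xi1.
  by rewrite normc_monomial big_ord1 xi1 !expr1n.
have := E 0%N; under eq_integral do rewrite muln0 expr0 mulr1 -cnorm1.
rewrite integral_gauss_complex E mul1r => Epi.
have -> : (a`!%:R * pi = a`!%:R / 2 * (2 * pi) :> R)%R by field.
rewrite [RHS]EFinM; congr (_ * _).
by rewrite EFinM Epi muleA -EFinM mulfV// mul1e.
Qed.

Lemma sphere_momentE n (alpha : 'cV[nat]_n) : (0 < n)%N ->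
  sphere_moment R alpha =
  (2 * pi ^+ n * (mi_fact alpha)%:R / (n + mi_size alpha - 1)`!%:R)%:E.
Proof.
move=> n0; have f0 : (n + mi_size alpha - 1)`!%:R != 0%R :> R.
  by rewrite pnatr_eq0 -lt0n fact_gt0.
have := integral_gauss_monomial alpha n0.
rewrite (_ : \int[_]_z _ = (pi ^+ n * (mi_fact alpha)%:R)%:E); last first.
  transitivity (\int[lebesgue_complex R n]_z \prod_l
     (gauss (Normc.normc (z l 0%R)) * Normc.normc (z l 0%R) ^+ (2 * alpha l 0%R))%:E).
    apply: eq_integral => z _; rewrite prodEFin normc_monomial.
    rewrite big_split/= -expR_sum -prodrXl; congr (expR _ * _)%:E.
      by rewrite cnorm_sqr sumrN.
    by apply: eq_bigr => l _; rewrite mulnC exprM.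
  rewrite (lebesgue_complex_prod (h := fun l z =>
     (gauss (Normc.normc z) * Normc.normc z ^+ (2 * alpha l 0%R))%:E)).
  - under eq_bigr do rewrite integral_gauss_complexX.
    rewrite prodEFin big_split/= prodr_const card_ord mulrC /mi_fact.
    by rewrite natr_prod.
  - move=> l; apply/measurable_EFinP.
    have mn : measurable_fun setT (@Normc.normc R).
      by apply: measurable_normc; exact: measurable_id.
    apply: measurable_funM; first exact: (measurable_fun_comp measurable_gauss mn).
    exact: measurable_funX.
  - by move=> l z; rewrite lee_fin mulr_ge0// exprn_ge0// normc_ge0.
(* The moment is an extended real not yet known to be finite, so the positive factor in [E] is not
   cancelled: its inverse is multiplied in, by associativity. *)
move=> E; rewrite -[LHS]mul1e.
rewrite [X in X * _](_ : 1 = (2 / (n + mi_size alpha - 1)`!%:R)%:E *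
   ((n + mi_size alpha - 1)`!%:R / 2)%:E); last by rewrite -EFinM; congr EFin; field.
by rewrite -muleA -E -EFinM; congr EFin; field.
Qed.

End sphere_moment_value.

(** * Blockwise polar coordinates *)

Section box_unique.
Variables (R : realType) (m : nat) (d : measure_display) (T : measurableType d).

Definition box (A : 'I_m -> set R) (S : set T) : set ('cV[R]_m * T) :=
  [set x : 'cV[R]_m * T | (forall l, A l (x.1 l 0)) /\ S x.2].

Let boxes : set (set ('cV[R]_m * T)) :=
  [set X | exists A S, [/\ forall l, measurable (A l), measurable S & X = box A S]].

Lemma measurable_box A S :
  (forall l, measurable (A l)) -> measurable S -> measurable (box A S).
Proof.
move=> mA mS; rewrite (_ : box A S = (\big[setI/setT]_l
    (fun x : 'cV[R]_m * T => x.1 l 0) @^-1` A l) `&` snd @^-1` S); last first.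
  apply/seteqP; split => x; rewrite /box /= -bigcap_seq.
    by move=> [Ax Sx]; split => // l _; exact: Ax.
  by move=> [Ax Sx]; split => // l; apply: Ax; exact: mem_index_enum.
have mpre d' (T' : measurableType d') (f : 'cV[R]_m * T -> T') B :
    measurable_fun setT f -> measurable B -> measurable (f @^-1` B).
  by move=> mf mB; rewrite -[X in measurable X]setTI; exact: mf.
apply: measurableI; last exact: mpre.
apply: bigsetI_measurable => l _; apply: mpre => //.
exact: (@measurable_fun_comp _ _ _ _ _ _ _ fst (measurable_coord l 0)).
Qed.

Let setI_closed_boxes : setI_closed boxes.
Proof.
move=> _ _ [A [S [mA mS ->]]] [B [U [mB mU ->]]].
exists (fun l => A l `&` B l), (S `&` U); split.
- by move=> l; exact: measurableI.
- exact: measurableI.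
apply/seteqP; split => x; rewrite /box/=.
  by move=> [[Ax Sx] [Bx Ux]]; split => // l; split.
by move=> [ABx [Sx Ux]]; split; split => // l; have [] := ABx l.
Qed.

Let measurable_boxes :
  @measurable _ ('cV[R]_m * T)%type = <<s boxes >>.
Proof.
apply/seteqP; split; last first.
  apply: smallest_sub; first exact: sigma_algebra_measurable.
  by move=> _ [A [S [mA mS ->]]]; exact: measurable_box.
(* The identity from the space with the sigma-algebra generated by boxes to the product space is
   measurable, because its coordinates are. *)
pose Z := g_sigma_algebraType boxes.
have m1 : measurable_fun setT (fun x : Z => x.1 : 'cV[R]_m).
  apply: measurable_fun_matrixP => i j _ Y mY; rewrite setTI.
  apply: sub_sigma_algebra; exists (fun l => if l == i then Y else setT), setT.
  split => //; first by move=> l; case: ifP.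
  rewrite ord1; apply/seteqP; split => x /=.
    by move=> Yx; split => // l; case: eqP => // ->.
  by move=> [/(_ i)]; rewrite eqxx.
have m2 : measurable_fun setT (fun x : Z => x.2 : T).
  move=> _ Y mY; rewrite setTI.
  apply: sub_sigma_algebra; exists (fun=> setT), Y; split => //.
  by apply/seteqP; split => x //= [].
have := measurable_fun_pair m1 m2 => mid X mX.
have := mid measurableT X mX; rewrite setTI.
by rewrite (_ : _ @^-1` X = X)//; apply/seteqP; split=> -[].
Qed.

(** Boxes are stable under intersection and generate the product sigma-algebra, and those with sides
    [[-n, n]] exhaust the space. Boxes constrain each radius separately because both measures to be
    compared factor on them. *)
Lemma box_measure_unique (m1 m2 : {measure set ('cV[R]_m * T) -> \bar R}) :
  (forall A S, (forall l, measurable (A l)) -> measurable S ->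
    m1 (box A S) = m2 (box A S)) ->
  (forall n : nat, m1 (box (fun=> `[(- n%:R)%R, n%:R]%classic) setT) < +oo)%E ->
  forall X, measurable X -> m1 X = m2 X.
Proof.
move=> m12 m1oo; apply: (measure_unique boxes
  (fun n : nat => box (fun=> `[(- n%:R)%R, n%:R]%classic) setT)) => //.
- by move=> n; exists (fun=> `[(- n%:R)%R, n%:R]%classic), setT.
- apply/seteqP; split => // x _.
  pose n := (\max_l (Num.truncn `|x.1 l 0|%R).+1)%N.
  exists n => //; split => //= l; rewrite in_itv/= -ler_norml.
  apply: (@le_trans _ _ (Num.truncn `|x.1 l 0|).+1%:R); first exact/ltW/truncnS_gt.
  by rewrite ler_nat; exact: (leq_bigmax l).
- by move=> _ [A [S [mA mS ->]]]; exact: m12.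
Qed.

End box_unique.

(** * Lebesgue measure in the block norms and the direction of block [j] *)

Section quasi_polar.
Variables (R : realType) (m : nat) (k : 'I_m -> nat) (j : 'I_m).
Hypothesis k_gt0 : forall l, (0 < k l)%N.
Variable alpha : forall l, 'cV[nat]_(k l).
Local Notation leb := (@lebesgue_measure R).
Local Open Scope ereal_scope.

Definition quasi_polar_map (z : 'cV[R[i]]_(\sum_(l < m) k l)) :
    'cV[R]_m * 'cV[R[i]]_(k j) :=
  (block_norms z, block_direction j z).

(** What [z^alpha] times the conjugate of [z^beta] contributes on the blocks other than [j], where
    the multi-indices agree. It depends on the directions of those blocks, which the map forgets, so
    it has to be part of the measure. *)
Definition monomial_weight (z : 'cV[R[i]]_(\sum_(l < m) k l)) : R :=
  (\prod_(l < m | l != j) Normc.normc (monomial (alpha l) (submxcol z l)) ^+ 2)%R.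

(** For [l != j] the constant is the sphere moment of the block, left by integrating its direction
    out, and the power joins the polar Jacobian to the homogeneity of the monomial. Block [j] keeps
    its direction, hence the Jacobian alone. *)
Definition radial_weight (l : 'I_m) (r : R) : R :=
  (\1_(`]0%R, +oo[) r *
   (if l == j then r ^+ (2 * k l - 1) else
    2 * pi ^+ k l * (mi_fact (alpha l))%:R / (k l + mi_size (alpha l) - 1)`!%:R *
    r ^+ (2 * k l + 2 * mi_size (alpha l) - 1)))%R.

Definition quasi_polar_density (x : 'cV[R]_m * 'cV[R[i]]_(k j)) : R :=
  (\prod_l radial_weight l (x.1 l 0) * \1_(csphere R (k j)) x.2)%R.

Lemma radial_weight_ge0 l r : (0 <= radial_weight l r)%R.
Proof.
rewrite /radial_weight indicE; case: (boolP (r \in _)) => [|_]; last by rewrite mul0r.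
rewrite inE/= in_itv/= andbT mul1r => r0; case: ifP => _; first by rewrite exprn_ge0// ltW.
by rewrite mulr_ge0 ?divr_ge0 ?mulr_ge0 ?exprn_ge0 ?pi_ge0 ?ler0n// ltW.
Qed.

Lemma measurable_radial_weight l : measurable_fun setT (radial_weight l).
Proof.
apply: measurable_funM; first exact: measurable_indic.
by case: (l == j); [exact: measurable_funX|apply: measurable_funM => //; exact: measurable_funX].
Qed.

Lemma quasi_polar_density_ge0 x : (0 <= quasi_polar_density x)%R.
Proof.
by rewrite mulr_ge0// prodr_ge0// => l _; exact: radial_weight_ge0.
Qed.

Lemma measurable_quasi_polar_density : measurable_fun setT quasi_polar_density.
Proof.
apply: measurable_funM.
  apply: measurable_prod => l _.
  apply: (@measurable_fun_comp _ _ _ _ _ _ (radial_weight l) _ (measurable_radial_weight l)).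
  exact: (@measurable_fun_comp _ _ _ _ _ _ _ fst (measurable_coord l 0%R)).
apply: (@measurable_fun_comp _ _ _ _ _ _ (\1_(csphere R (k j)) : _ -> R) snd) => //.
by apply: measurable_indic; exact: measurable_csphere.
Qed.

Lemma monomial_weight_ge0 z : (0 <= monomial_weight z)%R.
Proof. by apply: prodr_ge0 => l _; exact: sqr_ge0. Qed.

Lemma measurable_monomial_weight : measurable_fun setT monomial_weight.
Proof.
rewrite (_ : monomial_weight = fun z => \prod_l (if l != j then
    Normc.normc (monomial (alpha l) (submxcol z l)) ^+ 2 else 1))%R; last first.
  by apply/funext => z; rewrite /monomial_weight big_mkcond.
apply: measurable_prod => l _; case: (l != j) => //.
exact: (measurable_fun_comp (@measurable_normc_monomial R _ (alpha l))
  (@measurable_submxcol _ _ m k l)).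
Qed.

Lemma measurable_quasi_polar_map : measurable_fun setT quasi_polar_map.
Proof.
apply: measurable_fun_pair.
  apply: measurable_fun_matrixP => i i'.
  rewrite (_ : (fun _ => _) = fun z : 'cV[R[i]]_(\sum_(l < m) k l) => cnorm (submxcol z i)).
    exact: (measurable_fun_comp (@measurable_cnorm R _) (@measurable_submxcol _ _ m k i)).
  by apply/funext => z; rewrite mxE.
exact: (measurable_fun_comp (@measurable_cdirection R _) (@measurable_submxcol _ _ m k j)).
Qed.

(** [S] is a variable subject to an equation because the lemma is applied to a family of sets over
    all blocks whose members at [l != j] are only provably the full set. *)
Lemma integral_quasi_polar_block (l : 'I_m) (A : set R) (S : set 'cV[R[i]]_(k l)) :
  measurable A -> measurable S -> l != j -> S = setT ->
  \int[lebesgue_complex R (k l)]_z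
     (\1_A (cnorm z) * \1_S (cdirection z) *
      Normc.normc (monomial (alpha l) z) ^+ 2)%:E =
  \int[leb]_r (\1_A r * radial_weight l r)%:E.
Proof.
move=> mA mS lj ->.
under eq_integral do rewrite indicT mulr1.
rewrite (integral_radial_monomial (alpha l) (k_gt0 l) (h := \1_A))//.
rewrite sphere_momentE// -ge0_integralZr//; last 3 first.
- apply/measurable_EFinP; apply: measurable_funTS; apply: measurable_funM.
    exact: measurable_indic.
  exact: measurable_funX.
- move=> r; rewrite /= in_itv/= andbT => r0.
  by rewrite lee_fin mulr_ge0// exprn_ge0// ltW.
- by rewrite lee_fin divr_ge0 ?mulr_ge0 ?exprn_ge0 ?pi_ge0.
rewrite [LHS]integral_mkcond epatch_indic; apply: eq_integral => r _.
by rewrite /radial_weight (negPf lj) -!EFinM; congr EFin; ring.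
Qed.

Lemma integral_quasi_polar_block_j (A : set R) (S : set 'cV[R[i]]_(k j)) :
  measurable A -> measurable S ->
  \int[lebesgue_complex R (k j)]_z (\1_A (cnorm z) * \1_S (cdirection z))%:E =
  \int[leb]_r (\1_A r * radial_weight j r)%:E *
  sphere_complex R (k j) (S `&` csphere R (k j)).
Proof.
move=> mA mS.
pose H (x : R * 'cV[R[i]]_(k j)) : \bar R := (\1_A x.1 * \1_S x.2)%:E.
rewrite (@polar_complex_direction _ _ H)//; last 2 first.
- apply/measurable_EFinP; apply: measurable_funM.
  + by apply: (@measurable_fun_comp _ _ _ _ _ _ (\1_A : R -> R) fst).
  + by apply: (@measurable_fun_comp _ _ _ _ _ _ (\1_S : _ -> R) snd) => //.
- by move=> x; rewrite lee_fin mulr_ge0.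
rewrite -ge0_integralZr//; last 2 first.
- by apply/measurable_EFinP; apply: measurable_funM => //; exact: measurable_radial_weight.
- by move=> r _; rewrite lee_fin mulr_ge0// radial_weight_ge0.
rewrite [LHS]integral_mkcond epatch_indic; apply: eq_integral => r _.
rewrite (_ : \int[_]_(_ in _) _ =
    (\1_A r)%:E * sphere_complex R (k j) (S `&` csphere R (k j))).
  rewrite /radial_weight eqxx -!muleA; rewrite [_%:E in RHS]EFinM -muleA; congr (_ * _).
  by rewrite muleC -EFinM mulrC.
rewrite /H/=; under eq_integral do rewrite EFinM.
rewrite ge0_integralZl//.
- by rewrite integral_indic//; exact: measurable_csphere.
- exact: measurable_csphere.
- by apply/measurable_EFinP; exact: measurable_funTS.
Qed.

(** The two measures to be identified: [bm] is the image of weighted Lebesgue measure, [pm] the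
    product measure with density, written as an image under the identity. *)
Let bm : {measure set _ -> \bar R} :=
  image_density (lebesgue_complex R (\sum_(l < m) k l))
    measurable_quasi_polar_map measurable_monomial_weight monomial_weight_ge0.

Let pm : {measure set _ -> \bar R} :=
  image_density (lebesgue_cV R m \x sphere_complex R (k j))
    (@measurable_id _ _ setT) measurable_quasi_polar_density quasi_polar_density_ge0.

Lemma density_box (A : 'I_m -> set R) (S : set 'cV[R[i]]_(k j)) :
  (forall l, measurable (A l)) -> measurable S ->
  pm (box A S) = \prod_l \int[leb]_r (\1_(A l) r * radial_weight l r)%:E *
    sphere_complex R (k j) (S `&` csphere R (k j)).
Proof.
move=> mA mS; pose h l r : \bar R := (\1_(A l) r * radial_weight l r)%:E.
have mh l : measurable_fun setT (h l).
  by apply/measurable_EFinP; apply: measurable_funM => //; exact: measurable_radial_weight.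
have h0 l r : 0 <= h l r by rewrite lee_fin mulr_ge0// radial_weight_ge0.
have mSS : measurable (S `&` csphere R (k j)).
  by apply: measurableI => //; exact: measurable_csphere.
have mp : measurable_fun setT (fun r : 'cV[R]_m => \prod_l h l (r l 0%R)).
  apply: emeasurable_prod => l.
  exact: (measurable_fun_comp (mh l) (measurable_coord l 0%R)).
have m1 : measurable_fun setT (fun xi : 'cV[R[i]]_(k j) =>
    (\1_(S `&` csphere R (k j)) xi)%:E : \bar R).
  by apply/measurable_EFinP; exact: measurable_indic.
have p0 (r : 'cV[R]_m) : 0 <= \prod_l h l (r l 0%R) by exact: prode_ge0.
have -> : sphere_complex R (k j) (S `&` csphere R (k j)) =
    \int[sphere_complex R (k j)]_xi (\1_(S `&` csphere R (k j)) xi)%:E.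
  by rewrite integral_indic// setIT.
rewrite -lebesgue_cV_prod// -ge0_integral_mul//.
pose F (x : 'cV[R]_m * 'cV[R[i]]_(k j)) :=
  \prod_l h l (x.1 l 0%R) * (\1_(S `&` csphere R (k j)) x.2)%:E.
have mF : measurable_fun setT F.
  apply: emeasurable_funM.
  - exact: (@measurable_fun_comp _ _ _ _ _ _ _ fst mp).
  - exact: (@measurable_fun_comp _ _ _ _ _ _ _ snd m1).
transitivity (\int[lebesgue_cV R m \x sphere_complex R (k j)]_x F x); last first.
  by rewrite fubini_tonelli1// => x; rewrite mule_ge0// lee_fin.
rewrite /pm /= /image_density preimage_id integral_mkcond epatch_indic.
apply: eq_integral => -[r xi] _; rewrite /F /quasi_polar_density/=.
have -> : \prod_l h l (r l 0%R) =
    (\prod_l \1_(A l) (r l 0) * \prod_l radial_weight l (r l 0))%:E.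
  by rewrite prodEFin big_split.
rewrite -!EFinM; congr EFin.
have -> : (\1_(box A S) (r, xi) = \prod_l \1_(A l) (r l 0) * \1_S xi :> R)%R.
  rewrite !indicE; case: (pselect (box A S (r, xi))) => [[/= Ar Sx]|nb].
    rewrite !mem_set// mulr1 big1// => l _; rewrite indicE mem_set//.
  rewrite memNset//; case: (pselect (S xi)) => Sx; last by rewrite [xi \in S]memNset// mulr0.
  apply/esym/eqP; rewrite mulf_eq0; apply/orP; left; apply/prodf_eq0.
  apply: contrapT => nA; apply: nb; split => //= l; apply: contrapT => nAl; apply: nA.
  by exists l => //; rewrite indicE memNset.
by rewrite indicI/=; ring.
Qed.

Lemma blocks_box (A : 'I_m -> set R) (S : set 'cV[R[i]]_(k j)) :
  (forall l, measurable (A l)) -> measurable S ->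
  bm (box A S) = \prod_l \int[leb]_r (\1_(A l) r * radial_weight l r)%:E *
    sphere_complex R (k j) (S `&` csphere R (k j)).
Proof.
move=> mA mS.
(* [S] transported to the block [j], and no condition on the other blocks. *)
pose S' l : set 'cV[R[i]]_(k l) :=
  [set w | forall e : l = j, S (ecast l' 'cV[R[i]]_(k l') e w)].
have S'j : S' j = S.
  apply/seteqP; split => w /=; first by move=> /(_ erefl).
  by move=> Sw e; rewrite eq_axiomK.
have S'N l : l != j -> S' l = setT.
  by move=> /eqP lj; apply/seteqP; split => w // _ e.
have mS' l : measurable (S' l).
  by have [->|/S'N ->//] := eqVneq l j; rewrite S'j.
pose g l (z : 'cV[R[i]]_(k l)) : \bar R :=
  (\1_(A l) (cnorm z) * \1_(S' l) (cdirection z) *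
   (if l == j then 1 else Normc.normc (monomial (alpha l) z) ^+ 2))%:E.
have mg l : measurable_fun setT (g l).
  apply/measurable_EFinP; apply: measurable_funM.
    apply: measurable_funM.
      exact: (measurable_fun_comp (measurable_indic (mA l)) (@measurable_cnorm R _)).
    exact: (measurable_fun_comp (measurable_indic (mS' l)) (@measurable_cdirection R _)).
  by case: (l == j) => //; exact: measurable_normc_monomial.
have g0 l z : 0 <= g l z.
  by rewrite lee_fin mulr_ge0 ?mulr_ge0//; case: ifP => // _; rewrite sqr_ge0.
transitivity (\int[lebesgue_complex R (\sum_(l < m) k l)]_z
    \prod_l g l (submxcol z l)).
  rewrite /bm /= /image_density integral_mkcond epatch_indic.
  apply: eq_integral => z _; rewrite prodEFin -EFinM; congr EFin.
  rewrite big_split/= big_split/= /monomial_weight [in LHS]big_mkcond/= mulrC.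
  congr (_ * _)%R; last by apply: eq_bigr => l _; rewrite if_neg.
  have -> : (\prod_l \1_(S' l) (cdirection (submxcol z l)) =
      \1_S (cdirection (submxcol z j)) :> R)%R.
    rewrite (bigD1 j)//= S'j [X in (_ * X)%R]big1 ?mulr1// => l lj.
    by rewrite S'N// indicT.
  rewrite !indicE; case: (pselect (box A S (quasi_polar_map z))) => [[/= Az Sz]|nb].
    rewrite mem_set// mem_set// mulr1 big1// => l _; rewrite indicE mem_set//.
    by have := Az l; rewrite mxE.
  rewrite memNset//; case: (pselect (S (cdirection (submxcol z j)))) => Sx; last first.
    by rewrite [_ \in S]memNset// mulr0.
  apply/esym/eqP; rewrite mulf_eq0; apply/orP; left; apply/prodf_eq0.
  apply: contrapT => nA; apply: nb; split => //= l; apply: contrapT => nAl; apply: nA.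
  by exists l => //; rewrite indicE memNset//; move: nAl; rewrite mxE.
rewrite lebesgue_complex_blocks// (bigD1 j)//= [in RHS](bigD1 j)//= muleAC.
congr (_ * _).
  rewrite -integral_quasi_polar_block_j//; apply: eq_integral => z _.
  by rewrite /g eqxx S'j mulr1.
apply: eq_bigr => l lj; rewrite -(@integral_quasi_polar_block l (A l) (S' l))//; last exact: S'N.
by apply: eq_integral => z _; rewrite /g (negPf lj).
Qed.

(** The total mass is the moment of the constant monomial. *)
Lemma sphere_complex_lty : sphere_complex R (k j) (csphere R (k j)) < +oo.
Proof.
have := sphere_momentE R (0%R : 'cV[nat]_(k j)) (k_gt0 j).
rewrite /sphere_moment (eq_integral (cst 1)) => [|xi _]; last first.
  by rewrite normc_monomial big1 ?expr1n// => i _; rewrite mxE expr0.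
by rewrite integral_cst ?mul1e => [->|]; [rewrite ltry|exact: measurable_csphere].
Qed.

Lemma quasi_polar_measureE X : measurable X -> bm X = pm X.
Proof.
move: X; apply: box_measure_unique => [A S mA mS|n].
  by rewrite blocks_box// density_box.
rewrite blocks_box// setTI; apply: lte_mul_pinfty; last exact: sphere_complex_lty.
  apply: prode_ge0 => l _; apply: integral_ge0 => r _.
  by rewrite lee_fin mulr_ge0// radial_weight_ge0.
apply: prode_fin_num => l _; rewrite ge0_fin_numE; last first.
  by apply: integral_ge0 => r _; rewrite lee_fin mulr_ge0// radial_weight_ge0.
set I := `[_, _]%classic; have mI : measurable I by exact: measurable_itv.
(* The weight is 0 on nonpositive numbers and nondecreasing on positive ones, so its value at [n]
   bounds it on [I]. *)
pose M := radial_weight l n%:R.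
have M0 : (0 <= M)%R by exact: radial_weight_ge0.
apply: (@le_lt_trans _ _ (\int[leb]_(r in I) M%:E)); last first.
  rewrite (@integral_cst _ _ _ leb I mI M%:E) /I.
  rewrite /= lebesgue_measure_itv/=.
  by case: ifP => _; rewrite ?mule0 -?EFinB -?EFinM ltry.
rewrite [leRHS]integral_mkcond epatch_indic; apply: ge0_le_integral => //.
- by move=> r _; rewrite lee_fin mulr_ge0// radial_weight_ge0.
- apply/measurable_EFinP; apply: measurable_funM; first exact: measurable_indic.
  exact: measurable_radial_weight.
- apply/measurable_EFinP; apply: measurable_funM; first exact: measurable_cst.
  exact: measurable_indic.
move=> r _; rewrite -EFinM lee_fin mulrC !indicE.
have [rI|] := boolP (r \in I); last by rewrite !mulr0.
rewrite !mulr1 /M /radial_weight !indicE.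
have [r0|_] := boolP (r \in `]0%R, +oo[%classic); last first.
  by rewrite mul0r; exact: radial_weight_ge0.
move: rI r0; rewrite !inE/= !in_itv/= !andbT => /andP[_ rn] r0.
rewrite mem_set/=; last by rewrite in_itv/= andbT (lt_le_trans r0).
have e p : (r ^+ p <= n%:R ^+ p)%R by rewrite lerXn2r// nnegrE ltW// (lt_le_trans r0).
case: ifP => _; rewrite !mul1r// ler_wpM2l//.
by rewrite divr_ge0 ?mulr_ge0 ?exprn_ge0 ?pi_ge0.
Qed.

Lemma ge0_integral_quasi_polar (G : 'cV[R]_m * 'cV[R[i]]_(k j) -> \bar R) :
  measurable_fun setT G -> (forall x, 0 <= G x) ->
  \int[lebesgue_complex R (\sum_(l < m) k l)]_z
    (G (quasi_polar_map z) * (monomial_weight z)%:E) =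
  \int[lebesgue_cV R m \x sphere_complex R (k j)]_x
    (G x * (quasi_polar_density x)%:E).
Proof.
move=> mG G0.
rewrite -(@ge0_integral_density _ _ _ _ _ (lebesgue_cV R m \x sphere_complex R (k j))
  pm id quasi_polar_density)//; last 2 first.
- exact: measurable_quasi_polar_density.
- exact: quasi_polar_density_ge0.
rewrite -(@ge0_integral_density _ _ _ _ _ (lebesgue_complex R (\sum_(l < m) k l))
  pm quasi_polar_map monomial_weight)//.
- exact: measurable_quasi_polar_map.
- exact: measurable_monomial_weight.
- exact: monomial_weight_ge0.
- by move=> A mA; rewrite -quasi_polar_measureE.
Qed.

(** The integral is by definition the difference of those of the positive and negative parts. Both
    densities are nonnegative and pass through the parts, so the nonnegative case transfers term by
    term, whether or not the terms are finite. *)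
Lemma integral_quasi_polar (u : 'cV[R]_m * 'cV[R[i]]_(k j) -> R) :
  measurable_fun setT u ->
  \int[lebesgue_complex R (\sum_(l < m) k l)]_z
    (u (quasi_polar_map z) * monomial_weight z)%:E =
  \int[lebesgue_cV R m \x sphere_complex R (k j)]_x
    (u x * quasi_polar_density x)%:E.
Proof.
move=> mu; have mU : measurable_fun setT (EFin \o u) by exact/measurable_EFinP.
have pos (s t : R) : (0 <= t)%R ->
    Order.max (s * t)%:E 0 = Order.max s%:E 0 * t%:E.
  by move=> t0; rewrite -!EFin_max -EFinM maxr_pMl// mul0r.
have neg (s t : R) : (0 <= t)%R ->
    Order.max (- (s * t)%:E) 0 = Order.max (- s%:E) 0 * t%:E.
  by move=> t0; rewrite -!EFinN -mulNr pos.
rewrite integralE [RHS]integralE; congr (_ - _).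
- transitivity (\int[lebesgue_complex R (\sum_(l < m) k l)]_z
    ((EFin \o u)^\+ (quasi_polar_map z) * (monomial_weight z)%:E)).
    by apply: eq_integral => z _; rewrite !funeposE/= pos ?monomial_weight_ge0.
  rewrite ge0_integral_quasi_polar//; last exact: measurable_funepos.
  by apply: eq_integral => x _; rewrite !funeposE/= pos ?quasi_polar_density_ge0.
- transitivity (\int[lebesgue_complex R (\sum_(l < m) k l)]_z
    ((EFin \o u)^\- (quasi_polar_map z) * (monomial_weight z)%:E)).
    by apply: eq_integral => z _; rewrite !funenegE/= neg ?monomial_weight_ge0.
  rewrite ge0_integral_quasi_polar//; last exact: measurable_funeneg.
  by apply: eq_integral => x _; rewrite !funenegE/= neg ?quasi_polar_density_ge0.
Qed.

End quasi_polar.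

(** * Bergman spaces and Toeplitz operators *)

Section holomorphic_monomial.
Variable R : realType.

Lemma differentiable_monomial n (alpha : 'cV[nat]_n) (z : 'cV[R[i]]_n) :
  differentiable (monomial alpha) z.
Proof.
have dX i p : differentiable (fun z : 'cV[R[i]]_n => z i 0 ^+ p) z.
  elim: p => [|p IH]; first exact: differentiable_cst.
  under eq_fun do rewrite exprS.
  apply: (@differentiableM R[i] 'cV[R[i]]_n (fun z : 'cV[R[i]]_n => z i 0)
    (fun z : 'cV[R[i]]_n => z i 0 ^+ p)) => //.
  exact: differentiable_coord.
rewrite /monomial; elim: (index_enum _) => [|i s IH].
  by under eq_fun do rewrite big_nil; exact: differentiable_cst.
under eq_fun do rewrite big_cons.
exact: (@differentiableM R[i] 'cV[R[i]]_n (fun z : 'cV[R[i]]_n => z i 0 ^+ alpha i 0)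
   (fun z : 'cV[R[i]]_n => \prod_(j <- s) z j 0 ^+ alpha j 0)).
Qed.

End holomorphic_monomial.

(** * Finiteness of the weight on the ball *)

Section bergman_weight_theory.
Variables (R : realType) (lam : R).
Hypothesis lam_gtN1 : -1 < lam.
Local Notation leb := (@lebesgue_measure R).

Let lam1_gt0 : 0 < lam + 1.
Proof. by rewrite -(addNr 1) ltrD2r. Qed.

Let prim (r : R) : R := - ((1 - r ^+ 2) `^ (lam + 1) / (2 * (lam + 1))).

Let is_derive_prim (r : R) : 0 <= r -> r < 1 ->
  is_derive r 1 prim ((1 - r ^+ 2) `^ lam * r).
Proof.
move=> r0 r1; have q0 : 0 < 1 - r ^+ 2 by rewrite subr_gt0 expr_lt1.
have din : is_derive r 1 (fun x : R => 1 - x ^+ 2) (- (2 * r)).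
  by apply: is_derive_eq; rewrite /GRing.scale/=; ring.
have dout : is_derive (1 - r ^+ 2) 1 (fun x : R => x `^ (lam + 1))
    ((lam + 1) * (1 - r ^+ 2) `^ (lam + 1 - 1)) := is_derive1_powR (lam + 1) q0.
have dcomp := @is_derive1_comp R (fun x : R => x `^ (lam + 1))
  (fun x : R => 1 - x ^+ 2) r _ _ dout din.
have := is_deriveN (is_deriveZ (2 * (lam + 1))^-1 dcomp).
rewrite addrK => d; rewrite (_ : prim = - ((2 * (lam + 1))^-1 *:
    ((fun x : R => x `^ (lam + 1)) \o (fun x : R => 1 - x ^+ 2)))); last first.
  by apply/funext => x; rewrite /prim mulrC.
apply: (is_derive_eq d); rewrite /GRing.scale/=; field.
by rewrite gt_eqF.
Qed.

Let measurable_h : measurable_fun setT (fun r : R => (1 - r ^+ 2) `^ lam * r).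
Proof.
apply: measurable_funM => //.
apply: (@measurable_fun_comp _ _ _ _ _ _ (fun x : R => x `^ lam)
  (fun r : R => 1 - r ^+ 2)); first exact: measurable_powR.
by apply: measurable_funB => //; exact: measurable_funX.
Qed.

Local Open Scope ereal_scope.

(** The primitive [prim] is nonpositive at [b] and equals minus the bound at 0; the bound is uniform
    in [b], and [lam + 1 > 0] gives it its sign. *)
Let integral_prim_le (b : R) : (0 < b)%R -> (b < 1)%R ->
  \int[leb]_(r in `[0%R, b]) ((1 - r ^+ 2) `^ lam * r)%:E <=
  ((2 * (lam + 1))^-1)%:E.
Proof.
move=> b0 b1.
have lt1 x : x \in `[0%R, b] -> (0 <= x)%R /\ (x < 1)%R.
  by rewrite in_itv/= => /andP[-> xb]; rewrite (le_lt_trans xb).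
have cprim x : x \in `[0%R, b] -> {for x, continuous prim}.
  move=> /lt1[x0 x1]; apply: differentiable_continuous; apply/derivable1_diffP.
  by have [] := is_derive_prim x0 x1.
rewrite (@continuous_FTC2 _ _ prim)//.
- rewrite -EFinB lee_fin /prim expr0n/= subr0 powR1 opprK mul1r.
  by rewrite gerDr oppr_le0 divr_ge0 ?powR_ge0// mulr_ge0// ltW.
- apply: continuous_in_subspaceT => x; rewrite inE/= => /lt1[x0 x1].
  have q0 : (0 < 1 - x ^+ 2)%R by rewrite subr_gt0 expr_lt1.
  apply: differentiable_continuous; apply/derivable1_diffP.
  have din : is_derive x 1%R (fun x : R => 1 - x ^+ 2)%R (- (2 * x))%R.
    by apply: is_derive_eq; rewrite /GRing.scale/=; ring.
  have dout : is_derive (1 - x ^+ 2)%R 1%R (fun x : R => x `^ lam)%R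
    (lam * (1 - x ^+ 2) `^ (lam - 1))%R := is_derive1_powR lam q0.
  have [d _] := @is_derive1_comp R (fun x : R => x `^ lam)%R
    (fun x : R => 1 - x ^+ 2)%R x _ _ dout din.
  by apply: (@derivableM _ _ _ _ _ _ d).
- split.
  + move=> x; rewrite in_itv/= => /andP[x0 xb].
    by have [] := is_derive_prim (ltW x0) (lt_trans xb b1).
  + by apply: cvg_at_right_filter; apply: cprim; rewrite in_itv/= lexx ltW.
  + by apply: cvg_at_left_filter; apply: cprim; rewrite in_itv/= lexx ltW.
- move=> x; rewrite in_itv/= => /andP[x0 xb]; rewrite derive1E.
  by have [_ ->] := is_derive_prim (ltW x0) (lt_trans xb b1).
Qed.

(** For negative [lam] the integrand blows up at 1, so the fundamental theorem of calculus is used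
    on [[0, b]] with [b < 1], and the uniform bound passes to the limit along an increasing
    exhaustion. *)
Lemma integral_bergman_radial :
  \int[leb]_(r in `[0%R, 1%R[) ((1 - r ^+ 2) `^ lam * r)%:E < +oo.
Proof.
(* The shift to [n.+2] makes [b 0] positive. *)
pose b (n : nat) : R := (1 - n.+2%:R^-1)%R.
have b0 n : (0 < b n)%R by rewrite subr_gt0 invf_lt1 ?ltr0n// ltr1n.
have b1 n : (b n < 1)%R by rewrite ltrBlDr ltrDl invr_gt0.
have U : `[0%R, 1%R[%classic = \bigcup_n `[0%R, b n]%classic.
  apply/seteqP; split => r /=.
    rewrite in_itv/= => /andP[r0 r1].
    have r1' : (0 < 1 - r)%R by rewrite subr_gt0.
    exists (Num.truncn (1 - r)^-1) => //=; rewrite in_itv/= r0/= /b.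
    rewrite lerBrDr -lerBrDl -[leRHS]invrK lef_pV2 ?posrE ?invr_gt0//.
    apply/ltW/(lt_trans (truncnS_gt _)); by rewrite ltr_nat.
  by move=> [n _] /=; rewrite !in_itv/= => /andP[-> /le_lt_trans ->].
apply: (@le_lt_trans _ _ ((2 * (lam + 1))^-1)%:E); last by rewrite ltry.
have nn (r : R) : (0 <= r)%R -> 0 <= ((1 - r ^+ 2) `^ lam * r)%:E.
  by move=> r0; rewrite lee_fin mulr_ge0// powR_ge0.
have ndF : nondecreasing_seq (fun n => `[0%R, b n]%classic).
  apply/nondecreasing_seqP => n; apply/subsetPset => r /=; rewrite !in_itv/=.
  move=> /andP[-> /le_trans]; apply; rewrite lerD2l lerN2 lef_pV2 ?posrE//.
  by rewrite ler_nat.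
have mh n : measurable_fun `[0%R, b n] (fun r : R => ((1 - r ^+ 2) `^ lam * r)%:E).
  by apply/measurable_EFinP; exact: measurable_funTS.
have nnh n (r : R) : `[0%R, b n]%classic r -> 0 <= ((1 - r ^+ 2) `^ lam * r)%:E.
  by rewrite /= in_itv/= => /andP[r0 _]; exact: nn.
have cv : \int[leb]_(r in `[0%R, b n]) ((1 - r ^+ 2) `^ lam * r)%:E @[n --> \oo] -->
    \int[leb]_(r in `[0%R, 1%R[) ((1 - r ^+ 2) `^ lam * r)%:E.
  rewrite U; apply: ge0_nondecreasing_set_cvg_integral => //.
rewrite -(cvg_lim _ cv)//; apply: lime_le; first exact: cvgP cv.
by apply: nearW => n; exact: integral_prim_le.
Qed.

Lemma integral_ball_weight n : (0 < n)%N ->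
  \int[lebesgue_complex R n]_(z in cball R n)
    ((1 - cnorm z ^+ 2) `^ lam)%:E < +oo.
Proof.
move=> n0; pose h (r : R) := (\1_(`]-oo, 1%R[) r * (1 - r ^+ 2) `^ lam)%R.
have mh : measurable_fun setT h.
  apply: measurable_funM => //.
  apply: (@measurable_fun_comp _ _ _ _ _ _ (fun x : R => x `^ lam)%R
    (fun r : R => 1 - r ^+ 2)%R); first exact: measurable_powR.
  by apply: measurable_funB => //; exact: measurable_funX.
have h0 r : (0 <= h r)%R by rewrite mulr_ge0// powR_ge0.
pose al : 'cV[nat]_n := 0%R.
have := integral_radial_monomial al n0 mh h0.
rewrite (_ : \int[lebesgue_complex R n]_z _ =
   \int[lebesgue_complex R n]_(z in cball R n) ((1 - cnorm z ^+ 2) `^ lam)%:E).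
  move=> ->; rewrite sphere_momentE//; apply: lte_mul_pinfty => //.
  - apply: integral_ge0 => r; rewrite /= in_itv/= andbT => r0.
    by rewrite lee_fin mulr_ge0// exprn_ge0// ltW.
  - rewrite ge0_fin_numE; last first.
      apply: integral_ge0 => r; rewrite /= in_itv/= andbT => r0.
      by rewrite lee_fin mulr_ge0// exprn_ge0// ltW.
    apply: le_lt_trans integral_bergman_radial.
    rewrite integral_mkcond [leRHS]integral_mkcond; apply: ge0_le_integral => //.
    + move=> r _; apply: erestrict_ge0 => {}r; rewrite /= in_itv/= andbT => r0.
      by rewrite lee_fin mulr_ge0// exprn_ge0// ltW.
    + apply/(measurable_restrictT _ _).1 => //; apply/measurable_EFinP/measurable_funTS.
      by apply: measurable_funM => //; exact: measurable_funX.
    + apply/(measurable_restrictT _ _).1 => //.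
      by apply/measurable_EFinP; exact: measurable_funTS.
    move=> r _; rewrite !patchE; case: ifPn => [|_]; last first.
      case: ifPn => //; rewrite inE/= in_itv/= => /andP[r0 _].
      by rewrite lee_fin mulr_ge0// powR_ge0.
    rewrite inE/= in_itv/= andbT => r0; rewrite /h indicE.
    case: (boolP (r \in `]-oo, _[%classic)) => [|_]; last first.
      rewrite !mul0r; case: ifPn => //; rewrite inE/= in_itv/= => /andP[r0' _].
      by rewrite lee_fin mulr_ge0// powR_ge0.
    rewrite inE/= in_itv/= => r1; rewrite mem_set/=; last by rewrite in_itv/= r1 ltW.
    (* Below 1 the Jacobian [r ^+ (2 * n - 1)] is at most [r], its exponent being at least 1. *)
    rewrite mul1r lee_fin ler_wpM2l ?powR_ge0// -[leRHS]expr1 ler_wiXn2l ?ltW//.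
    by rewrite subn_gt0; apply: leq_trans (leq_addr _ _); exact: (leq_pmulr 2 n0).
  - by rewrite ltry.
rewrite [RHS]integral_mkcond epatch_indic; apply: eq_integral => z _.
rewrite normc_monomial big1 => [|i _]; last by rewrite mxE expr0.
by rewrite expr1n mulr1 /h mulrC EFinM; congr (_ * _%:E).
Qed.

End bergman_weight_theory.

(** * Square integrability and the projection *)

Section bergman_projection_theory.
Variables (R : realType) (n : nat) (lam : R).
Hypotheses (n_gt0 : (0 < n)%N) (lam_gtN1 : -1 < lam).
Local Notation mu := (lebesgue_complex R n).
Local Notation ball := (cball R n).
Local Notation w := (bergman_weight lam).

Lemma c_lambda_ge0 : 0 <= c_lambda n lam.
Proof.
have G0 (s : R) : 0 <= Gamma s.
  by apply: Rintegral_ge0 => t _; rewrite mulr_ge0 ?powR_ge0 ?expR_ge0.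
by rewrite divr_ge0// mulr_ge0// exprn_ge0// pi_ge0.
Qed.

Lemma bergman_weight_ge0 (z : 'cV[R[i]]_n) : 0 <= w z.
Proof. by rewrite mulr_ge0 ?powR_ge0// c_lambda_ge0. Qed.

Lemma measurable_ball_weight :
  measurable_fun setT (fun z : 'cV[R[i]]_n => (1 - cnorm z ^+ 2) `^ lam).
Proof.
apply: (@measurable_fun_comp _ _ _ _ _ _ (fun x : R => x `^ lam)
  (fun z : 'cV[R[i]]_n => 1 - cnorm z ^+ 2)); first exact: measurable_powR.
by apply: measurable_funB => //; apply: measurable_funX; exact: measurable_cnorm.
Qed.

Lemma measurable_bergman_weight : measurable_fun setT (@bergman_weight R n lam).
Proof. by apply: measurable_funM => //; exact: measurable_ball_weight. Qed.

Lemma bergman_weight_lty : (\int[mu]_(z in ball) (w z)%:E < +oo)%E.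
Proof.
under eq_integral do rewrite EFinM.
rewrite ge0_integralZl_EFin ?c_lambda_ge0//.
- apply: lte_mul_pinfty; rewrite ?lee_fin ?c_lambda_ge0//.
  exact: integral_ball_weight.
- exact: measurable_cball.
- by move=> z _; rewrite lee_fin powR_ge0.
- by apply/measurable_EFinP; apply: measurable_funTS; exact: measurable_ball_weight.
Qed.

Lemma L2_lambda_bounded (f : 'cV[R[i]]_n -> R[i]) (M : R) :
  measurable_fun ball f ->
  {ae mu, forall z, ball z -> Normc.normc (f z) <= M} -> L2_lambda lam f.
Proof.
move=> mf fM; split=> //.
have mw := measurable_funTS (D := ball) measurable_bergman_weight.
apply: (@le_lt_trans _ _ (\int[mu]_(z in ball) ((M ^+ 2)%:E * (w z)%:E))%E); last first.
  rewrite ge0_integralZl_EFin ?sqr_ge0//.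
  - by apply: lte_mul_pinfty; rewrite ?lee_fin ?sqr_ge0//; exact: bergman_weight_lty.
  - exact: measurable_cball.
  - by move=> z _; rewrite lee_fin bergman_weight_ge0.
  - exact/measurable_EFinP.
apply: ae_ge0_le_integral.
- exact: measurable_cball.
- by move=> z _; rewrite lee_fin mulr_ge0 ?sqr_ge0// bergman_weight_ge0.
- apply/measurable_EFinP; apply: measurable_funM => //.
  by apply: measurable_funX; exact: measurable_normc.
- by move=> z _; rewrite -EFinM lee_fin mulr_ge0 ?sqr_ge0// bergman_weight_ge0.
- by apply: emeasurable_funM => //; exact/measurable_EFinP.
apply: filterS fM => z fM Bz; rewrite -EFinM lee_fin ler_wpM2r ?bergman_weight_ge0//.
by rewrite lerXn2r// ?nnegrE ?normc_ge0 ?(le_trans (normc_ge0 _) (fM Bz))// fM.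
Qed.

Lemma normc_monomial_le1 (alpha : 'cV[nat]_n) (z : 'cV[R[i]]_n) :
  ball z -> Normc.normc (monomial alpha z) <= 1.
Proof.
move=> zB; rewrite normc_monomial; apply: prodr_ile1 => i _.
rewrite exprn_ge0 ?normc_ge0//= exprn_ile1 ?normc_ge0//.
apply: le_trans (ltW zB); rewrite -[leLHS]ger0_norm ?normc_ge0// -sqrtr_sqr.
rewrite /cnorm ler_wsqrtr// (bigD1 i)//= lerDl sumr_ge0// => l _.
exact: sqr_ge0.
Qed.

Lemma monomial_bergman (alpha : 'cV[nat]_n) : bergman_space lam (@monomial R n alpha).
Proof.
split; first by move=> z _; exact: differentiable_monomial.
apply: (@L2_lambda_bounded _ 1).
  by apply: measurable_funTS; exact: measurable_monomial.
by apply: aeW => z zB; exact: normc_monomial_le1.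
Qed.

Lemma normc_ge_Re (x : R[i]) : `|complex.Re x| <= Normc.normc x.
Proof.
by case: x => a b /=; rewrite -sqrtr_sqr ler_sqrt ?addr_ge0 ?sqr_ge0// lerDl sqr_ge0.
Qed.

Lemma normc_ge_Im (x : R[i]) : `|complex.Im x| <= Normc.normc x.
Proof.
by case: x => a b /=; rewrite -sqrtr_sqr ler_sqrt ?addr_ge0 ?sqr_ge0// lerDr sqr_ge0.
Qed.

Lemma normc_conjc (x : R[i]) : Normc.normc x^*%C = Normc.normc x.
Proof. by case: x => a b /=; rewrite sqrrN. Qed.

Let measurable_inner (f h : 'cV[R[i]]_n -> R[i]) :
  measurable_fun ball f -> measurable_fun ball h ->
  measurable_fun ball (fun z => f z * (h z)^*%C * (w z)%:C%C).
Proof.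
move=> mf mh; apply: measurable_complexM.
  by apply: measurable_complexM => //; exact: measurable_conjc.
apply: measurable_real_complex; apply: measurable_funTS.
exact: measurable_bergman_weight.
Qed.

(** The product [|f| * |h|] is dominated by [|f|^2 + |h|^2]. The map [p] stands for the real or the
    imaginary part. *)
Lemma integrable_inner (f h : 'cV[R[i]]_n -> R[i]) (p : R[i] -> R) :
  L2_lambda lam f -> L2_lambda lam h ->
  (forall x, `|p x| <= Normc.normc x) ->
  (forall g, measurable_fun ball g -> measurable_fun ball (p \o g)) ->
  mu.-integrable ball (EFin \o p \o (fun z => f z * (h z)^*%C * (w z)%:C%C)).
Proof.
move=> [mf foo] [mh hoo] pn mp.
have mw := measurable_funTS (D := ball) measurable_bergman_weight.
have sq (g : 'cV[R[i]]_n -> R[i]) : measurable_fun ball g ->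
    (\int[mu]_(z in ball) (Normc.normc (g z) ^+ 2 * w z)%:E < +oo)%E ->
    mu.-integrable ball (fun z => (Normc.normc (g z) ^+ 2 * w z)%:E).
  move=> mg goo; apply/integrableP; split.
    apply/measurable_EFinP; apply: measurable_funM => //.
    by apply: measurable_funX; exact: measurable_normc.
  rewrite (eq_integral (fun z => (Normc.normc (g z) ^+ 2 * w z)%:E))// => z _.
  by rewrite gee0_abs// lee_fin mulr_ge0 ?sqr_ge0// bergman_weight_ge0.
have D := integrableD (@measurable_cball R n) (sq _ mf foo) (sq _ mh hoo).
apply: le_integrable D; first exact: (@measurable_cball R n).
  by apply/measurable_EFinP; apply: mp; exact: measurable_inner.
move=> z _ /=; rewrite lee_fin; apply: le_trans (pn _) _.
have s0 : 0 <= Normc.normc (f z) ^+ 2 + Normc.normc (h z) ^+ 2.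
  by rewrite addr_ge0 ?sqr_ge0.
have w0 := bergman_weight_ge0 z.
rewrite -mulrDl [leRHS]ger0_norm; last exact: mulr_ge0.
rewrite mulrC normc_realM (ger0_norm w0) mulrC.
apply: ler_wpM2r => //; rewrite Normc.normcM normc_conjc.
have := normc_ge0 (f z); have := normc_ge0 (h z).
by move: (Normc.normc _) (Normc.normc _) => x y; nra.
Qed.

(** Orthogonality concerns the single integrand [(g - B g)] times the conjugate of [h]. Splitting it
    into two integrals rests on [integrable_inner], since [Rintegral] is additive on integrable
    functions. *)
Lemma bergman_projection_inner B (g h : 'cV[R[i]]_n -> R[i]) :
  bergman_projection lam B -> L2_lambda lam g -> bergman_space lam h ->
  inner_lambda lam (B g) h = inner_lambda lam g h.
Proof.
move=> PB Lg bh; have [[_ LB] orth] := PB _ Lg; have Lh := bh.2.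
have := orth _ bh; rewrite /inner_lambda /Cintegral.
have part (p : R[i] -> R) : (forall x y, p (x - y) = p x - p y) ->
    (forall x, `|p x| <= Normc.normc x) ->
    (forall g, measurable_fun ball g -> measurable_fun ball (p \o g)) ->
    Rintegral mu ball (fun z => p ((g z - B g z) * (h z)^*%C * (w z)%:C%C)) =
    Rintegral mu ball (fun z => p (g z * (h z)^*%C * (w z)%:C%C)) -
    Rintegral mu ball (fun z => p (B g z * (h z)^*%C * (w z)%:C%C)).
  move=> pB pn mp; rewrite -RintegralB.
  - by apply: eq_Rintegral => z _; rewrite !mulrBl pB.
  - exact: measurable_cball.
  - exact: (integrable_inner Lg Lh pn mp).
  - exact: (integrable_inner LB Lh pn mp).
move=> [] /eqP; rewrite part; last 3 first.
- by move=> [? ?] [? ?].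
- exact: normc_ge_Re.
- by move=> ? ?; exact: measurable_Re_comp.
rewrite subr_eq0 => /eqP ReE /eqP; rewrite part; last 3 first.
- by move=> [? ?] [? ?].
- exact: normc_ge_Im.
- by move=> ? ?; exact: measurable_Im_comp.
by rewrite subr_eq0 => /eqP ImE; rewrite ReE ImE.
Qed.

End bergman_projection_theory.

(** * Block decomposition of monomials and norms *)

Lemma big_blocks (T : Type) (idx : T) (op : Monoid.com_law idx) m
    (k : 'I_m -> nat) (F : 'I_(\sum_(l < m) k l) -> T) :
  \big[op/idx]_s F s = \big[op/idx]_l \big[op/idx]_(i < k l) F (tagnat.Rank l i).
Proof.
rewrite [RHS]sig_big_dep (reindex _ (@tagnat.sig_bij_on _ k))/=.
by apply: eq_bigr => s _; rewrite -[in LHS](tagnat.sig2K s).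
Qed.

Section blocks.
Variables (R : realType) (m : nat) (k : 'I_m -> nat) (j : 'I_m).
Local Notation N := (\sum_(l < m) k l)%N.

Lemma monomial_blocks (alpha : 'cV[nat]_N) (z : 'cV[R[i]]_N) :
  monomial alpha z = \prod_l monomial (submxcol alpha l) (submxcol z l).
Proof.
rewrite /monomial big_blocks; apply: eq_bigr => l _; apply: eq_bigr => i _.
by rewrite !mxE.
Qed.

Lemma rnorm_block_norms (z : 'cV[R[i]]_N) : rnorm (block_norms z) = cnorm z.
Proof.
rewrite /rnorm /cnorm; congr Num.sqrt; rewrite [RHS]big_blocks.
apply: eq_bigr => l _; rewrite mxE cnorm_sqr; apply: eq_bigr => i _.
by rewrite mxE.
Qed.

Lemma conjc_monomial n (alpha : 'cV[nat]_n) (z : 'cV[R[i]]_n) :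
  (monomial alpha z)^*%C = monomial alpha (map_mx conjc z).
Proof.
rewrite /monomial rmorph_prod; apply: eq_bigr => i _.
by rewrite rmorphXn mxE.
Qed.

Lemma mulc_conjc (x : R[i]) : x * x^*%C = (Normc.normc x ^+ 2)%:C%C.
Proof.
rewrite normcE; case: x => a b; apply/eqP; rewrite eq_complex/=; apply/andP.
by split; apply/eqP; ring.
Qed.

Lemma measurable_tau_ball : measurable (tau_ball R m).
Proof.
rewrite (_ : tau_ball R m = (\big[setI/setT]_l
    (fun r : 'cV[R]_m => r l 0) @^-1` `[0, +oo[) `&` @rnorm R m @^-1` `]-oo, 1[).
  apply: measurableI.
    apply: bigsetI_measurable => l _; rewrite -[X in measurable X]setTI.
    exact: measurable_coord.
  by rewrite -[X in measurable X]setTI; exact: measurable_rnorm.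
apply/seteqP; split => r; rewrite /tau_ball/= -bigcap_seq.
  by move=> [r0 r1]; split => [l _|] /=; rewrite in_itv/= ?r0.
move=> [r0 r1]; split => [l|]; last by move: r1; rewrite /= in_itv.
by have /= := r0 l (mem_index_enum _); rewrite in_itv/= andbT.
Qed.

(** In polar coordinates on block [j] the exceptional set is [r = 0], which the open half-line
    leaves out. Off this set the direction of block [j] is a genuine unit vector. *)
Lemma negligible_block0 : (forall l, (0 < k l)%N) ->
  {ae lebesgue_complex R N, forall z, cnorm (submxcol z j) != 0}.
Proof.
move=> k_gt0; pose g l (z : 'cV[R[i]]_(k l)) : \bar R :=
  (if l == j then \1_[set 0] (cnorm z) else 1)%:E.
have m0 : measurable_fun setT (\1_[set 0] : R -> R) by exact: measurable_indic.
have mg l : measurable_fun setT (g l).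
  apply/measurable_EFinP; case: (l == j) => //.
  exact: (measurable_fun_comp m0 (@measurable_cnorm R _)).
have g0 l z : (0 <= g l z)%E by rewrite lee_fin; case: ifP.
have mE : measurable [set z : 'cV[R[i]]_N | cnorm (submxcol z j) = 0].
  rewrite (_ : [set _ | _] = (fun z : 'cV[R[i]]_N => cnorm (submxcol z j)) @^-1` [set 0])//.
  rewrite -[X in measurable X]setTI.
  exact: (measurable_fun_comp (@measurable_cnorm R _) (@measurable_submxcol _ _ m k j)).
exists [set z : 'cV[R[i]]_N | cnorm (submxcol z j) = 0]; split => //; last first.
  by move=> z /= /negP/negPn/eqP.
rewrite -[X in _ X = _]setIT -integral_indic//.
rewrite (eq_integral (fun z => \prod_l g l (submxcol z l)))%E; last first.
  move=> z _; rewrite prodEFin [X in _ = X%:E](bigD1 j)//= eqxx.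
  rewrite [X in (_ * X)%R]big1 ?mulr1// => l /negPf lj.
  by rewrite lj.
(* The other blocks may contribute an infinite factor; the product is still 0, by the convention
   [0 * +oo = 0]. *)
rewrite lebesgue_complex_blocks// (bigD1 j)//= [X in (X * _)%E](_ : _ = 0%E) ?mul0e//.
rewrite /g eqxx.
rewrite (@polar_complex_direction R _ (fun x => (\1_[set 0] x.1)%:E))//; last first.
  by apply/measurable_EFinP; exact: (@measurable_fun_comp _ _ _ _ _ _ _ fst m0).
rewrite integral0_eq// => r; rewrite /= in_itv/= andbT => r0.
rewrite integral0_eq ?mul0e// => xi _ /=; rewrite indicE memNset//=.
by apply/eqP; rewrite gt_eqF.
Qed.

End blocks.

(** A positive constant preserves infinite integrals, and [fine] sends both infinities to 0; so the
    constant comes out without integrability of the polar integrand having to be shown. *)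
Lemma Rintegral_nnegZl d (T : measurableType d) (R : realType)
    (mu : {measure set T -> \bar R}) (D : set T) (c : R) (f : T -> R) :
  measurable D -> measurable_fun D f -> 0 <= c ->
  Rintegral mu D (fun x => c * f x) = c * Rintegral mu D f.
Proof.
move=> mD mf; rewrite le_eqVlt => /predU1P[<-|c0].
  rewrite mul0r /Rintegral integral0_eq// => x _; rewrite mul0r//.
rewrite /Rintegral.
have mF : measurable_fun D (EFin \o f) by exact/measurable_EFinP.
have -> : (\int[mu]_(x in D) (c * f x)%:E = c%:E * \int[mu]_(x in D) (f x)%:E)%E.
  rewrite integralE [in RHS]integralE.
  have P (g : T -> \bar R) : measurable_fun D g -> (forall x, 0 <= g x)%E ->
      (\int[mu]_(x in D) (c%:E * g x) = c%:E * \int[mu]_(x in D) g x)%E.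
    by move=> mg g0; rewrite ge0_integralZl_EFin// ltW.
  have -> : (\int[mu]_(x in D) (fun x => (c * f x)%:E)^\+ x =
     c%:E * \int[mu]_(x in D) (EFin \o f)^\+ x)%E.
    rewrite -P//; last exact: measurable_funepos.
    apply: eq_integral => x _; rewrite !funeposE/= -!EFin_max -EFinM.
    by rewrite maxr_pMr ?mulr0// ltW.
  have -> : (\int[mu]_(x in D) (fun x => (c * f x)%:E)^\- x =
     c%:E * \int[mu]_(x in D) (EFin \o f)^\- x)%E.
    rewrite -P//; last exact: measurable_funeneg.
    apply: eq_integral => x _; rewrite !funenegE/= -!EFin_max -EFinM.
    by rewrite maxr_pMr ?mulr0 ?mulrN// ltW.
  have cy : (c%:E * +oo = +oo :> \bar R)%E by rewrite gt0_muley.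
  have cNy : (c%:E * -oo = -oo :> \bar R)%E by rewrite gt0_muleNy.
  move: (\int[mu]_(x in D) _)%E (\int[mu]_(x in D) _)%E => [p| |] [q| |];
    rewrite ?cy ?cNy//.
  exact: (congr1 EFin (esym (mulrBr _ _ _))).
move: (\int[mu]_(x in D) (f x)%:E)%E => [p| |]; rewrite ?gt0_muley ?gt0_muleNy ?lte_fin//=.
- by rewrite mulr0.
- by rewrite mulr0.
Qed.

Lemma conjc_realM (R : realType) (t : R) (x : R[i]) :
  (t%:C%C * x)^*%C = t%:C%C * x^*%C.
Proof.
case: x => x y; apply/eqP; rewrite eq_complex/=.
by apply/andP; split; apply/eqP; ring.
Qed.

(** * The coefficient as an integral over radii and one sphere *)

Section toeplitz_coefficients.
Variables (R : realType) (m : nat) (k : 'I_m -> nat) (j : 'I_m).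
Variables (a : 'cV[R[i]]_(\sum_(l < m) k l) -> R[i])
  (f : 'cV[R]_m * 'cV[R[i]]_(k j) -> R[i]).
Variables (lam : R) (kappa : 'I_m -> nat).
Variables alpha beta : 'cV[nat]_(\sum_(l < m) k l).
Hypothesis k_gt0 : forall l, (0 < k l)%N.
Hypothesis a_bounded : Linfty (lebesgue_complex R (\sum_(l < m) k l))
  (cball R (\sum_(l < m) k l)) a.
Hypothesis af : corresponding_function a f.
Hypothesis alpha_size : forall l, mi_size (submxcol alpha l) = kappa l.
Hypothesis beta_size : forall l, mi_size (submxcol beta l) = kappa l.
Hypothesis alpha_beta : forall l, l != j -> submxcol alpha l = submxcol beta l.

Local Notation N := (\sum_(l < m) k l)%N.
Local Notation mu := (lebesgue_complex R N).
Local Notation nu := (lebesgue_cV R m \x sphere_complex R (k j))%E.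
Local Notation D := (tau_ball R m `*` csphere R (k j)).
Local Notation alphas := (fun l => submxcol alpha l).

Let F0 (x : 'cV[R]_m * 'cV[R[i]]_(k j)) : R[i] :=
  f x * monomial (submxcol alpha j) x.2 *
  monomial (submxcol beta j) (map_mx conjc x.2).

Let radial (x : 'cV[R]_m * 'cV[R[i]]_(k j)) : R :=
  (1 - rnorm x.1 ^+ 2) `^ lam *
  \prod_(l < m) x.1 l 0 ^+ (2 * k l + 2 * kappa l - 1).

Let coef : R := c_lambda N lam * \prod_(l < m | l != j)
  (2 * pi ^+ k l * (mi_fact (submxcol alpha l))%:R / (k l + kappa l - 1)`!%:R).

Lemma measurable_polar_domain : measurable D.
Proof.
by apply: measurableX; [exact: measurable_tau_ball|exact: measurable_csphere].
Qed.

Let measurable_F0 : measurable_fun D F0.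
Proof.
have [[mf _] _ _] := af.
apply: measurable_complexM; first apply: measurable_complexM => //.
  apply: measurable_funTS.
  exact: (@measurable_fun_comp _ _ _ _ _ _ _ snd (@measurable_monomial R _ _)).
apply: measurable_funTS; under eq_fun do rewrite -conjc_monomial.
apply: measurable_conjc.
exact: (@measurable_fun_comp _ _ _ _ _ _ _ snd (@measurable_monomial R _ _)).
Qed.

Let measurable_ball_factor : measurable_fun setT (fun x : 'cV[R]_m * 'cV[R[i]]_(k j) =>
  (1 - rnorm x.1 ^+ 2) `^ lam).
Proof.
apply: (@measurable_fun_comp _ _ _ _ _ _ (fun t : R => t `^ lam)
  (fun x : 'cV[R]_m * 'cV[R[i]]_(k j) => 1 - rnorm x.1 ^+ 2)).
  exact: measurable_powR.
apply: measurable_funB => //; apply: measurable_funX.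
exact: (@measurable_fun_comp _ _ _ _ _ _ _ fst (@measurable_rnorm R m)).
Qed.

Let measurable_coord1 l : measurable_fun setT
  (fun x : 'cV[R]_m * 'cV[R[i]]_(k j) => x.1 l 0).
Proof. exact: (@measurable_fun_comp _ _ _ _ _ _ _ fst (measurable_coord l 0)). Qed.

(** The radii always meet the conditions of [tau_ball] when [z] is in the ball; the direction lies
    on the sphere exactly because block [j] does not vanish. *)
Lemma quasi_polar_map_domain (z : 'cV[R[i]]_N) : cnorm (submxcol z j) != 0 ->
  D (quasi_polar_map j z) <-> cball R N z.
Proof.
move=> z0; rewrite /quasi_polar_map /tau_ball /cball /=.
rewrite rnorm_block_norms; split=> [[[_ //]]|zB]; split.
  by split=> // l; rewrite mxE cnorm_ge0.
by rewrite /csphere/= cnormZ ger0_norm ?invr_ge0 ?cnorm_ge0// mulVf.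
Qed.

(** In block [j] the multi-indices may differ but have the same degree [kappa j], so homogeneity
    gives the power [2 * kappa j] of the norm. In the other blocks they are equal and give squared
    moduli. *)
Lemma symbol_quasi_polar (z : 'cV[R[i]]_N) :
  monomial alpha z * (monomial beta z)^*%C =
  monomial (submxcol alpha j) (quasi_polar_map j z).2 *
  monomial (submxcol beta j) (map_mx conjc (quasi_polar_map j z).2) *
  (cnorm (submxcol z j) ^+ (2 * kappa j) * monomial_weight j alphas z)%:C%C.
Proof.
rewrite !monomial_blocks (bigD1 j)//= [X in _ * X^*%C](bigD1 j)//=.
rewrite rmorphM/= mulrACA; rewrite [X in _ * X](_ : _ = (monomial_weight j alphas z)%:C%C).
  rewrite (monomial_direction (submxcol alpha j)) (monomial_direction (submxcol beta j)).
  rewrite conjc_realM alpha_size beta_size conjc_monomial.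
  have realM (s t u : R) : (s * t * u)%:C%C = s%:C%C * t%:C%C * u%:C%C.
    by rewrite !rmorphM.
  rewrite mul2n -addnn exprD realM.
  rewrite -[block_direction j z]/(cdirection (submxcol z j)).
  move: (_%:C%C) (monomial _ _) (monomial _ _) (_%:C%C) => t x y w.
  by ring.
rewrite rmorph_prod -big_split/= /monomial_weight rmorph_prod.
by apply: eq_bigr => l lj; rewrite -alpha_beta// mulc_conjc.
Qed.

(** [tau_ball] contains points with a zero radius, where the indicator in [radial_weight] is 0. The
    right-hand side vanishes there too, since [0 < k l] makes the exponents positive. *)
Lemma radial_weightE l (r : R) : 0 <= r -> radial_weight j alphas l r =
  if l == j then r ^+ (2 * k l - 1) else
  2 * pi ^+ k l * (mi_fact (submxcol alpha l))%:R / (k l + kappa l - 1)`!%:R *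
  r ^+ (2 * k l + 2 * kappa l - 1).
Proof.
rewrite /radial_weight alpha_size le_eqVlt => /predU1P[<-|r0].
  have e p : (0 < 2 * k l + p - 1)%N.
    by rewrite subn_gt0; apply: leq_trans (leq_addr _ _); exact: (leq_pmulr 2 (k_gt0 l)).
  rewrite indicE memNset/=; last by rewrite in_itv/= ltxx.
  have := e 0%N; rewrite addn0; have := e (2 * kappa l)%N => e1 e2.
  by rewrite mul0r !expr0n !gtn_eqF//= mulr0; case: ifP.
by rewrite indicE mem_set/= ?mul1r// in_itv/= r0.
Qed.

(** Stated for a real-linear part [p], to be the real or the imaginary part: the change of variables
    is for real integrands, and all factors other than [F0] are real. *)
Lemma integral_symbol_part (p : R[i] -> R) :
  (forall x t, p (x * t%:C%C) = p x * t) ->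
  (forall d (T : measurableType d) (E : set T) (g : T -> R[i]),
     measurable_fun E g -> measurable_fun E (fun x => p (g x))) ->
  Rintegral mu (cball R N) (fun z => p (a z * monomial alpha z *
    (monomial beta z)^*%C * (bergman_weight lam z)%:C%C)) =
  coef * Rintegral nu D (fun x => p (F0 x * (radial x)%:C%C)).
Proof.
move=> pZ mp; have [[mf _] _ ae_af] := af.
have mD := measurable_polar_domain.
have mpF : measurable_fun D (fun x => p (F0 x)) by exact: mp.
have coef0 : 0 <= coef.
  rewrite mulr_ge0 ?c_lambda_ge0// prodr_ge0// => l _.
  by rewrite divr_ge0 ?mulr_ge0 ?exprn_ge0 ?pi_ge0.
have mrad : measurable_fun setT radial.
  apply: measurable_funM => //; apply: measurable_prod => l _.
  by apply: measurable_funX; exact: measurable_coord1.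
rewrite -Rintegral_nnegZl//; last first.
  under eq_fun do rewrite pZ; apply: measurable_funM => //.
  exact: measurable_funTS.
(* The power of [x.1 j 0] belongs to [v] because neither [monomial_weight] nor the density contains
   the monomials of block [j]. Extension by 0 outside [D], as [u], yields a function measurable
   everywhere, [f] being known to be measurable on [D]. *)
pose v x : R := p (F0 x) * (1 - rnorm x.1 ^+ 2) `^ lam * c_lambda N lam *
  x.1 j 0 ^+ (2 * kappa j).
pose u := v \_ D.
have mu_ : measurable_fun setT u.
  apply: (measurable_restrictT _ _).1 => //; apply: measurable_funM; last first.
    by apply: measurable_funTS; apply: measurable_funX; exact: measurable_coord1.
  apply: measurable_funM => //; apply: measurable_funM => //.
  exact: measurable_funTS.
rewrite /Rintegral; congr fine.
transitivity (\int[mu]_z (u (quasi_polar_map j z) * monomial_weight j alphas z)%:E)%E.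
  (* The two integrands agree where [a] is given by [f] and block [j] is nonzero, that is, almost
     everywhere. *)
  rewrite integral_mkcond; apply: ae_eq_integral => //.
  - apply/(measurable_restrictT _ _).1; first exact: measurable_cball.
    apply/measurable_EFinP; apply: mp; apply: measurable_complexM; last first.
      by apply: measurable_real_complex; apply: measurable_funTS; exact: measurable_bergman_weight.
    apply: measurable_complexM; last first.
      by apply: measurable_conjc; apply: measurable_funTS; exact: measurable_monomial.
    apply: measurable_complexM; first by have [] := a_bounded.
    by apply: measurable_funTS; exact: measurable_monomial.
  - apply/measurable_EFinP; apply: measurable_funM.
      exact: (measurable_fun_comp mu_ (@measurable_quasi_polar_map R m k j)).
    exact: measurable_monomial_weight.
  have ae0 := @negligible_block0 R m k j k_gt0.
  apply: filterS2 ae_af ae0 => z zf z0 _; have DB := quasi_polar_map_domain z0.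
  rewrite /u !patchE; case: ifPn => [|]; last first.
    rewrite notin_setE => zB; rewrite memNset ?mul0r//; first by move/DB.
  rewrite inE => zB; rewrite mem_set; last exact/DB.
  congr EFin; rewrite (zf zB) -[X in p (X * _)]mulrA symbol_quasi_polar.
  rewrite /v /F0 pZ mulrA pZ rnorm_block_norms -/(quasi_polar_map j z) /=.
  rewrite !mulrA /bergman_weight mxE; ring.
rewrite integral_quasi_polar// [RHS]integral_mkcond.
apply: eq_integral => x _; rewrite /u !patchE; case: ifPn => [|_]; last by rewrite mul0r.
rewrite inE => -[[r0 _] /= x2]; congr EFin.
rewrite /quasi_polar_density indicE mem_set// mulr1 pZ /v /radial /coef.
under eq_bigr do rewrite radial_weightE//.
move: (c_lambda _ _) => c; rewrite (bigD1 j)//= eqxx [X in _ = _ * (_ * (_ * X))](bigD1 j)//=.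
rewrite (eq_bigr (fun l => (2 * pi ^+ k l * (mi_fact (submxcol alpha l))%:R /
   (k l + kappa l - 1)`!%:R) * x.1 l 0 ^+ (2 * k l + 2 * kappa l - 1))); last first.
  by move=> l /negPf ->.
(* For block [j] the power [2 * kappa j] held in [v] and the Jacobian power [2 * k j - 1] held in
   the density add up to the exponent of [radial]. *)
rewrite big_split/= (_ : 2 * k j + 2 * kappa j - 1 = 2 * kappa j + (2 * k j - 1))%N.
  by rewrite exprD; ring.
by rewrite addnC addnBA// muln_gt0 k_gt0.
Qed.

Lemma coefE : coef = 2 ^+ m.-1 * Gamma (N%:R + lam + 1) *
    (\prod_(l < m | l != j) mi_fact (submxcol alpha l))%:R /
  (pi ^+ k j * Gamma (lam + 1) *
    (\prod_(l < m | l != j) (k l + kappa l - 1)`!)%:R).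
Proof.
rewrite /coef !big_split/= prodfV prodr_const cardC1 card_ord.
rewrite /c_lambda !natr_prod.
have -> : (pi : R) ^+ N = pi ^+ k j * pi ^+ (\sum_(l < m | l != j) k l).
  by rewrite [X in _ ^+ X](bigD1 j)//= exprD.
rewrite -prodrXr; set P := \prod_(l < m | l != j) pi ^+ k l.
have P0 : P != 0 by apply/prodf_neq0 => l _; rewrite expf_neq0// gt_eqF ?pi_gt0.
have p0 : pi ^+ k j != 0 :> R by rewrite expf_neq0// gt_eqF ?pi_gt0.
(* The inverses of [Gamma (lam + 1)] and of the factorials become variables, so that [field] asks
   only for powers of [pi] to be nonzero. *)
rewrite !invfM; move: (Gamma (lam + 1))^-1 (\prod_(l < m | l != j) _`!%:R)^-1 => u v.
by field; rewrite P0 p0.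
Qed.

End toeplitz_coefficients.

Theorem theorem7p3 (R : realType) (m : nat) (k : 'I_m -> nat) (j : 'I_m)
    (a : 'cV[R[i]]_(\sum_(l < m) k l) -> R[i])
    (f : 'cV[R]_m * 'cV[R[i]]_(k j) -> R[i]) :
  (2 <= m)%N -> (forall l, (0 < k l)%N) ->
  Linfty (lebesgue_complex R (\sum_(l < m) k l))
    (cball R (\sum_(l < m) k l)) a ->
  quasi_radial_quasi_homogeneous j a ->
  corresponding_function a f ->
  forall (lam : R) (kappa : 'I_m -> nat), -1 < lam ->
  forall B, bergman_projection lam B ->
  forall alpha beta : 'cV[nat]_(\sum_(l < m) k l),
  (forall l, mi_size (submxcol alpha l) = kappa l) ->
  (forall l, mi_size (submxcol beta l) = kappa l) ->
  (forall l, l != j -> submxcol alpha l = submxcol beta l) ->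
  inner_lambda lam (toeplitz B a (monomial alpha)) (monomial beta) =
  (2 ^+ m.-1 * Gamma ((\sum_(l < m) k l)%:R + lam + 1) *
     (\prod_(l < m | l != j) mi_fact (submxcol alpha l))%:R /
   (pi ^+ k j * Gamma (lam + 1) *
     (\prod_(l < m | l != j) (k l + kappa l - 1)`!)%:R))%:C%C *
  Cintegral (lebesgue_cV R m \x sphere_complex R (k j))%E
    (tau_ball R m `*` csphere R (k j))
    (fun x => f x * monomial (submxcol alpha j) x.2 *
              monomial (submxcol beta j) (map_mx conjc x.2) *
              ((1 - rnorm x.1 ^+ 2) `^ lam *
               \prod_(l < m) x.1 l 0 ^+ (2 * k l + 2 * kappa l - 1))%:C%C).
Proof.
move=> _ k_gt0 a_bounded _ af lam kappa lam_gtN1 B PB alpha beta alpha_size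
  beta_size alpha_beta.
have N_gt0 : (0 < \sum_(l < m) k l)%N.
  by rewrite (bigD1 j)//= addn_gt0 k_gt0.
(* The projection can be removed since [a] is essentially bounded and monomials have modulus at most
   1 on the ball, which puts [a * z^alpha] in L^2. *)
rewrite /toeplitz (bergman_projection_inner PB); last 2 first.
- have [ma [M aM]] := a_bounded; apply: (@L2_lambda_bounded R _ lam N_gt0 lam_gtN1 _ M).
    apply: measurable_complexM => //.
    by apply: measurable_funTS; exact: measurable_monomial.
  apply: filterS aM => z aM zB; rewrite Normc.normcM.
  apply: le_trans (aM zB); rewrite ler_piMr ?normc_ge0//.
  exact: normc_monomial_le1.
- exact: monomial_bergman.
have part := integral_symbol_part lam k_gt0 a_bounded af alpha_size
  beta_size alpha_beta.
rewrite /inner_lambda /Cintegral.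
rewrite (part (@complex.Re R)); last 2 first.
- by case=> x y t /=; rewrite mulr0 subr0.
- by move=> ? ? ? ?; exact: measurable_Re_comp.
rewrite (part (@complex.Im R)); last 2 first.
- by case=> x y t /=; rewrite mulr0 add0r.
- by move=> ? ? ? ?; exact: measurable_Im_comp.
rewrite (coefE j lam kappa alpha).
by apply/eqP; rewrite eq_complex/= !mul0r subr0 addr0 !eqxx.
Qed.
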